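(* Let $\gamma>0$ be a real number, $C\ge 1$ an integer, and let $(G_{n,j})_{n\in\mathbb N,\,j\in[n]}$ be finite connected graphs, each with at least one edge, such that for every $n\in\mathbb N$ and every $j\in[n]$ we have $\Delta(G_{n,j})\le C$ and $i(G_{n,j})\ge n^{-\gamma}$. For each $n$ let $G=G_{[n]}=G_{n,1}\square G_{n,2}\square\cdots\square G_{n,n}$ and let $\overline d=\overline d(G_{[n]})$ be its average degree. Fix $\varepsilon\in(0,1)$. Then: (a) if $p=(1-\varepsilon)/\overline d$, then asymptotically almost surely (as $n\to\infty$) $$L_1(G_p)\le \exp\left(-\frac{\varepsilon^2 n}{9C^2}\right)|V(G)|;$$ (b) if $p=(1+\varepsilon)/\overline d$, then there is a positive constant $c_1=c_1(\varepsilon,\gamma,C)$ (depending only on $\varepsilon,\gamma,C$) such that asymptotically almost surely (as $n\to\infty$) $$L_1(G_p)\ge c_1|V(G)|.$$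
   Context: $[n]=\{1,\dots,n\}$. For a graph $H$: $\Delta(H)$ is its maximum degree, $\overline d(H)=\frac{1}{|V(H)|}\sum_{v\in V(H)}\deg_H(v)$ is its average degree, and $L_1(H)$ is the number of vertices of its largest connected component. For $|V(H)|\ge 2$ the isoperimetric constant is $$i(H)=\min_{S\subseteq V(H),\ 1\le|S|\le|V(H)|/2}\frac{|\partial S|}{|S|},$$ where $\partial S$ is the set of edges of $H$ between $S$ and $V(H)\setminus S$. The Cartesian product $G_1\square\cdots\square G_n$ has vertex set $V(G_1)\times\cdots\times V(G_n)$, and $(u_1,\dots,u_n)$ and $(v_1,\dots,v_n)$ are adjacent iff there is $i\in[n]$ with $u_iv_i\in E(G_i)$ and $u_j=v_j$ for all $j\ne i$. $G_p$ denotes the random subgraph of $G$ on the same vertex set obtained by $p$-percolation: each edge of $G$ is retained with probability $p$ and deleted with probability $1-p$, independently of all other edges. A sequence of events $(A_n)$ holds asymptotically almost surely if $\mathbb P_n(A_n)\to1$ as $n\to\infty$. *)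

(* Defs.v *)
From HB Require Import structures.
From mathcomp Require Import all_boot all_order all_algebra.
From mathcomp Require Import all_classical all_reals all_analysis.

Set Implicit Arguments.
Unset Strict Implicit.
Unset Printing Implicit Defensive.

Import Order.TTheory GRing.Theory Num.Theory.

(* Only %R is opened: [set ... | ...] is finset's notation unless it carries %classic. *)
Local Open Scope ring_scope.

Record sgraph := SGraph {
  vertex :> finType;
  adj : rel vertex;
  adj_sym : symmetric adj;
  adj_irr : irreflexive adj
}.

Section Graphs.
Variable H : sgraph.

Definition edges : {set {set H}} :=
  [set e | [exists x, exists y, adj x y && (e == [set x; y])]].

Definition deg (v : H) : nat := #|[set u | adj v u]|.

Definition max_degree : nat := \max_(v : H) deg v.

Definition connected_graph : Prop :=
  (0 < #|H|)%N /\ forall x y : H, connect (@adj H) x y.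

Definition component (x : H) : {set H} := [set y | connect (@adj H) x y].

Definition L1 : nat := \max_(x : H) #|component x|.

Definition edge_boundary (S : {set H}) : {set {set H}} :=
  [set e in edges | [exists x in S, exists y in ~: S, e == [set x; y]]].

Definition iso_admissible (S : {set H}) : bool :=
  (0 < #|S|)%N && (2 * #|S| <= #|H|)%N.

Variable R : realType.

Definition avg_degree : R := (\sum_(v : H) deg v)%:R / #|H|%:R.

Definition iso_ratio (S : {set H}) : R := #|edge_boundary S|%:R / #|S|%:R.

(* For #|H| >= 2 this infimum is a minimum over a nonempty finite set, see
   [iso_constP]; for #|H| < 2 it is the junk value [inf set0]. *)
Definition iso_const : R :=
  inf [set iso_ratio S | S in [set S : {set H} | iso_admissible S]]%classic.

Lemma iso_constP : (2 <= #|H|)%N ->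
  (exists2 S, iso_admissible S & iso_const = iso_ratio S) /\
  (forall S, iso_admissible S -> iso_const <= iso_ratio S).
Proof.
move=> H2; have /card_gt0P[x _] : (0 < #|H|)%N by apply: leq_trans H2.
have a0 : iso_admissible [set x] by rewrite /iso_admissible cards1 muln1.
case: (@Order.TotalTheory.arg_minP _ _ _ [set x] iso_admissible iso_ratio a0).
move=> S aS Smin.
suff E : iso_const = iso_ratio S.
  by split=> [|S' aS']; [exists S | rewrite E; exact: Smin].
apply/eqP; rewrite eq_le; apply/andP; split.
  apply: ge_inf; last by exists S.
  by exists (iso_ratio S) => _ [S' aS' <-]; exact: Smin.
apply: lb_le_inf; first by exists (iso_ratio S); exists S.
by move=> _ [S' aS' <-]; exact: Smin.
Qed.

End Graphs.

Section CartesianProduct.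
Variables (n : nat) (G : 'I_n -> sgraph).

Definition cart_adj : rel {dffun forall i : 'I_n, G i} := fun u v =>
  [exists i, adj (u i) (v i) && [forall j, (j != i) ==> (u j == v j)]].

Lemma cart_adj_sym : symmetric cart_adj.
Proof.
move=> u v; apply: eq_existsb => i; rewrite adj_sym.
by under eq_forallb do rewrite [u _ == _]eq_sym.
Qed.

Lemma cart_adj_irr : irreflexive cart_adj.
Proof. by move=> u; apply/negbTE/existsPn => i; rewrite adj_irr. Qed.

Definition cart_prod : sgraph := SGraph cart_adj_sym cart_adj_irr.

End CartesianProduct.

Section Percolation.
Variable G : sgraph.

Definition sub_adj (F : {set {set G}}) : rel G :=
  fun x y => adj x y && ([set x; y] \in F).

Lemma sub_adj_sym F : symmetric (sub_adj F).
Proof. by move=> x y; rewrite /sub_adj adj_sym finset.setUC. Qed.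

Lemma sub_adj_irr F : irreflexive (sub_adj F).
Proof. by move=> x; rewrite /sub_adj adj_irr. Qed.

Definition spanning_subgraph (F : {set {set G}}) : sgraph :=
  SGraph (sub_adj_sym F) (sub_adj_irr F).

Variables (R : realType) (p : R).

(* Probability that F is exactly the set of retained edges. These weights always
   sum to 1 ([perc_prob_total]) and are nonnegative when 0 <= p <= 1. *)
Definition perc_weight (F : {set {set G}}) : R :=
  \prod_(e in edges G) (if e \in F then p else 1 - p).

Definition perc_prob (A : pred sgraph) : R :=
  \sum_(F in powerset (edges G) | A (spanning_subgraph F)) perc_weight F.

Lemma perc_prob_total : perc_prob predT = 1.
Proof.
rewrite /perc_prob /perc_weight.
pose f e := if e \in edges G then p else 0.
pose g e := if e \in edges G then 1 - p else 1.
have fg1 : \prod_e (f e + g e) = 1.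
  apply: big1 => e _; rewrite /f /g; case: ifP => _; last by rewrite add0r.
  by rewrite addrC subrK.
pose sub_edges := [pred F : {set {set G}} | F \subset edges G].
rewrite -[RHS]fg1 bigA_distr [RHS](bigID sub_edges) /=.
rewrite [X in _ = _ + X]big1 ?addr0 => [|F /fintype.subsetPn[e eF eE]]; last first.
  by rewrite (bigD1 e) //= eF /f (negbTE eE) mul0r.
apply: eq_big => [F|F]; first by rewrite powersetE andbT.
rewrite powersetE andbT => /fintype.subsetP FE.
rewrite big_mkcond; apply: eq_bigr => e _.
by rewrite /f /g; case: ifP => eE; case: ifP => // /FE; rewrite eE.
Qed.

End Percolation.

Definition admissible_factors (R : realType) (gamma : R) (C : nat)
    (G : forall n : nat, 'I_n -> sgraph) : Prop :=
  forall (n : nat) (j : 'I_n),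
    [/\ connected_graph (G n j),
        (1 <= #|edges (G n j)|)%N,
        (max_degree (G n j) <= C)%N
      & n%:R `^ (- gamma) <= iso_const (G n j) R].

(* Main.v *)
(** In the subcritical case a vertex of degree at most [d + 2 eps n / 3] has, up to depth
    of order [eps n / C], only vertices of degree [d + O(eps n)] around it, so the expected
    number of open self-avoiding walks from it decays; a component of size [M] then needs
    either an open walk of linear length, which is exponentially unlikely, or [M] endpoints
    of short walks, which Markov's inequality forbids. By Chernoff's bound only an
    exponentially small proportion of vertices has larger degree.

    In the supercritical case write [1 - p = (1 - p1) (1 - p2)] with [p1] still supercritical
    and [p2] of order [eps / d]. Reserve [K + 1] blocks of [m = delta n] coordinates.
    Exploring a cluster in the remaining coordinates beats a supercritical branching
    process until [m] vertices are found, so this succeeds with probability bounded below.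
    Each of the first [K] blocks then multiplies the cluster size by order [n]: moving in
    one coordinate of the block leads to [m] disjoint fibers, each of which is entered and
    contains a fresh large cluster, independently, with probability bounded below. The last
    block shows that all but an exponentially small proportion of vertices have order [n]
    neighbours in clusters of size at least of order [n ^ (K + 1)]. Finally the [p2]-edges
    merge these clusters: were there no component of linear size, the giant vertices would
    split into two linear-size unions of clusters with no [p2]-path in between, but by
    isoperimetry of the product there are [|V| / n ^ O(1)] edge-disjoint paths of length at
    most 3 joining any two such unions, and there are only [2 ^ (|V| / n ^ (K + 1))] ways
    to split. *)

From mathcomp Require Import all_classical all_reals all_analysis.
From mathcomp Require Import all_boot all_order all_algebra.
From mathcomp Require Import ring lra zify.
Require Import Defs.

Set Implicit Arguments.
Unset Strict Implicit.
Unset Printing Implicit Defensive.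

Import Order.TTheory GRing.Theory Num.Theory.
Import numFieldNormedType.Exports.
Local Open Scope ring_scope.

(** * Bernoulli product measures *)

Section BernoulliProduct.
Variables (R : realType) (T : finType).
Implicit Types (q : T -> R) (F S : {set T}) (A B : pred {set T}).

(** The obstacle is that degrees vary over the product, between [n] and [C n], so neither a walk nor
    an exploration can rely on a fixed degree. What helps is that one step changes a degree by less
    than [C], so that a number of steps small against [n] keeps it near its initial value. Degree
    lost in this way is budgeted throughout: blocks have only [delta n] coordinates, and in the
    supercritical case degrees are measured in the unreserved coordinates, which no move along a
    block affects.

    The share 2/3 of [eps] granted to the starting degree is the origin of the 9 in the subcritical
    claim: a share [theta] has tail exponent about [theta^2 eps^2 / (4 C^2)], which is
    [eps^2 / (9 C^2)] at [theta = 2/3].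

    Growth by blocks is forced by factors whose isoperimetric constant is only a power of [1 / n].
    They make sprinkled paths scarce, and with clusters of order [n] there would be too many ways to
    split; each block lowers the number of clusters by a factor of order [n], until the union bound
    is won. *)

Definition Ex q (f : {set T} -> R) : R :=
  \sum_(F : {set T}) (\prod_(e : T) (if e \in F then q e else 1 - q e)) * f F.

Definition Pr q (A : pred {set T}) : R := Ex q (fun F => (A F)%:R).

(** Measurability with respect to the coordinates in [S]; the codomain is arbitrary because clusters
    and walk counts are treated as well as events. *)
Definition depends_on (X : Type) S (f : {set T} -> X) :=
  forall F F', F :&: S = F' :&: S -> f F = f F'.

Lemma Ex_prod q (phi : T -> bool -> R) :
  Ex q (fun F => \prod_(e : T) phi e (e \in F)) =
  \prod_(e : T) (q e * phi e true + (1 - q e) * phi e false).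
Proof.
rewrite bigA_distr; apply: eq_bigr => F _; rewrite -big_split /=.
by apply: eq_bigr => e _; case: (e \in F).
Qed.

Lemma eq_Ex q f g : f =1 g -> Ex q f = Ex q g.
Proof. by move=> fg; apply: eq_bigr => F _; rewrite fg. Qed.

Lemma ExD q f g : Ex q (fun F => f F + g F) = Ex q f + Ex q g.
Proof. by rewrite /Ex -big_split; apply: eq_bigr => F _; rewrite /= mulrDr. Qed.

Lemma ExZ q a f : Ex q (fun F => a * f F) = a * Ex q f.
Proof. by rewrite /Ex big_distrr; apply: eq_bigr => F _; rewrite /= mulrCA. Qed.

Lemma Ex_sum q (I : Type) (r : seq I) (P : pred I) (f : I -> {set T} -> R) :
  Ex q (fun F => \sum_(i <- r | P i) f i F) = \sum_(i <- r | P i) Ex q (f i).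
Proof. by rewrite exchange_big; apply: eq_bigr => F _; rewrite big_distrr. Qed.

Lemma Ex_cst q a : Ex q (fun=> a) = a.
Proof.
have := Ex_prod q (fun _ _ => 1).
rewrite (@eq_Ex q _ (fun=> 1)) => [E1|F]; last by rewrite big1.
transitivity (Ex q (fun=> a * 1)); first by apply: eq_Ex => F; rewrite mulr1.
rewrite ExZ E1 big1 ?mulr1 // => e _.
by rewrite !mulr1 addrC subrK.
Qed.

Lemma Ex_prod_on q S (phi : T -> bool -> R) :
  Ex q (fun F => \prod_(e in S) phi e (e \in F)) =
  \prod_(e in S) (q e * phi e true + (1 - q e) * phi e false).
Proof.
pose psi e b := if e \in S then phi e b else 1.
transitivity (Ex q (fun F => \prod_(e : T) psi e (e \in F))).
  by apply: eq_Ex => F; rewrite big_mkcond.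
rewrite Ex_prod [RHS]big_mkcond; apply: eq_bigr => e _.
by rewrite /psi; case: (e \in S) => //; rewrite !mulr1 addrC subrK.
Qed.

Definition mix S F F' := (F :&: S) :|: (F' :\: S).

Lemma in_mix S F F' e : (e \in mix S F F') = (e \in if e \in S then F else F').
Proof. by rewrite !inE; case: (e \in S); rewrite ?andbT ?andbF ?orbF. Qed.

(** Exchanging the coordinates outside [S] between two independent copies is a weight-preserving
    involution on pairs. *)
Lemma Ex_mix2 q S (Psi : {set T} -> {set T} -> R) :
  Ex q (fun F => Ex q (fun F' => Psi (mix S F F') (mix S F' F))) =
  Ex q (fun F => Ex q (fun F' => Psi F F')).
Proof.
pose w (F : {set T}) := \prod_(e : T) (if e \in F then q e else 1 - q e).
have E (f : {set T} -> {set T} -> R) :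
    Ex q (fun F => Ex q (fun F' => f F F')) = \sum_(u : {set T} * {set T}) w u.1 * w u.2 * f u.1 u.2.
  rewrite /Ex -(pair_bigA _ (fun F F' => w F * w F' * f F F')) /=.
  by apply: eq_bigr => F _; rewrite big_distrr; apply: eq_bigr => F' _; rewrite /= mulrA.
rewrite !E; pose h u := (mix S u.1 u.2, mix S u.2 u.1).
have hK : involutive h.
  case=> F F'; congr pair; apply/setP => e; rewrite !inE /=;
    by case: (e \in S); rewrite ?andbF ?orbF ?andbT.
rewrite [RHS](reindex_inj (inv_inj hK)) /=.
apply: eq_bigr => -[F F'] _ /=; congr (_ * _).
rewrite /w -!big_split; apply: eq_bigr => e _ /=; rewrite !in_mix.
by case: (e \in S) => //; rewrite mulrC.
Qed.

Lemma Ex_mix q S f : Ex q (fun F => Ex q (fun F' => f (mix S F F'))) = Ex q f.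
Proof.
rewrite (Ex_mix2 q S (fun F _ => f F)); apply: eq_Ex => F; exact: Ex_cst.
Qed.

(* The states outside [S] may be resampled from an independent copy. *)
Lemma Ex_decouple q S (Psi : {set T} -> {set T} -> R) :
  (forall F', depends_on S (fun F => Psi F F')) ->
  (forall F, depends_on (~: S) (Psi F)) ->
  Ex q (fun F => Psi F F) = Ex q (fun F => Ex q (fun F' => Psi F F')).
Proof.
move=> dS dC; rewrite -(Ex_mix q S).
apply: eq_Ex => F; apply: eq_Ex => F'.
rewrite (dS _ _ F); last by apply/setP => e; rewrite !inE; case: (e \in S); rewrite ?andbF ?orbF ?andbT.
by apply: dC; apply/setP => e; rewrite !inE; case: (e \in S); rewrite ?andbF ?orbF ?andbT.
Qed.

Lemma Ex_indep q S f g : depends_on S f -> depends_on (~: S) g ->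
  Ex q (fun F => f F * g F) = Ex q f * Ex q g.
Proof.
move=> df dg; rewrite (@Ex_decouple q S (fun F F' => f F * g F')).
- rewrite mulrC -ExZ; apply: eq_Ex => F; rewrite ExZ mulrC; by [].
- by move=> F' F1 F2 E; rewrite (df _ _ E).
by move=> F F1 F2 E; rewrite (dg _ _ E).
Qed.

Lemma Ex_prod_indep q (I : eqType) (r : seq I) (S : I -> {set T}) (f : I -> {set T} -> R) :
  uniq r ->
  (forall i j, i \in r -> j \in r -> i != j -> [disjoint S i & S j]) ->
  (forall i, i \in r -> depends_on (S i) (f i)) ->
  Ex q (fun F => \prod_(i <- r) f i F) = \prod_(i <- r) Ex q (f i).
Proof.
elim: r => [|i r IH] /=.
  by move=> _ _ _; rewrite big_nil (@eq_Ex q _ (fun=> 1)) ?Ex_cst // => F; rewrite big_nil.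
move=> /andP[ir ur] dis dep; rewrite big_cons.
rewrite -IH => [|//|j k jr kr|j jr]; last 2 first.
- by apply: dis; rewrite inE ?jr ?kr orbT.
- by apply: dep; rewrite inE jr orbT.
rewrite -(@Ex_indep q (S i)); first by apply: eq_Ex => F; rewrite big_cons.
  by apply: dep; rewrite mem_head.
move=> F F' E; apply: eq_big_seq => j jr; apply: dep; first by rewrite inE jr orbT.
have sj : S j \subset ~: S i.
  rewrite -disjoints_subset dis ?inE ?jr ?eqxx ?orbT //.
  by apply: contraNneq ir => <-.
by rewrite -(setIidPr sj) !setIA E.
Qed.

(** The sprinkling identity. By linearity it is enough to treat the indicator of a single set; this
    is a product over the coordinates, so [Ex_prod], used once for each copy, reduces the claim to
    one coordinate. *)
Lemma Ex_union (q1 q2 : T -> R) f :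
  Ex q1 (fun F1 => Ex q2 (fun F2 => f (F1 :|: F2))) =
  Ex (fun e => 1 - (1 - q1 e) * (1 - q2 e)) f.
Proof.
pose q e := 1 - (1 - q1 e) * (1 - q2 e).
have fE F0 : f F0 = \sum_(F : {set T}) (\prod_(e : T) ((e \in F) == (e \in F0))%:R) * f F.
  rewrite (bigD1 F0) //= big1 ?mul1r => [|e _]; last by rewrite eqxx.
  rewrite big1 ?addr0 // => F neF.
  have /existsP[e ne] : [exists e, (e \in F) != (e \in F0)].
    rewrite -negb_forall; apply: contra neF => /forallP all; apply/eqP/setP => e; exact/eqP/all.
  by rewrite (bigD1 e) //= (negbTE ne) !mul0r.
transitivity (\sum_(F : {set T}) f F *
  Ex q1 (fun F1 => Ex q2 (fun F2 => \prod_(e : T) ((e \in F) == (e \in F1) || (e \in F2))%:R))).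
  transitivity (Ex q1 (fun F1 => \sum_(F : {set T}) f F *
    Ex q2 (fun F2 => \prod_(e : T) ((e \in F) == (e \in F1) || (e \in F2))%:R))).
    apply: eq_Ex => F1.
    transitivity (Ex q2 (fun F2 => \sum_(F : {set T}) f F *
      \prod_(e : T) ((e \in F) == (e \in F1) || (e \in F2))%:R)).
      apply: eq_Ex => F2; rewrite fE; apply: eq_bigr => F _; rewrite mulrC; congr (_ * _).
      by apply: eq_bigr => e _; rewrite inE.
    by rewrite Ex_sum; apply: eq_bigr => F _; rewrite ExZ.
  by rewrite Ex_sum; apply: eq_bigr => F _; rewrite ExZ.
apply: eq_bigr => F _; rewrite mulrC; congr (_ * _).
transitivity (Ex q1 (fun F1 => \prod_(e : T)
  (q2 e * (e \in F)%:R + (1 - q2 e) * ((e \in F) == (e \in F1))%:R))).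
  apply: eq_Ex => F1; rewrite (Ex_prod q2 (fun e b => ((e \in F) == (e \in F1) || b)%:R)).
  by apply: eq_bigr => e _; rewrite orbT orbF eqb_id.
rewrite (Ex_prod q1 (fun e b => q2 e * (e \in F)%:R + (1 - q2 e) * ((e \in F) == b)%:R)).
by apply: eq_bigr => e _; case: (e \in F) => /=; ring.
Qed.

(** * Inequalities for product measures and a lower tail bound *)

Section Monotone.
Variable q : T -> R.
Hypothesis q01 : forall e, 0 <= q e <= 1.

Lemma Ex_ge0 f : (forall F, 0 <= f F) -> 0 <= Ex q f.
Proof.
move=> f0; apply: sumr_ge0 => F _; apply: mulr_ge0 => //; apply: prodr_ge0 => e _.
by have /andP[? ?] := q01 e; case: ifP; rewrite ?subr_ge0.
Qed.

Lemma Ex_le f g : (forall F, f F <= g F) -> Ex q f <= Ex q g.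
Proof.
move=> fg; rewrite -subr_ge0 -[X in _ - X]mul1r -mulNr -ExZ -ExD.
by apply: Ex_ge0 => F; rewrite mulN1r subr_ge0.
Qed.

Lemma Pr_ge0 A : 0 <= Pr q A.
Proof. by apply: Ex_ge0 => F. Qed.

Lemma Pr_le A B : (forall F, A F -> B F) -> Pr q A <= Pr q B.
Proof. by move=> AB; apply: Ex_le => F; rewrite ler_nat; case: (A F) (AB F) => [->|]. Qed.

Lemma Pr_le1 A : Pr q A <= 1.
Proof. by rewrite -[leRHS](Ex_cst q); apply: Ex_le => F; case: (A F). Qed.

Lemma PrC A : Pr q (fun F => ~~ A F) = 1 - Pr q A.
Proof.
rewrite -[1](Ex_cst q) -[X in _ - X]mul1r -mulNr -ExZ -ExD; apply: eq_Ex => F.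
by case: (A F); rewrite /= ?mulr1 ?mulr0 ?subrr ?addr0 // mulN1r subrr.
Qed.

Lemma PrU A B : Pr q (fun F => A F || B F) <= Pr q A + Pr q B.
Proof.
by rewrite -ExD; apply: Ex_le => F; case: (A F); case: (B F); rewrite //= ?addr0 ?add0r ?lerDl.
Qed.

Lemma Pr_union_bound (I : finType) (P : pred I) (A : I -> pred {set T}) :
  Pr q (fun F => [exists i, P i && A i F]) <= \sum_(i | P i) Pr q (A i).
Proof.
rewrite -Ex_sum; apply: Ex_le => F; case: existsP => [[i /andP[Pi Ai]]|_].
  by rewrite (bigD1 i) //= Ai lerDl sumr_ge0.
by rewrite sumr_ge0.
Qed.

Lemma markov_Pr (A : pred {set T}) f (a : R) : 0 < a -> (forall F, 0 <= f F) ->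
  (forall F, A F -> a <= f F) -> Pr q A <= Ex q f / a.
Proof.
move=> a0 f0 Af; rewrite ler_pdivlMr // mulrC -ExZ; apply: Ex_le => F.
by case AF: (A F); rewrite ?mulr1 ?mulr0 ?Af.
Qed.

Lemma Pr_prod_on S : Pr q (fun F => S \subset F) = \prod_(e in S) q e.
Proof.
transitivity (Ex q (fun F => \prod_(e in S) (e \in F)%:R)).
  apply: eq_Ex => F; case: (boolP (S \subset F)) => [/subsetP sSF|/subsetPn[e eS eF]].
    by rewrite big1 // => e /sSF ->.
  by rewrite (bigD1 e) //= (negbTE eF) mul0r.
rewrite (Ex_prod_on q S (fun _ b => b%:R)); apply: eq_bigr => e _.
by rewrite mulr1 mulr0 addr0.
Qed.

Lemma Pr_mem e : Pr q (fun F => e \in F) = q e.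
Proof.
have := Pr_prod_on [set e]; rewrite big_set1 => <-.
by apply: eq_Ex => F; rewrite sub1set.
Qed.

Lemma Pr_disjoint S : Pr q (fun F => [disjoint S & F]) = \prod_(e in S) (1 - q e).
Proof.
transitivity (Ex q (fun F => \prod_(e in S) (e \notin F)%:R)).
  apply: eq_Ex => F; rewrite disjoints_subset.
  case: (boolP (S \subset ~: F)) => [/subsetP sSF|/subsetPn[e eS eF]].
    by rewrite big1 // => e /sSF; rewrite inE => ->.
  by rewrite (bigD1 e) //= -in_setC (negbTE eF) mul0r.
rewrite (Ex_prod_on q S (fun _ b => (~~ b)%:R)); apply: eq_bigr => e _.
by rewrite mulr1 mulr0 add0r.
Qed.

(** Markov's inequality for [z ^ count] with [z = exp (- 1 / 2)]; disjoint supports turn the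
    expectation into a product. *)
Lemma Pr_indep_count_tail (I : eqType) (r : seq I) (S : I -> {set T})
    (A : I -> pred {set T}) (c : R) :
  uniq r -> 0 <= c ->
  (forall i j, i \in r -> j \in r -> i != j -> [disjoint S i & S j]) ->
  (forall i, i \in r -> depends_on (S i) (A i)) ->
  (forall i, i \in r -> c <= Pr q (A i)) ->
  Pr q (fun F => (count (fun i => A i F) r)%:R <= c * (size r)%:R / 2) <=
  expR (- (c * (size r)%:R / 8)).
Proof.
move=> ur c0 dis dep lb; pose z : R := expR (- (1 / 2)).
have z0 : 0 <= z by exact: expR_ge0.
(* With [1 - z >= 3 / 8] each factor has expectation at most [exp (- 3 c / 8)]; dividing by the
   threshold [exp (- c N / 4)], for [N] events, leaves [exp (- c N / 8)]. *)
have z1 : z <= 5 / 8.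
  have h1 : 1 + 1 / 8 <= expR (1 / 8) :> R by exact: expR_ge1Dx.
  have h2 : (9 / 8) ^+ 4 <= expR (1 / 2) :> R.
    have -> : 1 / 2 = 4%:R * (1 / 8) :> R by field.
    by rewrite expRM_natl lerXn2r ?nnegrE ?expR_ge0 //; lra.
  rewrite /z expRN invf_ple ?posrE ?expR_gt0 //; first by lra.
have cnt F : \prod_(i <- r) (if A i F then z else 1) = z ^+ count (fun i => A i F) r.
  by rewrite -big_mkcond big_const_seq iter_mulr_1.
have fge0 F : 0 <= \prod_(i <- r) (if A i F then z else 1).
  by rewrite cnt exprn_ge0.
have a0 : 0 < expR (- (c * (size r)%:R / 4)) by exact: expR_gt0.
apply: le_trans (@markov_Pr _ _ _ a0 fge0 _) _ => [F h|].
  rewrite cnt /z -expRM_natl ler_expR -mulr_natl; lra.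
rewrite (Ex_prod_indep _ ur dis) => [|i ir F F' E]; last by rewrite (dep _ ir _ _ E).
rewrite ler_pdivrMr // -expRD.
apply: (@le_trans _ _ (\prod_(i <- r) expR (- (c * (3 / 8))))); last first.
  rewrite big_const_seq count_predT iter_mulr_1 -expRM_natl ler_expR -mulr_natl; lra.
rewrite big_seq [leRHS]big_seq; apply: ler_prod => i ir; apply/andP; split.
  by apply: Ex_ge0 => F; case: ifP.
apply: (@le_trans _ _ (1 - c * (3 / 8))); last first.
  by have := expR_ge1Dx (- (c * (3 / 8)) : R).
apply: (@le_trans _ _ (1 - Pr q (A i) * (1 - z))).
  rewrite le_eqVlt; apply/orP; left; apply/eqP; rewrite -[X in X - _](Ex_cst q) mulrC -mulNr -ExZ -ExD.
  by apply: eq_Ex => F; case: (A i F) => /=; lra.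
have := lb _ ir; have := Pr_ge0 (A i); nra.
Qed.

End Monotone.
End BernoulliProduct.

(** * Cluster exploration *)

(* The survival criterion [E th^X <= th] of a branching process with binomial
   offspring of mean at least [1 + a], at the explicit point [th = 1 - a / 2]. *)
Lemma binomial_survival (R : realType) (p a : R) (N : nat) :
  0 <= p <= 1 -> 0 <= a <= 1 -> 1 + a <= p * N%:R ->
  (1 - p * (1 - (1 - a / 2))) ^+ N <= 1 - a / 2.
Proof.
move=> /andP[p0 p1] /andP[a0 a1] pN; pose x : R := a / 2.
have -> : 1 - p * (1 - (1 - a / 2)) = 1 - p * x by rewrite /x; ring.
apply: (@le_trans _ _ (expR (- (p * N%:R * x)))).
  have -> : - (p * N%:R * x) = N%:R * (- (p * x)) by ring.
  rewrite expRM_natl; apply: lerXn2r; rewrite ?nnegrE ?expR_ge0 //.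
    by rewrite /x; nra.
  exact: expR_ge1Dx.
apply: (@le_trans _ _ (expR (- ((1 + a) * x)))).
  by rewrite ler_expR lerN2 ler_wpM2r // /x; lra.
have y0 : 0 < 1 + (1 + a) * x by rewrite /x; nra.
apply: (@le_trans _ _ ((1 + (1 + a) * x)^-1)).
  by rewrite expRN lef_pV2 ?posrE ?expR_gt0 //; apply: expR_ge1Dx.
by rewrite -[_^-1]mul1r ler_pdivrMr // /x; nra.
Qed.

Section OpenClusters.
Variables (V : finType) (e : rel V).
Hypothesis e_sym : symmetric e.
Implicit Types (F : {set {set V}}) (A D : {set V}) (u v : V).

Definition open_rel F : rel V := fun x y => e x y && ([set x; y] \in F).

Definition cluster F v : {set V} := [set u | connect (open_rel F) v u].

Lemma open_rel_sym F : symmetric (open_rel F).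
Proof. by move=> x y; rewrite /open_rel e_sym setUC. Qed.

Lemma open_connect_sym F : connect_sym (open_rel F).
Proof. exact/sym_connect_sym/open_rel_sym. Qed.

Section Exploration.
Hypothesis e_irr : irreflexive e.
Variables (R : realType) (q : {set V} -> R) (p : R).
Hypothesis q01 : forall E, 0 <= q E <= 1.
Hypothesis qE : forall x y, e x y -> q [set x; y] = p.
Variables (h : V -> nat) (C m H N : nat) (th : R).
Hypothesis h_lip : forall x y, e x y -> (h x <= h y + C)%N.
Hypothesis large_deg : forall u, (H <= h u + C * m)%N -> (N + m <= #|[set w | e u w]|)%N.
Hypothesis p01 : 0 <= p <= 1.
Hypothesis th01 : 0 <= th <= 1.
Hypothesis thN : (1 - p * (1 - th)) ^+ N <= th.

Let avoiding (D : {set V}) F : rel V := fun x y => [&& open_rel F x y, x \notin D & y \notin D].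

Let reach (A D : {set V}) F := [set u | [exists a in A, connect (avoiding D F) a u]].

(** Explored vertices are counted separately from what the active ones still reach outside [D], so
    that the count does not grow when a vertex is explored. *)
Let fails (A D : {set V}) F := (#|[set u in reach A D F | (H <= h u + C * m)%N]| + #|D| < m)%N.

Lemma exploration_step a A D F : a \in A -> a \notin D -> (H <= h a + C * m)%N ->
  fails A D F ->
  fails ((A :\ a) :|: [set b in [set b | e a b] :\: (A :|: D) | [set a; b] \in F])
        (a |: D) F.
Proof.
move=> aA aD ha; rewrite /fails cardsU1 aD /=.
set A2 := _ :|: _; set X := [set u in reach A D F | _]; set Y := [set u in _ | _].
suff : (#|a |: Y| <= #|X|)%N.
  rewrite cardsU1; have -> : a \notin Y.
    rewrite !inE negb_and; apply/orP; left; apply/existsPn => b; apply/negP => /andP[bA2 /connectP[s]].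
    have bna : b != a.
      by move: bA2; rewrite !inE => /orP[/andP[//]|/andP[/andP[_ eab] _]];
        apply: contraTneq eab => ->; rewrite e_irr.
    elim/last_ind: s => [_ /= ab|s x _]; first by rewrite ab eqxx in bna.
    rewrite rcons_path last_rcons => /andP[_ /and3P[_ _ +]] ax.
    by rewrite -ax !inE eqxx.
  by move=> *; lia.
apply/subset_leq_card/subsetP => u; rewrite !inE => /orP[/eqP ->|/andP[/existsP[b /andP[bA2 bu]] hu]].
  by rewrite ha andbT; apply/existsP; exists a; rewrite aA connect0.
rewrite hu andbT; apply/existsP.
have {}bu : connect (avoiding D F) b u.
  apply: connect_sub bu => x y /and3P[xy]; rewrite !inE !negb_or => /andP[_ xD] /andP[_ yD].
  by apply: connect1; rewrite /avoiding xy xD yD.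
move: bA2; rewrite !inE => /orP[/andP[_ bA]|].
  by exists b; rewrite bA.
rewrite negb_or => /andP[/andP[/andP[_ bD] eab] abF]; exists a; rewrite aA /=.
by apply: connect_trans bu; apply: connect1; rewrite /avoiding /open_rel eab abF aD bD.
Qed.

(* [A] is the set of active vertices and [D] the set of explored ones; [th ^ #|A|] is a
   supermartingale of the exploration because [E th ^ X <= th] for the offspring [X]. *)
Lemma exploration_bound k A D : (m <= #|D| + k)%N -> [disjoint A & D] ->
  (forall a, a \in A -> (H <= h a + C * #|D|)%N) ->
  Pr q (fails A D) <= th ^+ #|A|.
Proof.
have [th0 th1] := andP th01; have [p0 p1] := andP p01.
elim: k A D => [|k IH] A D mk dAD hA.
  apply: (@le_trans _ _ 0); last by rewrite exprn_ge0.
  rewrite -(@Ex_cst R _ q 0); apply: Ex_le => // F.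
  by rewrite /fails (_ : _ < m = false)%N //; apply/negbTE; rewrite -leqNgt; lia.
have [->|[a aA]] := set_0Vmem A.
  by rewrite cards0 expr0 Pr_le1.
have [mD|Dm] := leqP m #|D|; first by apply: IH => //; lia.
have haC a' : a' \in A -> (H <= h a' + C * m)%N.
  by move=> /hA /leq_trans; apply; rewrite leq_add2l leq_mul2l ltnW ?orbT.
have [mAD|ADm] := leqP m (#|A| + #|D|).
  apply: (@le_trans _ _ 0); last by rewrite exprn_ge0.
  rewrite -(@Ex_cst R _ q 0); apply: Ex_le => // F.
  rewrite /fails (_ : _ < m = false)%N //; apply/negbTE; rewrite -leqNgt.
  apply: leq_trans mAD _; rewrite leq_add2r; apply/subset_leq_card/subsetP => u uA.
  by rewrite !inE haC // andbT; apply/existsP; exists u; rewrite uA connect0.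
have aD : a \notin D by rewrite (disjointFr dAD).
pose Na := [set b | e a b] :\: (A :|: D).
pose S F := [set b in Na | [set a; b] \in F].
(* Fewer than [m] vertices are active or explored here, so at most [m] of the [N + m] neighbours are
   lost. *)
have NaN : (N <= #|Na|)%N.
  have := large_deg (haC a aA); rewrite /Na.
  have := cardsID (A :|: D) [set b | e a b]; rewrite -/Na.
  have := subset_leq_card (subsetIr [set b | e a b] (A :|: D)).
  have := cardsU A D; lia.
(* The offspring of [a] is read off the edges at [a], and the rest of the exploration avoids
   [a |: D], hence all of these edges. *)
pose star := [set E : {set V} | a \in E].
apply: (@le_trans _ _ (Pr q (fun F => fails ((A :\ a) :|: S F) (a |: D) F))).
  by apply: Pr_le => // F; apply: exploration_step => //; apply: haC.
rewrite /Pr (@Ex_decouple _ _ q star (fun F F' => (fails (A :\ a :|: S F) (a |: D) F')%:R)); last 2 first.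
- move=> F' F1 F2 E; suff -> : S F1 = S F2 by [].
  apply/setP => b; rewrite !inE; case: (_ && e a b) => //=.
  by have /setP/(_ [set a; b]) := E; rewrite !inE eqxx andbT andbT.
- move=> F F1 F2 E; rewrite /fails (_ : reach _ _ F1 = reach (A :\ a :|: S F) (a |: D) F2) //.
  apply/setP => u; rewrite !inE; apply: eq_existsb => b; congr (_ && _).
  apply: eq_connect => x y; rewrite /avoiding /open_rel.
  case xa : (x \notin a |: D) => //=; last by rewrite !andbF.
  case ya : (y \notin a |: D) => //=; last by rewrite !andbF.
  have /setP/(_ [set x; y]) := E; rewrite !inE.
  move: xa ya; rewrite !inE !negb_or => /andP[xa _] /andP[ya _].
  by rewrite ![a == _]eq_sym (negbTE xa) (negbTE ya) /= !andbT => ->.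
have Ssub F : S F \subset Na by apply/subsetP => b; rewrite inE => /andP[].
apply: (@le_trans _ _ (Ex q (fun F => th ^+ #|A|.-1 * th ^+ #|S F|))).
  apply: Ex_le => // F; rewrite -exprD.
  have -> : (#|A|.-1 + #|S F| = #|A :\ a :|: S F|)%N.
    rewrite cardsU (cardsD1 a A) aA /= (_ : _ :&: _ = set0) ?cards0 ?subn0 //.
    apply/setP => b; rewrite !inE; case: (b \in A); rewrite ?andbF //=.
  apply: IH.
  - by rewrite cardsU1 aD; lia.
  - rewrite -setI_eq0; apply/eqP/setP => b; rewrite !inE.
    have [->|ba] /= := eqVneq b a; first by rewrite e_irr !andbF.
    have := disjointFr dAD (x := b); case: (b \in A) => [->//|_]; rewrite ?andbF //=.
    by case: (b \in D); rewrite ?andbF.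
  - move=> b; rewrite cardsU1 aD mulnDr muln1 !inE => /orP[/andP[_ bA]|/andP[/andP[_ eab] _]].
      by apply: leq_trans (hA _ bA) _; lia.
    by have := hA _ aA; have := h_lip eab; lia.
rewrite ExZ.
have Ainj : {in Na &, injective (fun b => [set a; b])}.
  move=> b c; rewrite !inE => /andP[_ eab] /andP[_ eac] /setP/(_ b).
  rewrite !inE eqxx orbT; have [ba|_ /=] := eqVneq b a; first by rewrite ba e_irr in eab.
  by move/esym/eqP.
have -> : Ex q (fun F => th ^+ #|S F|) = (1 - p * (1 - th)) ^+ #|Na|.
  transitivity (Ex q (fun F => \prod_(E in [set [set a; b] | b in Na]) (if E \in F then th else 1))).
    apply: eq_Ex => F; rewrite big_imset //= -big_mkcondr -prodr_const.
    by apply: eq_bigl => b; rewrite [LHS]inE.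
  rewrite (Ex_prod_on q _ (fun _ b => if b then th else 1)) big_imset //=.
  rewrite (eq_bigr (fun=> 1 - p * (1 - th))); last first.
    by move=> b; rewrite !inE => /andP[_ eab]; rewrite qE //; ring.
  by rewrite prodr_const.
have x01 : 0 <= 1 - p * (1 - th) <= 1 by apply/andP; split; nra.
apply: (@le_trans _ _ (th ^+ #|A|.-1 * th)).
  rewrite ler_wpM2l ?exprn_ge0 //; apply: le_trans thN.
  by apply: ler_wiXn2l => //; case/andP: x01.
by rewrite -exprSr prednK //; apply/card_gt0P; exists a.
Qed.

Lemma exploration_cluster v : (H <= h v)%N ->
  1 - th <= Pr q (fun F => (m <= #|[set u in cluster F v | (H <= h u + C * m)%N]|)%N).
Proof.
move=> hv; pose A F := (m <= #|[set u in cluster F v | (H <= h u + C * m)%N]|)%N.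
suff : Pr q (fun F => ~~ A F) <= th by rewrite PrC -/A; lra.
have bound : Pr q (fails [set v] set0) <= th.
  have := @exploration_bound m [set v] set0; rewrite cards0 cards1 expr1; apply=> //.
    by rewrite -setI_eq0 setI0.
  by move=> a /set1P ->; rewrite muln0 addn0.
apply: le_trans bound; apply: Pr_le => // F; rewrite /A /fails cards0 addn0 -ltnNge.
apply: leq_ltn_trans; apply/subset_leq_card/subsetP => u; rewrite !inE.
move=> /andP[/existsP[a /andP[/set1P -> vu]] ->]; rewrite andbT.
by apply: connect_sub vu => x y /and3P[xy _ _]; apply: connect1.
Qed.

End Exploration.
End OpenClusters.

(** * Self-avoiding walks *)

Section SelfAvoidingWalks.
Variables (V : finType) (e : rel V).
Implicit Types (F : {set {set V}}) (D : {set V}) (u v : V).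

(** [D] holds the vertices already visited. The walk continued from [u] uses only edges disjoint
    from [v |: D], which makes it independent of the edge from [v] to [u]. *)
Fixpoint saw_count F k D v : nat :=
  if k is k'.+1
  then \sum_(u | open_rel e F v u && (u \notin v |: D)) saw_count F k' (v |: D) u
  else 1.

Fixpoint saw_ends F k D v : {set V} :=
  if k is k'.+1
  then \bigcup_(u | open_rel e F v u && (u \notin v |: D)) saw_ends F k' (v |: D) u
  else [set v].

Lemma card_saw_ends F k D v : (#|saw_ends F k D v| <= saw_count F k D v)%N.
Proof.
elim: k D v => [|k IH] D v /=; first by rewrite cards1.
elim/big_rec2: _ => [|u n B _ le]; first by rewrite cards0.
rewrite cardsU; apply: leq_trans (leq_subr _ _) _; exact: leq_add.
Qed.

Lemma mem_saw_ends F s D v : path (open_rel e F) v s -> uniq (v :: s) ->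
  [disjoint s & D] -> last v s \in saw_ends F (size s) D v.
Proof.
elim: s D v => [|u s IH] D v /=; first by rewrite set11.
move=> /andP[vu us] /andP[]; rewrite inE negb_or => /andP[vnu vs] /andP[uns uqs].
rewrite disjoint_cons => /andP[uD sD]; apply/bigcupP; exists u.
  by rewrite vu /= !inE negb_or eq_sym vnu.
apply: IH => //=; first by rewrite uns.
rewrite disjoint_sym disjoint_subset; apply/subsetP => x; rewrite !inE => /orP[/eqP -> //|xD].
by apply: contraTN sD => xs; apply/pred0Pn; exists x; rewrite /= xs.
Qed.

(** A path to a vertex of the cluster can be shortened to a self-avoiding one; if its length were at
    least [k], its prefix would be a walk of length [k]. *)
Lemma cluster_saw F k v : saw_count F k set0 v = 0%N ->
  (#|cluster e F v| <= \sum_(i < k) saw_count F i set0 v)%N.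
Proof.
move=> c0; apply: (@leq_trans #|\bigcup_(i < k) saw_ends F i set0 v|); last first.
  elim/big_rec2: _ => [|u n B _ le]; first by rewrite cards0.
  rewrite cardsU; apply: leq_trans (leq_subr _ _) _; apply: leq_add => //; exact: card_saw_ends.
apply/subset_leq_card/subsetP => u; rewrite inE => /connectP[s0 vs0 ->].
case/shortenP: vs0 => s vs us _.
have d0 (t : seq V) : [disjoint t & set0].
  by rewrite disjoint_sym disjoint_subset; apply/subsetP => x; rewrite inE.
have [ks|sk] := leqP k (size s); last first.
  by apply/bigcupP; exists (Ordinal sk) => //; apply: mem_saw_ends.
have [] : False.
have := card_saw_ends F k set0 v; rewrite c0 leqn0 cards_eq0 => /eqP E0.
have := @mem_saw_ends F (take k s) set0 v; rewrite size_take_min (minn_idPl ks) E0 inE.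
by move=> /(_ _ _ _)/negP; apply=> //; [exact: take_path | exact: (@take_uniq _ (v :: s) k.+1)].
Qed.

Lemma depends_on_saw k D v : v \notin D ->
  depends_on [set E : {set V} | [disjoint E & D]] (fun F => saw_count F k D v).
Proof.
elim: k D v => [|k IH] D v vD F F' E //=.
have dE u : u \notin D -> ([set v; u] \in F) = ([set v; u] \in F').
  move=> uD; have /setP/(_ [set v; u]) := E; rewrite !inE.
  suff -> : [disjoint [set v; u] & D] by rewrite !andbT.
  by rewrite disjoint_subset; apply/subsetP => x; rewrite !inE => /orP[]/eqP ->.
apply: eq_big => [u|u /andP[_ uD]].
  rewrite /open_rel; case uD : (u \in v |: D); rewrite ?andbF //= dE //.
  by apply: contraFN uD => uD; rewrite inE uD orbT.
apply: (IH (v |: D) u uD); apply/setP => B; have /setP/(_ B) := E; rewrite !inE.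
case: (boolP [disjoint B & v |: D]) => dB; rewrite ?andbF // !andbT.
by rewrite (disjointWr (subsetUr _ _) dB) !andbT.
Qed.

Variables (R : realType) (q : {set V} -> R) (p : R) (C : nat).
Hypothesis q01 : forall E, 0 <= q E <= 1.
Hypothesis qE : forall x y, e x y -> q [set x; y] = p.
Hypothesis p0 : 0 <= p.
Hypothesis deg_lip : forall x y, e x y -> (#|[set w | e y w]| <= #|[set w | e x w]| + C)%N.

(** Conditioning on the first step gives at most [dg] continuations, each open with probability [p]
    and independent of the walk that follows. The degree bound then rises by [C], whence the [C * i]
    in the factor of step [i]. *)
Lemma Ex_saw_count k D v dg : (#|[set w | e v w]|%:R <= dg) ->
  Ex q (fun F => (saw_count F k D v)%:R) <= \prod_(i < k) (p * (dg + (C * i)%:R)).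
Proof.
elim: k D v dg => [|k IH] D v dg vdg /=; first by rewrite big_ord0 Ex_cst.
have dg0 : 0 <= dg by apply: le_trans vdg.
have -> : Ex q (fun F => (\sum_(u | open_rel e F v u && (u \notin v |: D)) saw_count F k (v |: D) u)%:R)
    = Ex q (fun F => \sum_(u | e v u && (u \notin v |: D))
        ([set v; u] \in F)%:R * (saw_count F k (v |: D) u)%:R).
  apply: eq_Ex => F; rewrite natr_sum big_mkcond [RHS]big_mkcond; apply: eq_bigr => u _.
  rewrite /open_rel; case: (e v u) => //=; case: (_ \in F); rewrite ?mul1r ?mul0r //=.
  by case: ifP.
rewrite Ex_sum big_ord_recl muln0 addr0.
set P := \prod_(i < k) _.
have P0 : 0 <= P by apply: prodr_ge0 => i _; rewrite mulr_ge0 // addr_ge0.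
apply: (@le_trans _ _ (\sum_(u | e v u && (u \notin v |: D)) p * P)).
  apply: ler_sum => u /andP[evu uD].
  rewrite (@Ex_indep _ _ q (~: [set E : {set V} | [disjoint E & v |: D]])).
  - have -> : Ex q (fun F => ([set v; u] \in F)%:R) = p by rewrite -/(Pr q _) Pr_mem qE.
    rewrite ler_wpM2l //.
    have -> : P = \prod_(i < k) (p * ((dg + C%:R) + (C * i)%:R)).
      by apply: eq_bigr => i _; rewrite lift0 mulnS natrD addrA.
    apply: IH; apply: (@le_trans _ _ (#|[set w | e v w]| + C)%:R).
      by rewrite ler_nat deg_lip.
    by rewrite natrD lerD2r.
  - move=> F F' /setP/(_ [set v; u]); rewrite !inE.
    suff -> : ~~ [disjoint [set v; u] & v |: D] by rewrite !andbT => ->.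
    by apply/pred0Pn; exists v; rewrite /= !inE eqxx.
  - by rewrite setCK => F F' E; rewrite (depends_on_saw _ uD E).
rewrite sumr_const -mulr_natl mulrA ler_wpM2r // mulrC ler_wpM2l //.
apply: le_trans vdg; rewrite ler_nat; apply/subset_leq_card/subsetP => u.
by rewrite !inE => /andP[].
Qed.

Lemma cluster_tail k v dg (M : R) : 0 < M -> #|[set w | e v w]|%:R <= dg ->
  Pr q (fun F => M < #|cluster e F v|%:R) <=
  \prod_(i < k) (p * (dg + (C * i)%:R)) +
  (\sum_(j < k) \prod_(i < j) (p * (dg + (C * i)%:R))) / M.
Proof.
move=> M0 vdg.
pose f F : R := (\sum_(j < k) saw_count F j set0 v)%:R.
have f0 F : 0 <= f F by rewrite ler0n.
apply: (@le_trans _ _ (Pr q (fun F => (1 <= (saw_count F k set0 v)%:R :> R) || (M <= f F)))).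
  apply: Pr_le => // F MC; rewrite ler1n; case: posnP => [c0|//]; rewrite /=.
  by apply: (le_trans (ltW MC)); rewrite ler_nat cluster_saw.
apply: le_trans (PrU q01 _ _) _; apply: lerD.
  apply: le_trans (Ex_saw_count k set0 vdg); rewrite -[leRHS]divr1.
  exact: markov_Pr.
apply: (le_trans (markov_Pr q01 M0 f0 _)) => [//|].
rewrite ler_wpM2r ?invr_ge0 ?(ltW M0) //.
rewrite (@eq_Ex _ _ q _ (fun F => \sum_(j < k) (saw_count F j set0 v)%:R)); last first.
  by move=> F; rewrite /f natr_sum.
by rewrite Ex_sum; apply: ler_sum => j _; apply: Ex_saw_count.
Qed.

End SelfAvoidingWalks.

(** * Merging clusters by sprinkling *)

Section Merging.
Variables (V : finType) (e : rel V).
Hypotheses (e_sym : symmetric e).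
Implicit Types (F L : {set {set V}}) (A B S U X : {set V}) (x y u v : V).

Definition arcs_out S : {set V * V} := [set z | [&& z.1 \in S, z.2 \notin S & e z.1 z.2]].

Section Links.
Variables A B X : {set V}.
Hypothesis AB : [disjoint A & B].
Hypothesis near : forall y, y \notin X -> y \notin A :|: B -> exists2 u, u \in A :|: B & e y u.

(* The boundary arcs of [halo] that avoid [X] extend to paths of length at most 3 from [A]
   to [B]; [link z] is the edge set of the path through the arc [z]. *)
Definition halo : {set V} := A :|: [set x in ~: B | [exists a in A, e x a]].

Let M := [set z in arcs_out halo | z.2 \notin X].
(** When an end of the arc already lies in [A] or [B], the path is shorter and [link] omits that
    edge. For arcs in [M] the default value is never taken, by [toAP] and [toBP]. *)
Let toA x := if x \in A then x else odflt x [pick a | (a \in A) && e x a].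
Let toB y := if y \in B then y else odflt y [pick b | (b \in B) && e y b].
Let link (z : V * V) : {set {set V}} :=
  [set z.1; z.2] |: ((if z.1 \in A then set0 else [set [set z.1; toA z.1]])
                 :|: (if z.2 \in B then set0 else [set [set z.2; toB z.2]])).

Lemma toAP z : z \in M -> toA z.1 \in A /\ (z.1 \notin A -> e z.1 (toA z.1)).
Proof.
rewrite !inE => /andP[/and3P[z1 _ _] _]; rewrite /toA.
case: ifP z1 => //= zA /andP[_ /existsP[a /andP[aA za]]].
by case: pickP => [b /andP[]//|/(_ a)]; rewrite aA za.
Qed.

(** A vertex outside both [halo] and [B] has no neighbour in [A], so the neighbour in [A :|: B]
    supplied by [near] lies in [B]. *)
Lemma toBP z : z \in M -> toB z.2 \in B /\ (z.2 \notin B -> e z.2 (toB z.2)).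
Proof.
rewrite !inE !negb_or negb_and negbK => /andP[/and3P[_ /andP[zA zN] _] zX]; rewrite /toB.
case: ifP zN => //= zB /existsPn zN.
have [|u] := near zX; first by rewrite inE zB orbF.
rewrite inE => uAB zu; case: pickP => [b /andP[]//|/(_ u)]; rewrite zu andbT.
by have := zN u; rewrite zu andbT; case/orP: uAB => ->.
Qed.

Lemma link_connects z F : z \in M -> link z \subset F ->
  exists a b, [/\ a \in A, b \in B & connect (open_rel e F) a b].
Proof.
move=> zM /subsetP lF; have [aA ea] := toAP zM; have [bB eb] := toBP zM.
exists (toA z.1), (toB z.2); split=> //.
have e12 : e z.1 z.2 by move: zM; rewrite !inE => /andP[/and3P[]].
have c1 : connect (open_rel e F) (toA z.1) z.1.
  rewrite open_connect_sym //; case: (boolP (z.1 \in A)) => zA; first by rewrite /toA zA connect0.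
  by apply: connect1; rewrite /open_rel ea //= lF // !inE (negbTE zA) set11 orbT.
have c2 : connect (open_rel e F) z.2 (toB z.2).
  case: (boolP (z.2 \in B)) => zB; first by rewrite /toB zB connect0.
  by apply: connect1; rewrite /open_rel eb //= lF // !inE (negbTE zB) set11 !orbT.
apply: connect_trans c1 (connect_trans _ c2).
by apply: connect1; rewrite /open_rel e12 /= lF // !inE eqxx.
Qed.

Lemma card_link z : (#|link z| <= 3)%N.
Proof.
rewrite /link; apply: leq_trans (leq_card_setU _ _) _; rewrite cards1 (leq_add2l 1 _ 2).
apply: leq_trans (leq_card_setU _ _) _.
by apply: (@leq_add _ _ 1 1); case: ifP; rewrite ?cards0 ?cards1.
Qed.

Lemma link_edge z E : z \in M -> E \in link z -> exists x y, e x y /\ E = [set x; y].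
Proof.
move=> zM; have [_ ea] := toAP zM; have [_ eb] := toBP zM.
have e12 : e z.1 z.2 by move: zM; rewrite !inE => /andP[/and3P[]].
rewrite !inE => /or3P[/eqP ->||]; first by exists z.1, z.2.
- case: ifP => [_|/negbT zA]; rewrite inE // => /eqP ->.
  by exists z.1, (toA z.1); split=> //; apply: ea.
case: ifP => [_|/negbT zB]; rewrite inE // => /eqP ->.
by exists z.2, (toB z.2); split=> //; apply: eb.
Qed.

Lemma link_touch z E : E \in link z ->
  (z.1 \in E) || (z.2 \in E) /\ {subset E <= [:: z.1; z.2; toA z.1; toB z.2]}.
Proof.
rewrite !inE => /or3P[/eqP ->||].
- rewrite set21; split=> // x; rewrite !inE => /orP[]->; rewrite ?orbT //.
- case: ifP => [_|/negbT zA]; rewrite inE // => /eqP ->.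
  by rewrite set21; split=> // x; rewrite !inE => /orP[]->; rewrite ?orbT.
case: ifP => [_|/negbT zB]; rewrite inE // => /eqP ->.
by rewrite set21 orbT; split=> // x; rewrite !inE => /orP[]->; rewrite ?orbT.
Qed.

Variable Delta : nat.
Hypothesis deg_le : forall v, (#|[set w | e v w]| <= Delta)%N.

(** Take a maximal edge-disjoint family. The link of any arc in [M] meets a chosen link, so by
    [link_touch] the arc has an end among the four vertices of that link. A vertex is an end of at
    most [2 * Delta] arcs, and 8 is four times 2. *)
Lemma disjoint_links : exists2 M1 : {set V * V}, M1 \subset M /\
    {in M1 &, forall z z', z != z' -> [disjoint link z & link z']} &
    (#|M| <= 8 * Delta * #|M1|)%N.
Proof.
pose P (M1 : {set V * V}) := (M1 \subset M) &&
  [forall z in M1, forall z' in M1, (z != z') ==> [disjoint link z & link z']].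
have [|M1 /maxsetP[/andP[sM /forall_inP dM] maxM] _] := @maxset_exists _ P set0.
  by rewrite /P sub0set; apply/forall_inP => z; rewrite inE.
have {}dM : {in M1 &, forall z z', z != z' -> [disjoint link z & link z']}.
  by move=> z z' /dM/forall_inP/[apply]/implyP.
exists M1 => //.
pose near_arcs (x : V) := [set z : V * V | e z.1 z.2 && ((z.1 == x) || (z.2 == x))].
have card_near x : (#|near_arcs x| <= 2 * Delta)%N.
  apply: (@leq_trans #|[set (x, w) | w in [set w | e x w]] :|: [set (w, x) | w in [set w | e x w]]|).
    apply/subset_leq_card/subsetP => -[z1 z2]; rewrite !inE /= => /andP[ez /orP[/eqP E|/eqP E]].
      by apply/orP; left; apply/imsetP; exists z2; rewrite ?inE -?E.
    by apply/orP; right; apply/imsetP; exists z1; rewrite ?inE -?E // e_sym.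
  apply: leq_trans (leq_card_setU _ _) _; rewrite mul2n -addnn; apply: leq_add;
    exact: leq_trans (leq_imset_card _ _) _.
have cover_M : M \subset \bigcup_(z in M1) (near_arcs z.1 :|: near_arcs z.2
                   :|: near_arcs (toA z.1) :|: near_arcs (toB z.2)).
  apply/subsetP => z zM.
  have [z' z'M] : exists2 z', z' \in M1 & ~~ [disjoint link z & link z'].
    have [zM1|zM1] := boolP (z \in M1).
      exists z => //; apply/pred0Pn; exists [set z.1; z.2]; rewrite /= !inE eqxx //.
    apply/exists_inP; rewrite -negb_forall_in; apply: contra zM1 => /forall_inP dz.
    have <- : z |: M1 = M1; last by rewrite setU11.
    apply: maxM (subsetUr _ _); rewrite /P subUset sub1set zM sM /=.
    apply/forall_inP => x; rewrite in_setU1 => /orP[/eqP ->|xM];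
      apply/forall_inP => y; rewrite in_setU1 => /orP[/eqP ->|yM]; apply/implyP => //.
    - by rewrite eqxx.
    - by move=> _; apply: dz.
    - by move=> _; rewrite disjoint_sym dz.
    exact: dM.
  move=> /pred0Pn[E /= /andP[Ez Ez']]; apply/bigcupP; exists z' => //.
  have [tz _] := link_touch Ez; have [_ sE] := link_touch Ez'.
  have ez : e z.1 z.2 by move: zM; rewrite !inE => /andP[/and3P[]].
  by case/orP: tz => /sE; rewrite !inE ez /= => /or4P[]/eqP ->; rewrite !eqxx ?orbT.
apply: leq_trans (subset_leq_card cover_M) _.
apply: (@leq_trans (\sum_(z in M1) 8 * Delta)); last by rewrite sum_nat_const mulnC.
elim/big_rec2: _ => [|z n D _ le]; first by rewrite cards0.
apply: leq_trans (leq_card_setU _ _) _; apply: leq_add => //.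
have U4 (S1 S2 S3 S4 : {set V * V}) : (#|S1 :|: S2 :|: S3 :|: S4| <= #|S1| + #|S2| + #|S3| + #|S4|)%N.
  apply: leq_trans (leq_card_setU _ _) _; rewrite leq_add2r.
  by apply: leq_trans (leq_card_setU _ _) _; rewrite leq_add2r leq_card_setU.
apply: leq_trans (U4 _ _ _ _) _.
have -> : (8 * Delta = 2 * Delta + 2 * Delta + 2 * Delta + 2 * Delta)%N by lia.
by rewrite !leq_add // card_near.
Qed.

Variables (R : realType) (q : {set V} -> R) (p iota t : R).
Hypothesis q01 : forall E, 0 <= q E <= 1.
Hypothesis qE : forall x y, e x y -> q [set x; y] = p.
Hypothesis p01 : 0 <= p <= 1.
Hypothesis iota0 : 0 <= iota.
Hypothesis iso : forall S, iota * #|S|%:R * #|~: S|%:R <= #|V|%:R * #|arcs_out S|%:R.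
Hypothesis t0 : 0 <= t.
Hypothesis tA : t <= #|A|%:R.
Hypothesis tB : t <= #|B|%:R.
Hypothesis XV : #|X|%:R * Delta%:R * #|V|%:R <= iota * t ^+ 2 / 2.

(** [halo] contains [A] and misses [B], so isoperimetry applies with [t] on both sides; the arcs
    ending in [X] cost at most half of the bound, by [XV]. *)
Lemma card_links : iota * t ^+ 2 / 2 <= #|V|%:R * #|M|%:R.
Proof.
have h1 : iota * t ^+ 2 <= #|V|%:R * #|arcs_out halo|%:R.
  apply: le_trans (iso halo); rewrite -mulrA ler_wpM2l // expr2; apply: ler_pM => //.
    by apply: le_trans tA _; rewrite ler_nat; apply/subset_leq_card/subsetUl.
  apply: le_trans tB _; rewrite ler_nat; apply/subset_leq_card/subsetP => b bB.
  by rewrite !inE bB /= orbF (disjointFl AB).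
have h2 : (#|arcs_out halo| <= #|M| + #|X| * Delta)%N.
  rewrite -(cardsID [set z : V * V | z.2 \in X] (arcs_out halo)) addnC.
  apply: leq_add.
    by apply/subset_leq_card/subsetP => z; rewrite !inE => /andP[-> ->].
  apply: (@leq_trans #|\bigcup_(x in X) [set (w, x) | w in [set w | e x w]]|).
    apply/subset_leq_card/subsetP => z; rewrite !inE => /andP[/and3P[_ _ ez] zX].
    by apply/bigcupP; exists z.2 => //; apply/imsetP; exists z.1; rewrite ?inE 1?e_sym //; case: z {ez zX}.
  apply: (@leq_trans (\sum_(x in X) Delta)); last by rewrite sum_nat_const.
  elim/big_rec2: _ => [|x n D _ le]; first by rewrite cards0.
  apply: leq_trans (leq_card_setU _ _) _; apply: leq_add => //.
  exact: leq_trans (leq_imset_card _ _) _.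
have h3 : #|arcs_out halo|%:R <= #|M|%:R + #|X|%:R * Delta%:R :> R.
  by rewrite -natrM -natrD ler_nat.
have := ler_wpM2l (ler0n R #|V|) h3; move: h1 XV; rewrite mulrDr.
by set a := iota * t ^+ 2; rewrite [_ * (_ * _)]mulrC; lra.
Qed.

(** Separation closes an edge of every link. Edge-disjoint links are independent, and each is open
    with probability at least [p ^ 3], having at most three edges. *)
Lemma separation_bound :
  Pr q (fun F => [forall a in A, forall b in B, ~~ connect (open_rel e F) a b])
  <= expR (- (p ^+ 3 * (iota * t ^+ 2 / 2) / (#|V|%:R * (8 * Delta%:R)))).
Proof.
have [M1 [sM dM] cM] := disjoint_links; have [p0 p1] := andP p01.
have p3 : 0 <= p ^+ 3 by rewrite exprn_ge0.
apply: (@le_trans _ _ (expR (- (p ^+ 3 * #|M1|%:R)))); last first.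
  rewrite ler_expR lerN2 -mulrA ler_wpM2l //.
  have [->|D0] := posnP Delta; first by rewrite !mulr0 invr0 mulr0.
  have [V0|V0] := posnP #|V|; first by rewrite V0 mul0r invr0 mulr0.
  rewrite ler_pdivrMr ?mulr_gt0 ?ltr0n //.
  apply: le_trans card_links _; rewrite mulrCA ler_wpM2l // mulrC.
  by rewrite -!natrM ler_nat.
apply: (@le_trans _ _ (Ex q (fun F => \prod_(z <- enum M1) (~~ (link z \subset F))%:R))).
  apply: Ex_le => // F; case: forall_inP => [sep|_] /=; last first.
    by apply: prodr_ge0.
  rewrite big1_seq // => z; rewrite mem_enum => /andP[_ /(subsetP sM) zM].
  case lF: (link z \subset F) => //.
  have [a [b [aA bB ab]]] := link_connects zM lF.
  by have /forall_inP/(_ b bB) := sep a aA; rewrite ab.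
rewrite (@Ex_prod_indep _ _ q _ _ link); first last.
- move=> z _ F F' E; congr (~~ _)%:R; rewrite (sameP setIidPr eqP) (sameP setIidPr eqP).
  by rewrite E.
- by move=> z z'; rewrite !mem_enum; apply: dM.
- exact: enum_uniq.
have -> : - (p ^+ 3 * #|M1|%:R) = #|M1|%:R * - p ^+ 3 by ring.
rewrite expRM_natl -prodr_const -[leRHS]big_enum big_seq [leRHS]big_seq.
apply: ler_prod => z; rewrite mem_enum => zM1; have zM := subsetP sM z zM1.
rewrite -/(Pr q (fun F => ~~ (link z \subset F))) Pr_ge0 //= PrC Pr_prod_on.
rewrite (eq_bigr (fun=> p)); last first.
  by move=> E /(link_edge zM)[x [y [exy ->]]]; rewrite qE.
rewrite prodr_const; apply: le_trans (expR_ge1Dx _); rewrite lerD2l lerN2.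
by rewrite ler_wiXn2l // card_link.
Qed.

End Links.

Lemma cluster_refl F v : v \in cluster e F v.
Proof. by rewrite inE. Qed.

Lemma cluster_eq F u v : u \in cluster e F v -> cluster e F u = cluster e F v.
Proof.
rewrite inE => vu; apply/setP => w; rewrite !inE.
by apply/esym/same_connect => //; apply: open_connect_sym.
Qed.

Lemma sub_connect_open F F' x y : F \subset F' ->
  connect (open_rel e F) x y -> connect (open_rel e F') x y.
Proof.
move=> /subsetP sFF'; apply: connect_sub => u v /andP[euv uvF].
by apply: connect1; rewrite /open_rel euv sFF'.
Qed.

(* A minimal union of clusters of [U]-size at least [t] has [U]-size below [2 t]. *)
Lemma cluster_balanced_split (R : realType) F U (t : R) : 0 < t -> 3 * t <= #|U|%:R ->
  (forall v, #|cluster e F v|%:R < t) ->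
  exists A, [/\ A \subset U,
    {in A & U, forall x y, connect (open_rel e F) x y -> y \in A},
    t <= #|A|%:R & t <= #|U :\: A|%:R].
Proof.
move=> t0 tU small.
pose P A := [&& A \subset U,
  [forall x in A, forall y in U, connect (open_rel e F) x y ==> (y \in A)] & t <= #|A|%:R].
have PU : P U.
  rewrite /P subxx /=; apply/andP; split; last by lra.
  by apply/forall_inP => x _; apply/forall_inP => y ->; rewrite implybT.
case: (arg_minnP (fun A : {set V} => #|A|) PU) => A /and3P[sAU cA tA] minA.
have {}cA : {in A & U, forall x y, connect (open_rel e F) x y -> y \in A}.
  by move=> x y xA yU; have /forall_inP/(_ x xA)/forall_inP/(_ y yU)/implyP := cA.
exists A; split=> //.
have /card_gt0P[x xA] : (0 < #|A|)%N by rewrite -(ltr0n R); apply: lt_le_trans tA.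
have small' : #|A :\: cluster e F x|%:R < t.
  rewrite ltNge; apply/negP => tA'; have: (#|A :\: cluster e F x| < #|A|)%N.
    apply/proper_card/properP; split; first exact: subsetDl.
    by exists x => //; rewrite !inE connect0.
  rewrite ltnNge minA //; apply/and3P; split=> //.
    by apply: subset_trans sAU; apply: subsetDl.
  apply/forall_inP => y; rewrite in_setD => /andP[yx yA]; apply/forall_inP => z zU; apply/implyP => yz.
  rewrite in_setD (cA y z) // andbT; apply: contra yx; rewrite !inE => xz.
  by apply: connect_trans xz _; rewrite open_connect_sym.
have cardA : #|A|%:R = #|A :&: cluster e F x|%:R + #|A :\: cluster e F x|%:R :> R.
  by rewrite -natrD cardsID.
have cardI : #|A :&: cluster e F x|%:R <= #|cluster e F x|%:R :> R.
  by rewrite ler_nat; apply/subset_leq_card/subsetIr.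
have : #|U|%:R = #|A|%:R + #|U :\: A|%:R :> R.
  by rewrite -natrD -(cardsID A U) (setIidPr sAU).
have := small x; lra.
Qed.

(** The set [F1] is fixed and only the sprinkled edges are random. Clusters in [U] have at least [s]
    vertices, so there are at most [#|V| / s] of them, and the union bound over their families costs
    [2 ^ (#|V| / s)], which is at most [exp (#|V| / s)]. *)
Lemma merging (R : realType) (q : {set V} -> R) (p iota s t : R) (Delta : nat) F1 :
  (forall v, (#|[set w | e v w]| <= Delta)%N) ->
  (forall E, 0 <= q E <= 1) -> (forall x y, e x y -> q [set x; y] = p) -> 0 <= p <= 1 ->
  0 <= iota ->
  (forall S, iota * #|S|%:R * #|~: S|%:R <= #|V|%:R * #|arcs_out S|%:R) ->
  let U := [set v | s <= #|cluster e F1 v|%:R] in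
  let X := [set y | (y \notin U) && ~~ [exists u in U, e y u]] in
  0 < s -> 0 < t -> 3 * t <= #|U|%:R ->
  #|X|%:R * Delta%:R * #|V|%:R <= iota * t ^+ 2 / 2 ->
  Pr q (fun F2 => ~~ [exists v, t <= #|cluster e (F1 :|: F2) v|%:R]) <=
  expR (#|V|%:R / s - p ^+ 3 * (iota * t ^+ 2 / 2) / (#|V|%:R * (8 * Delta%:R))).
Proof.
move=> deg_le q01 qE p01 iota0 iso U X s0 t0 tU XV.
pose KK := [set cluster e F1 v | v in U].
have tKK : trivIset KK.
  apply/trivIsetP => K K' /imsetP[u uU ->] /imsetP[v vU ->]; apply: contraNT => /pred0Pn[w /= /andP[wu wv]].
  by rewrite -(cluster_eq wu) -(cluster_eq wv).
have sKK : #|KK|%:R <= #|V|%:R / s.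
  rewrite ler_pdivlMr //; apply: (@le_trans _ _ #|cover KK|%:R); last first.
    by rewrite ler_nat max_card.
  rewrite -(eqP tKK) natr_sum -sumr_const mulr_suml; apply: ler_sum => K /imsetP[v + ->].
  by rewrite inE mul1r.
have UK v w : v \in U -> w \in cluster e F1 v -> w \in U.
  by rewrite !inE => vU vw; rewrite (@cluster_eq F1 w v) // inE.
pose sep A F2 := [forall a in A, forall b in U :\: A, ~~ connect (open_rel e F2) a b].
pose Q := [pred A : {set V} | [&& A \subset U, t <= #|A|%:R & t <= #|U :\: A|%:R]].
pose QQ := [pred KS : {set {set V}} | (KS \subset KK) && Q (cover KS)].
apply: (@le_trans _ _ (Pr q (fun F2 => [exists KS, QQ KS && sep (cover KS) F2]))).
  apply: Pr_le => // F2 /existsPn small.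
  have [|A [sAU cA tA tB]] := cluster_balanced_split t0 tU (F := F1 :|: F2).
    by move=> v; rewrite ltNge small.
  (* One side of a split for [F1 :|: F2] is a union of [F1]-clusters; this is why families of
     clusters are counted instead of subsets of [U]. *)
  have AE : cover [set K in KK | K \subset A] = A.
    apply/setP => x; apply/bigcupP/idP => [[K]|xA].
      by rewrite inE => /andP[_ /subsetP]; apply.
    have xU := subsetP sAU x xA.
    exists (cluster e F1 x); last exact: cluster_refl.
    rewrite inE imset_f //; apply/subsetP => y xy; apply: (cA x) => //; first exact: UK xy.
    by move: xy; rewrite inE; apply: sub_connect_open; apply: subsetUl.
  apply/existsP; exists [set K in KK | K \subset A]; rewrite /= AE sAU tA tB !andbT.
  apply/andP; split; first by apply/subsetP => K; rewrite inE => /andP[].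
  apply/forall_inP => a aA; apply/forall_inP => b; rewrite in_setD => /andP[bA bU].
  apply: contra bA => ab; apply: (cA a) => //.
  by apply: sub_connect_open ab; apply: subsetUr.
apply: le_trans (Pr_union_bound q01 _ _) _.
set B := expR _; set b := p ^+ 3 * _ / _ in B *.
apply: (@le_trans _ _ (\sum_(KS in powerset KK) expR (- b))).
  rewrite big_mkcond [leRHS]big_mkcond; apply: ler_sum => KS _; rewrite powersetE /=.
  case: (boolP (KS \subset KK)) => //= _; case: ifP => [/and3P[sU tA tB]|_]; last exact: expR_ge0.
  apply: (@separation_bound _ _ X) => //.
  - by rewrite disjoint_sym disjoint_subset; apply/subsetP => y; rewrite !inE => /andP[].
  - move=> y yX; rewrite (_ : cover KS :|: _ = U); last first.
      by rewrite -[RHS](setID U (cover KS)) (setIidPr sU).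
    move=> yU; move: yX; rewrite inE yU negbK => /existsP[u /andP[uU yu]]; by exists u.
  exact: ltW.
rewrite sumr_const card_powerset -[_ *+ _]mulr_natl natrX /B expRD ler_wpM2r ?expR_ge0 //.
apply: (@le_trans _ _ (expR 1 ^+ #|KK|)).
  apply: lerXn2r; rewrite ?nnegrE ?expR_ge0 //.
  by have := expR_ge1Dx (1 : R); lra.
by rewrite -expRM_natl ler_expR mulr1.
Qed.

End Merging.

(** * Sums over product spaces *)

Section DependentProduct.
Variables (R : realType) (I : finType) (T : I -> finType).
Local Notation V := {dffun forall i : I, T i}.
Implicit Types (u v w : V) (A : {set I}).

Lemma sum_dffun_prod (g : forall i, T i -> R) :
  \sum_(v : V) \prod_i g i (v i) = \prod_i \sum_(x : T i) g i x.
Proof.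
pose P_ i := [ffun x => g i x].
rewrite (reindex (@dffun_of_fprod _ T)); last exact/onW_bij/dffun_of_fprod_bij.
transitivity (\sum_(t : fprod T) \prod_(i in I) P_ i (t i)).
  by apply: eq_bigr => t _; apply: eq_bigr => i _; rewrite !ffunE.
rewrite big_fprod /=.
transitivity (\prod_i \sum_(j in tagged_with T i) untag 0 (P_ i) j).
  by rewrite bigA_distr_big_dep.
apply: eq_bigr => i _; rewrite -(big_tag (fun i => P_ i)).
by apply: eq_bigr => x _; rewrite ffunE.
Qed.

Definition upd v i (x : T i) : V := [ffun j => dfwith v x j].

Definition hyb A u v : V := [ffun i => if i \in A then u i else v i].

Lemma updE v i (x : T i) : upd v x i = x.
Proof. by rewrite ffunE dfwith_in. Qed.

Lemma upd_neq v i (x : T i) j : i != j -> upd v x j = v j.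
Proof. by move=> ij; rewrite ffunE dfwith_out. Qed.

Lemma upd_id v i : upd v (v i) = v.
Proof.
by apply/ffunP => j; have [<-|ij] := eqVneq i j; rewrite ?updE // upd_neq.
Qed.

Lemma upd_upd v i (x y : T i) : upd (upd v x) y = upd v y.
Proof.
by apply/ffunP => j; have [<-|ij] := eqVneq i j; rewrite ?updE // !upd_neq.
Qed.

Lemma upd_inj v i : injective (@upd v i).
Proof. by move=> x y /ffunP/(_ i); rewrite !updE. Qed.

(** Resampling one coordinate preserves the uniform measure: exchanging the old and the new value is
    an involution on pairs. *)
Lemma sum_upd i (f : V -> R) :
  \sum_v \sum_(x : T i) f (upd v x) = #|T i|%:R * \sum_v f v.
Proof.
pose h (z : V * T i) := (upd z.1 z.2, z.1 i).
have hK : involutive h by case=> v x; rewrite /h /= updE upd_upd upd_id.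
rewrite pair_bigA /= (reindex_inj (inv_inj hK)) /=.
rewrite -(pair_bigA _ (fun v (x : T i) => f (upd (upd v x) (v i)))) /= mulr_sumr.
apply: eq_bigr => v _; rewrite (eq_bigr (fun=> f v)); last by move=> x _; rewrite upd_upd upd_id.
by rewrite sumr_const mulr_natl.
Qed.

Lemma sum_coord i (phi : T i -> R) :
  #|T i|%:R * \sum_(v : V) phi (v i) = #|{: V}|%:R * \sum_x phi x.
Proof.
rewrite -(sum_upd i (fun v => phi (v i))) (eq_bigr (fun=> \sum_x phi x)).
  by rewrite sumr_const mulr_natl.
by move=> v _; apply: eq_bigr => x _; rewrite updE.
Qed.

(** From [exp (- x / 2) >= 1 - x / 2], squared and inverted. What remains is
    [x ^ 2 (1 - 3 x + x ^ 2) >= 0], and [x <= 1 / 3] makes [1 - 3 x] nonnegative. *)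
Lemma expR_le_quad (x : R) : `|x| <= 1 / 3 -> expR x <= 1 + x + x ^+ 2.
Proof.
rewrite ler_norml => /andP[x1 x2].
have h1 : 1 - x / 2 <= expR (- (x / 2)) by exact: expR_ge1Dx.
have h2 : expR x = (expR (- (x / 2)) ^+ 2)^-1.
  by rewrite -expRM_natl -expRN; congr expR; field.
rewrite h2 -[_^-1]mul1r ler_pdivrMr ?exprn_gt0 ?expR_gt0 //.
have h3 : (1 - x / 2) ^+ 2 <= expR (- (x / 2)) ^+ 2.
  by apply: lerXn2r; rewrite // nnegrE ?expR_ge0 //; lra.
have h4 : 0 <= 1 + x + x ^+ 2 by nra.
apply: (@le_trans _ _ ((1 + x + x ^+ 2) * (1 - x / 2) ^+ 2)); last by rewrite ler_wpM2l.
have -> : (1 + x + x ^+ 2) * (1 - x / 2) ^+ 2 = 1 + x ^+ 2 * (1 - 3 * x + x ^+ 2) / 4 by field.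
have : 0 <= x ^+ 2 * (1 - 3 * x + x ^+ 2).
  by rewrite mulr_ge0 ?sqr_ge0 //; have := sqr_ge0 x; lra.
lra.
Qed.

(** Exponential moments under the uniform measure: centring removes the linear term of
    [expR_le_quad], and each coordinate contributes at most [exp (lam ^ 2 B ^ 2)]. *)
Lemma chernoff_product (g : forall i, T i -> R) (B lam s : R) :
  (forall i, \sum_x g i x = 0) -> (forall i x, `|g i x| <= B) ->
  0 <= lam -> lam * B <= 1 / 3 ->
  #|[set v : V | s <= \sum_i g i (v i)]|%:R <=
  #|{: V}|%:R * expR (lam ^+ 2 * B ^+ 2 * #|I|%:R - lam * s).
Proof.
move=> g0 gB lam0 lamB.
have cardV : #|{: V}|%:R = \prod_i #|T i|%:R :> R.
  transitivity (\sum_(v : V) \prod_(i : I) (1 : R)).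
    transitivity (\sum_(v : V) (1 : R)); last by apply: eq_bigr => v _; rewrite big1.
    by rewrite sumr_const; congr (_ *+ _); apply: eq_card.
  transitivity (\prod_i \sum_(x : T i) (1 : R)); first exact: (sum_dffun_prod (fun _ _ => 1)).
  by apply: eq_bigr => i _; rewrite sumr_const.
rewrite expRB mulrA ler_pdivlMr ?expR_gt0 //.
apply: (@le_trans _ _ (\sum_(v : V) \prod_i expR (lam * g i (v i)))).
  rewrite -sumr_const mulr_suml big_mkcond; apply: ler_sum => v _; rewrite inE.
  rewrite -expR_sum -mulr_sumr; case: ifP => h; last exact: expR_ge0.
  by rewrite mul1r ler_expR ler_wpM2l.
rewrite (sum_dffun_prod (fun i x => expR (lam * g i x))).
have -> : lam ^+ 2 * B ^+ 2 * #|I|%:R = #|I|%:R * (lam ^+ 2 * B ^+ 2) by rewrite mulrC.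
rewrite expRM_natl -prodr_const cardV -big_split /=; apply: ler_prod => i _.
rewrite sumr_ge0 /= => [|x _]; last exact: expR_ge0.
apply: (@le_trans _ _ (\sum_(x : T i) (1 + lam ^+ 2 * B ^+ 2 + lam * g i x))).
  apply: ler_sum => x _; apply: le_trans (expR_le_quad _) _.
    by rewrite normrM (ger0_norm lam0); apply: le_trans lamB; rewrite ler_wpM2l.
  have : lam ^+ 2 * g i x ^+ 2 <= lam ^+ 2 * B ^+ 2.
    rewrite ler_wpM2l ?sqr_ge0 // -[g i x ^+ 2]real_normK ?num_real //.
    by apply: lerXn2r; rewrite ?nnegrE // (le_trans _ (gB i x)).
  rewrite exprMn; lra.
rewrite big_split /= -mulr_sumr g0 mulr0 addr0 sumr_const -[_ *+ _]mulr_natl.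
by rewrite ler_wpM2l // expR_ge1Dx.
Qed.

End DependentProduct.

(** * Cartesian products *)

Section ProductGraph.
Variables (n : nat) (G : 'I_n -> sgraph).
Local Notation V := {dffun forall i : 'I_n, G i}.
Implicit Types (u v w : V) (A : {set 'I_n}) (S : {set V}).

Definition adj_in A : rel V := fun u v =>
  [exists i in A, adj (u i) (v i) && [forall j, (j != i) ==> (u j == v j)]].

Definition deg_in A v : nat := \sum_(i in A) deg (v i).

Lemma adj_inP A u v :
  reflect (exists i (x : G i), [/\ i \in A, adj (u i) x & v = upd u x]) (adj_in A u v).
Proof.
apply: (iffP exists_inP) => [[i iA /andP[auv /forallP uv]]|[i [x [iA ux ->]]]].
  exists i, (v i); split=> //; apply/ffunP => j.
  have [<-|ij] := eqVneq i j; first by rewrite updE.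
  by rewrite upd_neq //; have := uv j; rewrite eq_sym ij => /eqP.
exists i => //; rewrite updE ux /=; apply/forallP => j; apply/implyP => ji.
by rewrite upd_neq // eq_sym.
Qed.

Lemma adj_in_sym A : symmetric (adj_in A).
Proof.
move=> u v; apply: eq_existsb => i; rewrite adj_sym.
by under eq_forallb do rewrite [u _ == _]eq_sym.
Qed.

Lemma adj_in_irr A : irreflexive (adj_in A).
Proof. by move=> u; apply/negbTE/exists_inPn => i _; rewrite adj_irr. Qed.

Lemma sub_adj_in A A' u v : A \subset A' -> adj_in A u v -> adj_in A' u v.
Proof. by move=> /subsetP sA /exists_inP[i iA uv]; apply/exists_inP; exists i; rewrite ?sA. Qed.

Lemma adj_in_setT : adj_in setT =2 @cart_adj n G.
Proof. by move=> u v; apply: eq_existsb => i; rewrite inE. Qed.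

Lemma card_nbrs A v (Q : pred V) : #|[set w | adj_in A v w & Q w]| =
  (\sum_(i in A) #|[set x : G i | adj (v i) x & Q (upd v x)]|)%N.
Proof.
pose S i := if i \in A then [set upd v x | x in [set x : G i | adj (v i) x & Q (upd v x)]] else set0.
transitivity #|\bigcup_i S i|.
  congr #|pred_of_set _|; apply/setP => w; rewrite inE; apply/andP/bigcupP.
    move=> [/adj_inP[i [x [iA vx ->]]] Qx]; exists i => //; rewrite /S iA.
    by apply: imset_f; rewrite inE vx.
  move=> [i _]; rewrite /S; case: ifP => [iA|]; last by rewrite inE.
  case/imsetP => x; rewrite inE => /andP[vx Qx] ->; split=> //.
  by apply/adj_inP; exists i, x.
rewrite -sum1_card partition_disjoint_bigcup /=; last first.
  move=> i j ij; apply/pred0Pn => -[w /= /andP[]]; rewrite /S.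
  case: ifP => _; last by rewrite inE.
  case: ifP => _; last by rewrite inE.
  case/imsetP => x; rewrite inE => /andP[vx _] -> /imsetP[y _] /ffunP/(_ i).
  by rewrite updE upd_neq 1?eq_sym // => xv; rewrite xv adj_irr in vx.
rewrite [RHS]big_mkcond; apply: eq_bigr => i _; rewrite sum1_card /S.
case: ifP => _; last by rewrite cards0.
by rewrite card_imset //; apply: upd_inj.
Qed.

Lemma deg_inE A v : #|[set w | adj_in A v w]| = deg_in A v.
Proof.
transitivity #|[set w | adj_in A v w & predT w]|.
  by congr #|pred_of_set _|; apply/setP => w; rewrite !inE andbT.
rewrite card_nbrs; apply: eq_bigr => i _.
by congr #|pred_of_set _|; apply/setP => w; rewrite !inE andbT.
Qed.

Lemma deg_in_upd A v i (x : G i) : i \notin A -> deg_in A (upd v x) = deg_in A v.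
Proof.
move=> iA; apply: eq_bigr => j jA; rewrite upd_neq //.
by apply: contraNneq iA => ->.
Qed.

Section DegreeBounds.
Variable B : nat.
Hypothesis deg_ge1 : forall i (x : G i), (1 <= deg x)%N.
Hypothesis deg_le : forall i (x : G i), (deg x <= B.+1)%N.

(** At most one summand changes, and it stays between 1 and [B.+1]. *)
Lemma deg_in_lip A A' u v : adj_in A u v -> (deg_in A' u <= deg_in A' v + B)%N.
Proof.
move=> /adj_inP[i [x [_ _ ->]]]; case: (boolP (i \in A')) => [iA|iA]; last first.
  by rewrite deg_in_upd // leq_addr.
rewrite /deg_in (bigD1 i) //= [in leqRHS](bigD1 i) //= updE.
rewrite (eq_bigr (fun j => deg (upd u x j))); last by move=> j /andP[_ ji]; rewrite upd_neq // eq_sym.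
rewrite addnAC leq_add2r; apply: leq_trans (deg_le _) _.
by rewrite -add1n leq_add2r.
Qed.

Lemma deg_in_ge A v : (#|A| <= deg_in A v)%N.
Proof. by rewrite -sum1_card; apply: leq_sum => i _. Qed.

Lemma deg_in_le A v : (deg_in A v <= #|A| * B.+1)%N.
Proof. by rewrite -sum_nat_const; apply: leq_sum => i _. Qed.

End DegreeBounds.

(** * Isoperimetry of Cartesian products *)

Section Isoperimetry.
Variables (R : realType) (kappa : R).
Hypothesis kappa0 : 0 <= kappa.
Hypothesis G_gt0 : forall i, (0 < #|G i|)%N.
Hypothesis iso_factor : forall i (S : {set G i}),
  kappa * #|S|%:R * #|~: S|%:R <= #|G i|%:R * #|arcs_out (@adj (G i)) S|%:R.

Let in_out S i (z : V) (x : G i) : R := (z \in S)%:R * (upd z x \notin S)%:R.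

(** The average of [iso_factor] over all lines in direction [i]; [Sw] is the trace of [S] on the
    line through [w]. *)
Lemma iso_coord S i :
  kappa * (\sum_(z : V) \sum_(x : G i) in_out S z x) <=
  #|G i|%:R * \sum_(z : V) \sum_(x : G i) (adj (z i) x)%:R * in_out S z x.
Proof.
have N0 : 0 < #|G i|%:R :> R by rewrite ltr0n.
rewrite -(ler_pM2l N0) mulrCA -sum_upd -[X in _ <= _ * X]sum_upd !mulr_sumr.
apply: ler_sum => w _; pose Sw := [set x : G i | upd w x \in S].
have card_sum (H : finType) (P : pred H) : #|[set x | P x]|%:R = \sum_x (P x)%:R :> R.
  rewrite -sum1_card natr_sum big_mkcond; apply: eq_bigr => x _; rewrite inE; by case: (P x).
have -> : \sum_(x' : G i) \sum_(x : G i) in_out S (upd w x') x = #|Sw|%:R * #|~: Sw|%:R.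
  rewrite /Sw card_sum [X in _ * X](_ : _ = \sum_(x : G i) (upd w x \notin S)%:R).
    rewrite mulr_suml; apply: eq_bigr => x' _; rewrite mulr_sumr.
    by apply: eq_bigr => x _; rewrite /in_out upd_upd.
  by rewrite -card_sum; congr (_%:R); congr #|pred_of_set _|; apply/setP => x; rewrite !inE.
have -> : \sum_(x' : G i) \sum_(x : G i) (adj (upd w x' i) x)%:R * in_out S (upd w x') x =
    #|arcs_out (@adj (G i)) Sw|%:R.
  rewrite card_sum pair_bigA /=; apply: eq_bigr => -[x' x] _ /=.
  rewrite /in_out upd_upd updE !inE.
  by case: (adj _ _); case: (_ \in S); case: (_ \in S); rewrite /= ?mul0r ?mul1r ?mulr0.
by rewrite mulrA; apply: iso_factor.
Qed.

(* Passing from [u] to [v] one coordinate at a time, a walk from [S] to its complement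
   leaves [S] at some step, which resamples a single coordinate. *)
Let hybrid k u v : V := hyb [set i : 'I_n | (i < k)%N] v u.

(** Swapping the coordinates below [i] is a bijection on pairs, so the hybrid before the step is
    uniform and independent of the value resampled at [i]. *)
Lemma hybrid_step (i : 'I_n) (f : V -> V -> R) :
  \sum_(u : V) \sum_(v : V) f (hybrid i u v) (hybrid i.+1 u v) = \sum_(z : V) \sum_(w : V) f z (upd z (w i)).
Proof.
pose A := [set j : 'I_n | (j < i)%N].
pose h (z : V * V) := (hyb A z.2 z.1, hyb A z.1 z.2).
have hK : involutive h.
  by case=> u v; congr pair; apply/ffunP => j; rewrite !ffunE; case: (j \in A).
rewrite !pair_bigA [RHS](reindex_inj (inv_inj hK)) /=.
apply: eq_bigr => -[u v] _ /=; congr (f _ _); apply/ffunP => j.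
have [<-|ij] := eqVneq i j; first by rewrite updE !ffunE !inE ltnS leqnn ltnn.
rewrite upd_neq // !ffunE !inE ltnS (leq_eqVlt j).
by have /negbTE -> : (j != i :> nat) by rewrite eq_sym.
Qed.

Lemma first_exit (b : nat -> bool) m : b 0%N -> ~~ b m ->
  exists2 k, (k < m)%N & b k && ~~ b k.+1.
Proof.
move=> b0; elim: m => [|m IH] bm; first by rewrite b0 in bm.
case: (boolP (b m)) => [bm'|/IH[k km bk]]; first by exists m; rewrite ?bm'.
by exists k => //; apply: ltnW.
Qed.

(** The form with [#|S| * #|~: S|] counts pairs, and for this reason it passes to products with the
    same [kappa]: each pair is charged to a coordinate where its hybrid walk leaves [S], and
    [iso_coord] bounds the exits of every coordinate by boundary arcs in that direction. *)
Lemma iso_product S :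
  kappa * #|S|%:R * #|~: S|%:R <= #|{: V}|%:R * #|arcs_out (adj_in setT) S|%:R.
Proof.
pose C i : R := \sum_(z : V) \sum_(w : V) in_out S z (w i : G i).
pose Bo i : R := \sum_(z : V) \sum_(x : G i) (adj (z i) x)%:R * in_out S z x.
have CB i : kappa * C i <= #|{: V}|%:R * Bo i.
  have N0 : 0 < #|G i|%:R :> R by rewrite ltr0n.
  rewrite -(ler_pM2l N0) mulrCA.
  have -> : #|G i|%:R * C i = #|{: V}|%:R * (\sum_(z : V) \sum_(x : G i) in_out S z x).
    rewrite /C !mulr_sumr; apply: eq_bigr => z _; exact: (sum_coord (in_out S z)).
  rewrite mulrCA [leRHS]mulrCA ler_wpM2l //; exact: iso_coord.
have pairs : #|S|%:R * #|~: S|%:R <= \sum_i C i.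
  have card_sum (H : finType) (P : {set H}) : #|P|%:R = \sum_x (x \in P)%:R :> R.
    by rewrite -sum1_card natr_sum big_mkcond; apply: eq_bigr => x _; case: (x \in P).
  rewrite (eq_bigr (fun i : 'I_n => \sum_(u : V) \sum_(v : V)
    (hybrid i u v \in S)%:R * (hybrid i.+1 u v \notin S)%:R)); last first.
    by move=> i _; rewrite (hybrid_step i (fun z z' => (z \in S)%:R * (z' \notin S)%:R)).
  rewrite !card_sum mulr_suml exchange_big /=; apply: ler_sum => u _.
  rewrite mulr_sumr exchange_big /=; apply: ler_sum => v _; rewrite inE.
  case: (boolP (u \in S)) => [uS|_]; last by rewrite mul0r sumr_ge0.
  case: (boolP (v \in S)) => [_|vS]; first by rewrite mulr0 sumr_ge0.
  have [||k kn /andP[zk zk']] := @first_exit (fun k => hybrid k u v \in S) n.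
  - by rewrite (_ : hybrid 0 u v = u) //; apply/ffunP => j; rewrite ffunE inE.
  - by rewrite (_ : hybrid n u v = v) //; apply/ffunP => j; rewrite ffunE inE ltn_ord.
  rewrite (bigD1 (Ordinal kn)) //= zk zk' lerDl; apply: sumr_ge0 => i _; by [].
have arcs : \sum_i Bo i <= #|arcs_out (adj_in setT) S|%:R.
  rewrite exchange_big /= -sum1_card natr_sum.
  rewrite (eq_bigl (fun z : V * V => (z.1 \in S) && ((z.2 \notin S) && adj_in setT z.1 z.2))); last first.
    by move=> z; rewrite inE.
  rewrite -(pair_big_dep (fun u => u \in S) (fun u v => (v \notin S) && adj_in setT u v) (fun _ _ => 1)) /=.
  rewrite [leRHS]big_mkcond; apply: ler_sum => u _; case: ifP => uS; last first.
    by apply: sumr_le0 => i _; apply: sumr_le0 => x _; rewrite /in_out uS mul0r mulr0.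
  rewrite [leRHS](_ : _ = #|[set w | adj_in setT u w & w \notin S]|%:R); last first.
    by rewrite -sum1_card natr_sum; apply: eq_bigl => w; rewrite inE andbC.
  rewrite card_nbrs natr_sum [leRHS]big_mkcond; apply: ler_sum => i _; rewrite inE.
  rewrite -sum1_card natr_sum [leRHS]big_mkcond; apply: ler_sum => x _; rewrite inE /in_out uS mul1r.
  by case: (adj _ _); case: (_ \notin S); rewrite ?mulr1 ?mul0r ?mulr0.
rewrite -mulrA; apply: (@le_trans _ _ (kappa * \sum_i C i)); first by rewrite ler_wpM2l.
apply: (@le_trans _ _ (#|{: V}|%:R * \sum_i Bo i)); last by rewrite ler_wpM2l.
by rewrite !mulr_sumr; apply: ler_sum => i _; apply: CB.
Qed.

End Isoperimetry.
End ProductGraph.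

(** * Fibers of a coordinate set and the edges between them *)

Section Fibers.
Variables (n : nat) (G : 'I_n -> sgraph).
Local Notation V := {dffun forall i : 'I_n, G i}.
Implicit Types (u v w x y : V) (A D : {set 'I_n}) (F : {set {set V}}) (T : {set V}).

Definition fiber A v : {set V} := [set u : V | [forall j, (j \notin A) ==> (u j == v j)]].

(** The empty set is excluded because it would belong to every fiber and spoil
    [edges_in_disjoint]. *)
Definition edges_in A v : {set {set V}} :=
  [set E : {set V} | (E != set0) && (E \subset fiber A v)].

Lemma fiberP A v u : reflect (forall j, j \notin A -> u j = v j) (u \in fiber A v).
Proof.
rewrite inE; apply: (iffP forallP) => [h j jA|h j]; first by have /implyP/(_ jA)/eqP := h j.
by apply/implyP => /h ->.
Qed.

Lemma fiber_refl A v : v \in fiber A v.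
Proof. exact/fiberP. Qed.

Lemma fiber_adj A v u w : u \in fiber A v -> adj_in A u w -> w \in fiber A v.
Proof.
move=> /fiberP uv /adj_inP[i [x [iA _ ->]]]; apply/fiberP => j jA.
by rewrite upd_neq ?uv //; apply: contraNneq jA => <-.
Qed.

Lemma open_adj_inS A A' F u v : A \subset A' ->
  connect (open_rel (adj_in A) F) u v -> connect (open_rel (adj_in A') F) u v.
Proof.
move=> sA; apply: connect_sub => x y /andP[xy xyF]; apply: connect1.
by rewrite /open_rel xyF (sub_adj_in sA).
Qed.

Lemma cluster_fiber A F v : cluster (adj_in A) F v \subset fiber A v.
Proof.
apply/subsetP => u; rewrite inE => /connectP[s + ->].
elim/last_ind: s => [_|s w IH]; first exact: fiber_refl.
by rewrite rcons_path last_rcons => /andP[/IH vs /andP[/(fiber_adj vs)]].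
Qed.

Lemma depends_on_cluster A v : depends_on (edges_in A v) (fun F => cluster (adj_in A) F v).
Proof.
move=> F F' E.
suff sub F1 F2 : F1 :&: edges_in A v = F2 :&: edges_in A v ->
    cluster (adj_in A) F1 v \subset cluster (adj_in A) F2 v.
  by apply/eqP; rewrite eqEsubset !sub.
move=> {}E; apply/subsetP => u; rewrite inE => /connectP[s + ->].
elim/last_ind: s => [_|s w IH]; first by rewrite inE.
rewrite rcons_path last_rcons => /andP[/[dup] vs /IH vs2 /andP[lw lwF]].
move: vs2; rewrite !inE => vs2; apply: connect_trans vs2 (connect1 _); rewrite /open_rel lw /=.
have lv : last v s \in fiber A v.
  by apply: (subsetP (cluster_fiber A F1 v)); rewrite inE; apply/connectP; exists s.
have : [set last v s; w] \in F1 :&: edges_in A v.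
  rewrite in_setI lwF /= in_set; apply/andP; split; first by apply/set0Pn; exists w; rewrite set22.
  by rewrite subUset !sub1set lv (fiber_adj lv lw).
by rewrite E inE => /andP[].
Qed.

Lemma edges_in_disjoint A v v' : v' \notin fiber A v ->
  [disjoint edges_in A v & edges_in A v'].
Proof.
move=> vv'; rewrite -setI_eq0; apply: contraT => /set0Pn[E]; rewrite in_setI 2!in_set.
move=> /andP[/andP[/set0Pn[x xE] /subsetP sE] /andP[_ /subsetP sE']].
case/negP: vv'; apply/fiberP => j jA.
by have /fiberP/(_ j jA) <- := sE x xE; have /fiberP/(_ j jA) -> := sE' x xE.
Qed.

Section CrossEdges.
Variables (A D : {set 'I_n}) (v : V).
Hypothesis AD : [disjoint A & D].

Definition nbrs : {set V} := [set v' : V | adj_in D v v'].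

Lemma fiber_nbrs v' x : v' \in nbrs -> x \in fiber A v' -> x \notin fiber A v.
Proof.
rewrite inE => /adj_inP[j [z [jD vz ->]]] /fiberP xv'.
have jA : j \notin A by rewrite (disjointFl AD).
apply/negP => /fiberP/(_ j jA); rewrite xv' // updE => zv.
by rewrite zv adj_irr in vz.
Qed.

Lemma fiber_nbrs2 v' v'' x : v' \in nbrs -> v'' \in nbrs ->
  x \in fiber A v' -> x \in fiber A v'' -> v' = v''.
Proof.
rewrite !inE => /adj_inP[j [z [jD _ ->]]] /adj_inP[j' [z' [jD' _ ->]]].
have jA i : i \in A -> (j != i) && (j' != i).
  by move=> iA; apply/andP; split; apply: contraTneq iA => <-; rewrite (disjointFl AD).
move=> /forallP x1 /forallP x2; apply/ffunP => i.
have [/jA/andP[ji j'i]|iA] := boolP (i \in A); first by rewrite !upd_neq.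
by have := x1 i; have := x2 i; rewrite iA => /eqP <- /eqP.
Qed.

Lemma hyb_fiber u v' : hyb A u v' \in fiber A v'.
Proof. by apply/fiberP => j jA; rewrite ffunE (negbTE jA). Qed.

(** [hyb A u v'] is the translate of [u] along the edge from [v] to [v']. *)
Lemma hyb_adj u v' : v' \in nbrs -> u \in fiber A v -> adj_in D u (hyb A u v').
Proof.
rewrite inE => /adj_inP[j [z [jD vz ->]]] /fiberP uv.
have jA : j \notin A by rewrite (disjointFl AD).
apply/adj_inP; exists j, z; split=> //; first by rewrite uv.
apply/ffunP => i; rewrite ffunE; have [<-|ji] := eqVneq j i.
  by rewrite (negbTE jA) !updE.
by rewrite !upd_neq //; case: ifP => // /negbT iA; rewrite uv.
Qed.

Lemma cross_edge_inj v' : v' \in nbrs ->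
  {in fiber A v &, injective (fun u => [set u; hyb A u v'])}.
Proof.
move=> v'N u w uv wv /setP/(_ u); rewrite !inE eqxx /= => /esym/orP[/eqP //|/eqP uw].
by have := fiber_nbrs v'N (hyb_fiber w v'); rewrite -uw uv.
Qed.

(** All that decides the success of [v']: the edges leading from the fiber of [v] into that of [v']
    and those inside the latter. They are disjoint for distinct neighbours and disjoint from the
    edges that determine the cluster of [v] in its own fiber. *)
Definition cross_edges v' : {set {set V}} :=
  [set E : {set V} | ~~ [disjoint E & fiber A v'] & E \subset fiber A v :|: fiber A v'].

Lemma cross_edges_disjoint v' v'' : v' \in nbrs -> v'' \in nbrs -> v' != v'' ->
  [disjoint cross_edges v' & cross_edges v''].
Proof.
move=> v'N v''N ne; rewrite -setI_eq0; apply: contraT => /set0Pn[E]; rewrite in_setI 2!in_set.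
move=> /andP[/andP[/pred0Pn[x /= /andP[xE xv']] _] /andP[_ /subsetP/(_ x xE)]]; rewrite in_setU.
by rewrite (negbTE (fiber_nbrs v'N xv')) /= => /(fiber_nbrs2 v'N v''N xv') eqv; case/eqP: ne.
Qed.

Lemma cross_edges_out v' : v' \in nbrs -> cross_edges v' \subset ~: edges_in A v.
Proof.
move=> v'N; apply/subsetP => E; rewrite in_setC 2!in_set => /andP[/pred0Pn[x /= /andP[xE xv']] _].
rewrite negb_and; apply/orP; right; apply/subsetPn; exists x => //.
exact: fiber_nbrs xv'.
Qed.

Lemma edges_in_cross v' : edges_in A v' \subset cross_edges v'.
Proof.
apply/subsetP => E; rewrite 2!in_set => /andP[/set0Pn[x xE] sE]; apply/andP; split.
  by apply/pred0Pn; exists x; rewrite /= xE (subsetP sE).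
by apply: subset_trans sE (subsetUr _ _).
Qed.

Lemma cross_edge_mem u v' : u \in fiber A v -> [set u; hyb A u v'] \in cross_edges v'.
Proof.
move=> uv; rewrite inE; apply/andP; split.
  by apply/pred0Pn; exists (hyb A u v'); rewrite /= set22 hyb_fiber.
by rewrite subUset !sub1set !in_setU uv hyb_fiber orbT.
Qed.

End CrossEdges.
End Fibers.

(** * Growing clusters block by block *)

Section Growth.
Variables (n : nat) (G : 'I_n -> sgraph).
Local Notation V := {dffun forall i : 'I_n, G i}.
Variables (R : realType) (q : {set V} -> R) (p : R).
Hypothesis q01 : forall E, 0 <= q E <= 1.
Hypothesis qE : forall x y : V, adj_in setT x y -> q [set x; y] = p.
Hypothesis p01 : 0 <= p <= 1.
Variables (h : V -> nat) (A0 : {set 'I_n}) (H : nat).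
Hypothesis h_loc : forall u v : V, (forall i, i \in A0 -> u i = v i) -> h u = h v.
Implicit Types (u v w x y : V) (A D : {set 'I_n}) (F : {set {set V}}) (T : {set V}).

Definition good A (b : nat) (s : R) x F : bool :=
  s <= #|[set y in cluster (adj_in A) F x | (H <= h y + b)%N]|%:R.

(* [H - b] is the degree required of the root [v]; the vertices counted in its cluster may
   fall short of it by a further [a]. *)
Definition growth A (bmax a : nat) (s c : R) : Prop := forall v (b : nat),
  (b <= bmax)%N -> (H <= h v + b)%N -> c <= Pr q (good A (b + a) s v).

Lemma depends_on_good A b s x : depends_on (edges_in A x) (good A b s x).
Proof. by move=> F F' E; rewrite /good (depends_on_cluster E). Qed.

(** Two independent stages: the edges from [T] into the fiber of [v'] select an entry point through
    [pk], and the edges inside that fiber, still unrevealed, give its cluster. The entry point has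
    the same [h] as its translate in [T] because [A0] is contained in [A]. *)
Lemma Pr_cross_success A D v v' T (s c : R) (b b' : nat) :
  A0 \subset A -> [disjoint A & D] -> v' \in nbrs D v -> T \subset fiber A v ->
  (forall u, u \in T -> (H <= h u + b)%N) -> s <= #|T|%:R -> 0 <= c ->
  (forall x, (H <= h x + b)%N -> c <= Pr q (good A b' s x)) ->
  (1 - expR (- (p * s))) * c <=
  Pr q (fun F => [exists u in T, ([set u; hyb A u v'] \in F) && good A b' s (hyb A u v') F]).
Proof.
move=> sA AD v'N sT hT sTc c0 hc; have [p0 p1] := andP p01.
pose Y F := [set u in T | [set u; hyb A u v'] \in F].
pose pk (S : {set V}) := odflt v [pick u in S].
have pkP S : S != set0 -> pk S \in S.
  by move=> /set0Pn[u uS]; rewrite /pk; case: pickP => [//|/(_ u)]; rewrite uS.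
pose Psi F F' : R := (Y F != set0)%:R * (good A b' s (hyb A (pk (Y F)) v') F')%:R.
apply: (@le_trans _ _ (Ex q (fun F => Psi F F))); last first.
  apply: Ex_le => // F; rewrite /Psi; case: eqVneq => [_|Y0]; first by rewrite mul0r.
  rewrite mul1r ler_nat; case gF: good => //; rewrite lt0b; apply/exists_inP.
  have := pkP _ Y0; rewrite inE => /andP[pT pF].
  by exists (pk (Y F)) => //; rewrite pF gF.
pose S := [set E : {set V} | ~~ (E \subset fiber A v')].
rewrite (@Ex_decouple _ _ q S Psi); last 2 first.
- move=> F' F1 F2 E; rewrite /Psi; suff -> : Y F1 = Y F2 by [].
  apply/setP => u; rewrite !inE; case uT: (u \in T) => //=.
  have /setP/(_ [set u; hyb A u v']) := E; rewrite !inE.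
  suff -> : ~~ ([set u; hyb A u v'] \subset fiber A v') by rewrite !andbT.
  rewrite subUset !sub1set negb_and; apply/orP; left.
  by apply: contraL (subsetP sT u uT) => uv'; apply: (fiber_nbrs AD v'N).
- move=> F F1 F2 E; rewrite /Psi; congr (_ * (_ : bool)%:R); apply: depends_on_good.
  apply/setP => B; have /setP/(_ B) := E; rewrite !inE negbK.
  have -> : fiber A (hyb A (pk (Y F)) v') = fiber A v'.
    apply/setP => x; apply/fiberP/fiberP => xv j jA; rewrite xv //;
      by have /fiberP/(_ j jA) := hyb_fiber A (pk (Y F)) v'.
  case: (B \subset fiber A v'); rewrite ?andbF // !andbT => BE.
  by case: (B != set0); rewrite ?andbF ?andbT.
apply: (@le_trans _ _ (Ex q (fun F => c * (Y F != set0)%:R))); last first.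
  apply: Ex_le => // F; rewrite ExZ mulrC; case: eqVneq => [_|Y0]; rewrite ?mul0r // !mul1r.
  apply: hc; rewrite (h_loc (v := pk (Y F))).
    by have := pkP _ Y0; rewrite inE => /andP[/hT].
  by move=> i /(subsetP sA) iA; rewrite ffunE iA.
rewrite ExZ mulrC ler_wpM2l //.
pose S3 := [set [set u; hyb A u v'] | u in T].
have -> : Ex q (fun F => (Y F != set0)%:R) = 1 - Pr q (fun F => [disjoint S3 & F]).
  rewrite -PrC; apply: eq_Ex => F; congr (_ : bool)%:R; apply/set0Pn/idP.
    move=> [u]; rewrite inE => /andP[uT uF]; apply/pred0Pn; exists [set u; hyb A u v'].
    by rewrite /= uF andbT; apply: imset_f.
  by move=> /pred0Pn[E /= /andP[/imsetP[u uT ->] uF]]; exists u; rewrite inE uT.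
rewrite lerD2l lerN2 Pr_disjoint big_imset /=; last first.
  by move=> u w /(subsetP sT) uv /(subsetP sT) wv; apply: (cross_edge_inj AD v'N).
rewrite (eq_bigr (fun=> 1 - p)); last first.
  by move=> u /(subsetP sT) uv; rewrite qE //;
    apply: (sub_adj_in (finset.subsetT D)); apply: (hyb_adj (v := v)).
rewrite prodr_const; apply: (@le_trans _ _ (expR (- p) ^+ #|T|)).
  by apply: lerXn2r; rewrite ?nnegrE ?subr_ge0 ?expR_ge0 //; apply: expR_ge1Dx.
rewrite -expRM_natl ler_expR; nra.
Qed.

(** Made for the last block: no connection to [v] is required, so each event lives on the fiber of
    its own neighbour. *)
Lemma Pr_good_nbrs A D v (s c : R) (b b' : nat) :
  A0 \subset A -> [disjoint A & D] -> (H <= h v + b)%N -> 0 <= c ->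
  (forall x, (H <= h x + b)%N -> c <= Pr q (good A b' s x)) ->
  Pr q (fun F => #|[set v' in nbrs D v | good A b' s v' F]|%:R <= c * #|nbrs D v|%:R / 2) <=
  expR (- (c * #|nbrs D v|%:R / 8)).
Proof.
move=> sA AD hv c0 hc.
have := @Pr_indep_count_tail _ _ q q01 _ (enum (nbrs D v)) (edges_in A) (fun v' => good A b' s v') c.
rewrite -cardE => /(_ (enum_uniq _) c0 _ _ _) tail.
apply: le_trans (tail _ _ _) => {tail}.
- apply: Pr_le => // F; rewrite -size_filter (_ : size _ = #|[set v' in nbrs D v | good A b' s v' F]|) //.
  rewrite cardE; apply: perm_size; apply: uniq_perm; [exact/filter_uniq/enum_uniq|exact: enum_uniq|].
  by move=> v'; rewrite mem_filter !mem_enum [RHS]inE andbC.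
- move=> v' v''; rewrite !mem_enum => v'N v''N ne; apply: edges_in_disjoint.
  by apply: contra_neqN ne => /(fiber_nbrs2 AD v''N v'N (fiber_refl _ _)).
- by move=> v' _; apply: depends_on_good.
move=> v'; rewrite mem_enum => v'N; apply: hc; rewrite (h_loc (v := v)) //.
move=> i /(subsetP sA) iA; move: v'N; rewrite inE => /adj_inP[j [x [jD _ ->]]].
by rewrite upd_neq //; apply: contraTneq iA => <-; rewrite (disjointFl AD).
Qed.

(** A neighbour succeeds with probability at least [k], so at least [k m / 2] fibers contribute [s]
    vertices each. The slack doubles, [a] being spent in the cluster of the root and again in the
    fibers entered from it; the hypothesis is applied at deficit [b + a], hence the smaller
    [bmax]. *)
Lemma growth_step A D (bmax a : nat) (s c m : R) :
  A0 \subset A -> [disjoint A & D] -> 0 <= m -> (forall v, m <= #|nbrs D v|%:R) ->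
  0 <= s -> 0 <= c -> growth A (bmax + a) a s c ->
  let k := (1 - expR (- (p * s))) * c in
  growth (A :|: D) bmax (a + a) (k * m / 2 * s) (c * (1 - expR (- (k * m / 8)))).
Proof.
move=> sA AD m0 hm s0 c0 gA k v b bb hv; have [p0 p1] := andP p01.
have k0 : 0 <= k by rewrite mulr_ge0 // subr_ge0 expR_le1 oppr_le0 mulr_ge0.
pose T F := [set u in cluster (adj_in A) F v | (H <= h u + (b + a))%N].
pose E F v' F' := [exists u in T F, ([set u; hyb A u v'] \in F') &&
   good A (b + (a + a)) s (hyb A u v') F'].
pose X F F' := [set v' in nbrs D v | E F v' F'].
have sT F : T F \subset fiber A v.
  apply: subset_trans (cluster_fiber A F v); apply/subsetP => u.
  by rewrite inE => /andP[].
pose Psi F F' : R := (s <= #|T F|%:R)%R%:R * (k * m / 2 <= #|X F F'|%:R)%R%:R.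
apply: (@le_trans _ _ (Ex q (fun F => Psi F F))); last first.
  apply: Ex_le => // F; rewrite /Psi -natrM mulnb ler_nat.
  case: (boolP (_ && _)) => //= /andP[_ kX].
  rewrite lt0b /good; set W := [set y in _ | _].
  apply: (@le_trans _ _ (#|X F F|%:R * s)); first by rewrite ler_wpM2r.
  (* Pieces in different fibers are disjoint, so their sizes add up. *)
  pose piece v' := if v' \in X F F then W :&: fiber A v' else set0.
  apply: (@le_trans _ _ #|\bigcup_v' piece v'|%:R); last first.
    rewrite ler_nat; apply/subset_leq_card/bigcupsP => v' _.
    by rewrite /piece; case: ifP => _; rewrite ?sub0set ?subsetIl.
  rewrite -[in leRHS]sum1_card partition_disjoint_bigcup /=; last first.
    move=> v' v'' ne; rewrite /piece -setI_eq0; case: ifP => [v'X|_]; last by rewrite set0I.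
    case: ifP => [v''X|_]; last by rewrite setI0.
    apply: contraT => /set0Pn[x]; rewrite !in_setI => /andP[/andP[_ xv'] /andP[_ xv'']].
    by case/eqP: ne; move: v'X v''X; rewrite !inE => /andP[+ _] /andP[+ _]; rewrite -!in_set => v'N v''N;
      apply: (fiber_nbrs2 AD v'N v''N xv' xv'').
  rewrite natr_sum -sumr_const mulr_suml big_mkcond /=; apply: ler_sum => v' _.
  rewrite sum1_card /piece; case: ifP => v'X; last by rewrite cards0.
  have := v'X; rewrite in_set => /andP[v'N /exists_inP[u uT /andP[uF gu]]].
  rewrite mul1r; apply: (le_trans gu); rewrite ler_nat; apply/subset_leq_card/subsetP => y.
  rewrite in_set => /andP[yu hy]; rewrite in_setI in_set hy andbT.
  have uv := subsetP (sT F) u uT.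
  apply/andP; split; last first.
    have /fiberP yf := subsetP (cluster_fiber _ _ _) y yu.
    by apply/fiberP => j jA; rewrite yf // ffunE (negbTE jA).
  move: yu uT; rewrite !inE => yu /andP[vu _].
  apply: connect_trans (open_adj_inS (finset.subsetUl _ _) vu) _.
  apply: connect_trans (connect1 _) (open_adj_inS (finset.subsetUl _ _) yu).
  rewrite /open_rel uF andbT; apply: (sub_adj_in (finset.subsetUr A D)).
  exact: (hyb_adj (v := v)).
rewrite (@Ex_decouple _ _ q (edges_in A v) Psi); last 2 first.
- by move=> F' F1 F2 EF; rewrite /Psi /X /E /T (depends_on_cluster EF).
- move=> F F1 F2 EF; rewrite /Psi; suff -> : X F F1 = X F F2 by [].
  apply/setP => v'; rewrite [LHS]in_set [RHS]in_set; case v'N: (v' \in nbrs D v) => //=.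
  apply: eq_existsb => u; case uT: (u \in T F) => //=.
  have sub := cross_edges_out AD v'N.
  have {}EF : F1 :&: cross_edges A v v' = F2 :&: cross_edges A v v'.
    by rewrite -(setIidPr sub) !finset.setIA EF.
  congr (_ && _).
    have /setP/(_ [set u; hyb A u v']) := EF; rewrite !in_setI.
    by rewrite cross_edge_mem ?andbT //; apply: (subsetP (sT F)).
  apply: depends_on_good.
  have -> : edges_in A (hyb A u v') = edges_in A v'.
    apply/setP => B; rewrite !inE; congr (_ && (B \subset pred_of_set _)).
    apply/setP => x; apply/fiberP/fiberP => xv j jA; rewrite xv //;
      by have /fiberP/(_ j jA) := hyb_fiber A u v'.
  by rewrite -(setIidPr (edges_in_cross A v v')) !finset.setIA EF.
apply: (@le_trans _ _ (Ex q (fun F => (1 - expR (- (k * m / 8))) * (s <= #|T F|%:R)%R%:R))).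
  rewrite ExZ mulrC ler_wpM2l //; last exact: gA (leq_trans bb (leq_addr _ _)) hv.
  by rewrite subr_ge0 expR_le1 oppr_le0; apply: divr_ge0 => //; apply: mulr_ge0.
apply: Ex_le => // F; rewrite ExZ mulrC; case: (boolP (s <= #|T F|%:R)) => sTF; rewrite ?mul0r // !mul1r.
pose bad F' := #|X F F'|%:R <= k * #|nbrs D v|%:R / 2.
apply: (@le_trans _ _ (1 - Pr q bad)); last first.
  rewrite -PrC; apply: Pr_le => // F'; rewrite /bad -ltNge => /ltW; apply: le_trans.
  by rewrite ler_pM2r ?invr_gt0 // ler_wpM2l.
rewrite lerD2l lerN2.
apply: (@le_trans _ _ (expR (- (k * #|nbrs D v|%:R / 8)))); last first.
  by rewrite ler_expR lerN2 ler_pM2r ?invr_gt0 // ler_wpM2l.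
have := @Pr_indep_count_tail _ _ q q01 _ (enum (nbrs D v)) (cross_edges A v) (E F) k.
rewrite -cardE => /(_ (enum_uniq _) k0 _ _ _) tail.
apply: le_trans (tail _ _ _) => {tail}.
- apply: Pr_le => // F'; rewrite /bad -size_filter (_ : size _ = #|X F F'|) //.
  rewrite cardE; apply: perm_size; apply: uniq_perm; [exact/filter_uniq/enum_uniq|exact: enum_uniq|].
  by move=> v'; rewrite mem_filter !mem_enum [RHS]in_set andbC.
- by move=> v' v''; rewrite !mem_enum; apply: (cross_edges_disjoint AD).
- move=> v'; rewrite mem_enum => v'N F1 F2 EF.
  apply: eq_existsb => u; case uT: (u \in T F) => //=.
  congr (_ && _).
    have /setP/(_ [set u; hyb A u v']) := EF; rewrite !in_setI.
    by rewrite cross_edge_mem ?andbT //; apply: (subsetP (sT F)).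
  apply: depends_on_good.
  have -> : edges_in A (hyb A u v') = edges_in A v'.
    apply/setP => B; rewrite !inE; congr (_ && (B \subset pred_of_set _)).
    apply/setP => x; apply/fiberP/fiberP => xv j jA; rewrite xv //;
      by have /fiberP/(_ j jA) := hyb_fiber A u v'.
  by rewrite -(setIidPr (edges_in_cross A v v')) !finset.setIA EF.
move=> v'; rewrite mem_enum => v'N; apply: (Pr_cross_success (b := (b + a)%N) sA AD v'N) => //.
  by move=> u; rewrite inE => /andP[].
move=> x hx; rewrite addnA; apply: gA => //; by rewrite leq_add2r.
Qed.

End Growth.

(** * From the percolation model to product measures *)

Section Factors.
Variables (R : realType) (H : sgraph).
Implicit Types (S : {set H}).

Lemma deg_ge1 : connected_graph H -> (1 <= #|edges H|)%N -> forall x : H, (1 <= deg x)%N.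
Proof.
move=> [_ conn] /card_gt0P[E]; rewrite inE => /existsP[a /existsP[b /andP[ab _]]] x.
have [z zx] : exists z : H, z != x.
  have [xa|] := eqVneq a x; last by exists a.
  by exists b; apply: contraTneq ab => ->; rewrite xa adj_irr.
have /connectP[[|y s] /= + zE] := conn x z; first by rewrite zE eqxx in zx.
by move=> /andP[xy _]; apply/card_gt0P; exists y; rewrite inE.
Qed.

Lemma arcs_out_setC S : #|arcs_out (@adj H) (~: S)| = #|arcs_out (@adj H) S|.
Proof.
pose sw (z : H * H) := (z.2, z.1).
have sw_inj : injective sw by move=> [a b] [c d] [-> ->].
rewrite -(card_imset _ sw_inj); congr #|pred_of_set _|; apply/setP => -[a b].
apply/imsetP/idP => [[[c d]]|]; rewrite !inE /=.
  by move=> /and3P[cS dS cd] [-> ->]; rewrite negbK in dS; rewrite dS cS adj_sym.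
by move=> /and3P[aS bS ab]; exists (b, a); rewrite // !inE /= negbK aS bS adj_sym.
Qed.

Lemma card_edge_boundary S : (#|edge_boundary S| <= #|arcs_out (@adj H) S|)%N.
Proof.
apply: (@leq_trans #|[set [set z.1; z.2] | z in arcs_out (@adj H) S]|); last exact: leq_imset_card.
apply/subset_leq_card/subsetP => E; rewrite inE => /andP[xyE /exists_inP[x xS /exists_inP[y yS /eqP Exy]]].
rewrite Exy; apply/imsetP; exists (x, y) => //; rewrite !inE xS /=.
rewrite inE in yS; rewrite yS /=; move: xyE; rewrite inE => /existsP[a /existsP[b /andP[ab /eqP xyab]]].
have xy : x != y by apply: contraNneq yS => <-.
have /orP[/eqP yb|/eqP yb] : (y == a) || (y == b) by rewrite -in_set2 -xyab Exy set22.
all: have /orP[/eqP xa|/eqP xa] : (x == a) || (x == b) by rewrite -in_set2 -xyab Exy set21.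
- by move: xy; rewrite xa yb eqxx.
- by rewrite xa yb adj_sym.
- by rewrite xa yb.
by move: xy; rewrite xa yb eqxx.
Qed.

(** The smaller of [S] and its complement obeys the isoperimetric bound, and the other has at most
    [#|H|] vertices. *)
Lemma iso_const_arcs (kappa : R) : (2 <= #|H|)%N -> 0 <= kappa -> kappa <= iso_const H R ->
  forall S, kappa * #|S|%:R * #|~: S|%:R <= #|H|%:R * #|arcs_out (@adj H) S|%:R.
Proof.
move=> H2 k0 kH.
have small S : (2 * #|S| <= #|H|)%N -> kappa * #|S|%:R <= #|arcs_out (@adj H) S|%:R.
  move=> S2; have [->|S0] := posnP #|S|; first by rewrite mulr0.
  have [_ /(_ S)] := @iso_constP H R H2; rewrite /iso_admissible S0 S2 => /(_ isT) kS.
  apply: (@le_trans _ _ #|edge_boundary S|%:R); last by rewrite ler_nat card_edge_boundary.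
  by rewrite -ler_pdivlMr ?ltr0n //; apply: le_trans kH kS.
have cHS S : (#|S| <= #|H|)%N by apply: max_card.
move=> S; have [S2|S2] := leqP (2 * #|S|) #|H|.
  rewrite mulrC ler_pM ?ler0n ?mulr_ge0 //; last exact: small.
  by rewrite ler_nat.
have C2 : (2 * #|~: S| <= #|H|)%N by have := cardsC S; lia.
rewrite mulrAC mulrC ler_pM ?ler0n ?mulr_ge0 ?ler_nat //.
by rewrite -arcs_out_setC; apply: small.
Qed.

End Factors.

Section Glue.
Variables (R : realType) (G : sgraph).
Implicit Types (p : R) (F : {set {set G}}).

(* Non-edges are closed almost surely, so that the percolation measure becomes a product
   measure on all of [{set {set G}}]. *)
Definition edge_prob p : {set G} -> R := fun E => if E \in edges G then p else 0.

Lemma edge_prob01 p : 0 <= p <= 1 -> forall E, 0 <= edge_prob p E <= 1.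
Proof. by move=> p01 E; rewrite /edge_prob; case: ifP; rewrite // lexx ler01. Qed.

Lemma edge_probE p (x y : G) : adj x y -> edge_prob p [set x; y] = p.
Proof.
move=> xy; rewrite /edge_prob inE ifT //; apply/existsP; exists x; apply/existsP; exists y.
by rewrite xy eqxx.
Qed.

Lemma perc_probE p (A : pred sgraph) :
  perc_prob G p A = Pr (edge_prob p) (fun F => A (spanning_subgraph F)).
Proof.
rewrite /perc_prob /Pr /Ex /perc_weight.
rewrite [RHS](bigID (fun F : {set {set G}} => F \subset edges G)) /=.
rewrite [X in _ = _ + X]big1 ?addr0 => [|F /subsetPn[E EF nE]]; last first.
  by rewrite (bigD1 E) //= EF /edge_prob (negbTE nE) !mul0r.
under [RHS]eq_bigr => F _ do rewrite mulr_natr mulrb.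
rewrite -big_mkcondr; apply: eq_big => [F|F]; first by rewrite powersetE.
rewrite powersetE => /andP[/subsetP FE _].
rewrite big_mkcond; apply: eq_bigr => E _; rewrite /edge_prob; case: ifP => [//|nE].
by case: ifP => [/FE|_]; rewrite ?nE ?subr0.
Qed.

Lemma L1_le F (M : R) : 0 <= M ->
  (forall x, #|cluster (@adj G) F x|%:R <= M) -> (L1 (spanning_subgraph F))%:R <= M.
Proof.
move=> M0 small; rewrite /L1.
by elim/big_ind: _ => // [a b aM bM|x _]; [rewrite /maxn; case: ifP | apply: small].
Qed.

Lemma L1_ge F (M : R) x : M <= #|cluster (@adj G) F x|%:R -> M <= (L1 (spanning_subgraph F))%:R.
Proof.
move=> /le_trans; apply; rewrite ler_nat.
exact: (@leq_bigmax _ (fun x : spanning_subgraph F => #|component x|) x).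
Qed.

Lemma sum_deg (H : sgraph) : (0 < #|H|)%N ->
  avg_degree H R * #|H|%:R = \sum_(x : H) (deg x)%:R.
Proof. by move=> H0; rewrite /avg_degree divfK ?natr_sum // pnatr_eq0 -lt0n. Qed.

End Glue.

(** * Average degree and degree concentration in a product *)

Section ProductDegrees.
Variables (R : realType) (n : nat) (G : 'I_n -> sgraph) (C : nat).
Local Notation V := {dffun forall i : 'I_n, G i}.
Hypothesis G_gt0 : forall i, (0 < #|G i|)%N.
Hypothesis deg1 : forall i (x : G i), (1 <= deg x)%N.
Hypothesis degC : forall i (x : G i), (deg x <= C)%N.
Implicit Types (A : {set 'I_n}) (v : V).

Let avg i : R := avg_degree (G i) R.

Lemma avg_ge1 i : 1 <= avg i.
Proof.
rewrite /avg -(ler_pM2r (_ : 0 < #|G i|%:R)) ?ltr0n // sum_deg // mul1r -sumr_const.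
by apply: ler_sum => x _; rewrite ler1n.
Qed.

Lemma avg_le i : avg i <= C%:R.
Proof.
rewrite /avg -(ler_pM2r (_ : 0 < #|G i|%:R)) ?ltr0n // sum_deg // mulr_natr -sumr_const.
by apply: ler_sum => x _; rewrite ler_nat.
Qed.

Lemma card_product_gt0 : (0 < #|{: V}|)%N.
Proof.
have xi i : {x : G i | true} by have /card_gt0P/sigW[x _] := G_gt0 i; exists x.
by apply/card_gt0P; exists [ffun i => sval (xi i)].
Qed.

Lemma avg_degree_product : avg_degree (cart_prod G) R = \sum_i avg i.
Proof.
have V0 : 0 < #|{: V}|%:R :> R by rewrite ltr0n card_product_gt0.
rewrite /avg_degree -[RHS](mulfK (lt0r_neq0 V0)); congr (_ / _).
rewrite natr_sum (eq_bigr (fun v : V => \sum_i (deg (v i))%:R)); last first.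
  move=> v _; rewrite -natr_sum; congr (_%:R).
  transitivity (deg_in setT v); last by apply: eq_bigl => i; rewrite inE.
  by rewrite -deg_inE; congr #|pred_of_set _|; apply/setP => w; rewrite !inE adj_in_setT.
rewrite exchange_big mulr_suml; apply: eq_bigr => i _ /=.
have N0 : #|G i|%:R != 0 :> R by rewrite pnatr_eq0 -lt0n.
apply: (mulfI N0); rewrite (sum_coord (fun x : G i => (deg x)%:R)) -sum_deg //.
by rewrite [LHS]mulrC [RHS]mulrA; congr (_ * _); rewrite mulrC.
Qed.

Lemma avg_product_ge : n%:R <= avg_degree (cart_prod G) R.
Proof.
rewrite avg_degree_product -[n in n%:R]card_ord -sumr_const.
by apply: ler_sum => i _; apply: avg_ge1.
Qed.

Lemma avg_product_le : avg_degree (cart_prod G) R <= n%:R * C%:R.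
Proof.
rewrite avg_degree_product mulr_natl -[n in _ *+ n]card_ord -sumr_const.
by apply: ler_sum => i _; apply: avg_le.
Qed.

Lemma deviation_bound i (x : G i) : `|(deg x)%:R - avg i| <= C%:R - 1.
Proof.
have d1 : 1 <= (deg x)%:R :> R by rewrite ler1n.
have dC : (deg x)%:R <= C%:R :> R by rewrite ler_nat.
by have := avg_ge1 i; have := avg_le i; rewrite ler_norml; lra.
Qed.

Lemma sum_deviation i : \sum_(x : G i) ((deg x)%:R - avg i) = 0.
Proof.
by rewrite big_split /= sumr_const -sum_deg // mulNrn mulr_natr subrr.
Qed.

Lemma upper_degree_tail (lam s : R) : 0 <= lam -> lam * (C%:R - 1) <= 1 / 3 ->
  #|[set v : V | avg_degree (cart_prod G) R + s <= (deg_in setT v)%:R]|%:R <=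
  #|{: V}|%:R * expR (lam ^+ 2 * (C%:R - 1) ^+ 2 * n%:R - lam * s).
Proof.
move=> lam0 lamC.
have := @chernoff_product R _ (fun i => G i) (fun i x => (deg x)%:R - avg i) _ _ s
  sum_deviation deviation_bound lam0 lamC.
rewrite card_ord; apply: le_trans; rewrite ler_nat.
apply/subset_leq_card/subsetP => v; rewrite !inE avg_degree_product => h.
rewrite big_split /= sumrN lerBrDl; apply: le_trans h _.
by rewrite -natr_sum ler_nat /deg_in; apply: eq_leq; apply: eq_bigl => i; rewrite inE.
Qed.

Lemma lower_degree_tail A (lam s : R) : 0 <= lam -> lam * C%:R <= 1 / 3 ->
  #|[set v : V | (deg_in A v)%:R + s <= \sum_(i in A) avg i]|%:R <=
  #|{: V}|%:R * expR (lam ^+ 2 * C%:R ^+ 2 * n%:R - lam * s).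
Proof.
move=> lam0 lamC.
pose g i (x : G i) : R := if i \in A then avg i - (deg x)%:R else 0.
have := @chernoff_product R _ (fun i => G i) g C%:R lam s.
rewrite card_ord => /(_ _ _ lam0 lamC) ch; apply: le_trans (ch _ _) => {ch}.
- rewrite ler_nat; apply/subset_leq_card/subsetP => v; rewrite !inE => h.
  rewrite -big_mkcond /= big_split /= sumrN lerBrDr addrC.
  by apply: le_trans h; rewrite -natr_sum lerD2r.
- move=> i; rewrite /g; case: (i \in A); last by rewrite big1.
  apply/eqP; rewrite -oppr_eq0 -sumrN; apply/eqP.
  transitivity (\sum_(x : G i) ((deg x)%:R - avg i)); last exact: sum_deviation.
  by apply: eq_bigr => x _; rewrite opprB.
move=> i x; rewrite /g; case: ifP => _; last by rewrite normr0.
by rewrite distrC; apply: le_trans (deviation_bound x) _; rewrite gerBl.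
Qed.

Lemma card_product_ge : (forall i, 2 <= #|G i|)%N -> (2 ^ n <= #|{: V}|)%N.
Proof.
move=> G2; rewrite -(ler_nat R).
have -> : #|{: V}|%:R = \sum_(v : V) \prod_(i : 'I_n) (1 : R).
  transitivity (\sum_(v : V) (1 : R)); last by apply: eq_bigr => v _; rewrite big1.
  by rewrite sumr_const; congr (_ *+ _); apply: eq_card.
rewrite (_ : \sum_(v : V) _ = \prod_i \sum_(x : G i) (1 : R)); last first.
  exact: (sum_dffun_prod (T := fun i => G i) (fun _ _ => 1)).
rewrite natrX -[n in _ ^+ n]card_ord -prodr_const; apply: ler_prod => i _.
by rewrite sumr_const ler0n /= ler_nat G2.
Qed.

End ProductDegrees.

(** * The subcritical regime *)

Section Asymptotics.
Variable R : realType.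

Lemma cvg_one_of_harmonic_error (f : nat -> R) (K : R) (N : nat) :
  (forall n, (N <= n)%N -> 1 - K / n%:R <= f n <= 1) -> (f @ \oo --> (1 : R))%classic.
Proof.
move=> bnd; apply/cvgrPdist_le => e e0; near=> n.
have nN : (N <= n)%N by near: n; exists N.
have n0 : (0 < n)%N by near: n; exists 1%N.
have nK : K / e <= n%:R by near: n; apply: nbhs_infty_ger.
have /andP[lo hi] := bnd n nN.
have : K / n%:R <= e by rewrite ler_pdivrMr ?ltr0n // mulrC -ler_pdivrMr.
by rewrite ger0_norm; lra.
Unshelve. all: by end_near. Qed.

Lemma expRN_le_pow (x : R) j : 0 < x -> expR (- x) <= j.+1`!%:R / x ^+ j.+1.
Proof.
move=> x0; have f0 : 0 < j.+1`!%:R :> R by rewrite ltr0n fact_gt0.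
have lb := expR_ge1Dxn j (ltW x0).
rewrite expRN -[leRHS]invf_div lef_pV2 ?posrE ?expR_gt0 ?divr_gt0 ?exprn_gt0 //; lra.
Qed.

Lemma expR_half_le_pow2 n : expR (n%:R / 2) <= 2 ^+ n :> R.
Proof.
rewrite mulrC mulrC expRM_natl; apply: lerXn2r; rewrite ?nnegrE ?expR_ge0 //.
have : 1 - 1 / 2 <= expR (- (1 / 2)) :> R by exact: expR_ge1Dx.
rewrite expRN div1r => h; have := expR_gt0 (2^-1 : R) => e0.
by rewrite -[leLHS]invrK -[leRHS]invrK lef_pV2 ?posrE ?invr_gt0 //; lra.
Qed.

End Asymptotics.

Lemma cluster_ext (V : finType) (e e' : rel V) F v : e =2 e' -> cluster e F v = cluster e' F v.
Proof.
move=> ee; apply/setP => u; rewrite !inE; apply: eq_connect => x y.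
by rewrite /open_rel ee.
Qed.

Section Subcritical.
Variables (R : realType) (n : nat) (G : 'I_n -> sgraph) (C : nat) (eps : R).
Local Notation V := {dffun forall i : 'I_n, G i}.
Hypothesis G2 : forall i, (2 <= #|G i|)%N.
Hypothesis deg1 : forall i (x : G i), (1 <= deg x)%N.
Hypothesis degC : forall i (x : G i), (deg x <= C)%N.
Hypothesis C1 : (1 <= C)%N.
Hypothesis n0 : (0 < n)%N.
Hypotheses (eps0 : 0 < eps) (eps1 : eps < 1).

Let d : R := avg_degree (cart_prod G) R.
Let p : R := (1 - eps) / d.
Let B : R := C%:R - 1.
(* Degrees deviate from their mean by at most [B = C - 1]. Any [beta] with [B <= beta < C] and
   [2 beta ^ 2 < C ^ 3] gives both error exponents an edge over [eps ^ 2 / (9 C ^ 2)]. *)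
Let beta : R := C%:R - 1 / 2.

Let G_gt0 i : (0 < #|G i|)%N. Proof. exact: leq_trans (G2 i). Qed.
Let nR : 0 < n%:R :> R. Proof. by rewrite ltr0n. Qed.
Let dn : n%:R <= d. Proof. exact: avg_product_ge. Qed.
Let CR : 1 <= C%:R :> R. Proof. by rewrite ler1n. Qed.
Let facts : [/\ 0 < eps, eps < 1, 0 < n%:R :> R, n%:R <= d & 1 <= C%:R :> R].
Proof. by []. Qed.

Lemma subcritical_p01 : 0 <= p <= 1.
Proof.
have [e0 e1 n0' nd c1] := facts.
have d1 : 1 <= d by apply: le_trans dn; rewrite ler1n.
have d0 : 0 < d by lra.
have e2 : 0 <= 1 - eps by lra.
by rewrite /p divr_ge0 ?(ltW d0) //= ler_pdivrMr //; lra.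
Qed.

(** Since [d >= n], the degree allowance uses up at most two thirds of the gain [exp (- eps)]. *)
Lemma saw_factor i : p * (d + 2 / 3 * eps * n%:R + (C.-1 * i)%:R) <=
  expR (- (eps / 3) + B * i%:R / n%:R).
Proof.
have [e0 e1 n0' nd c1] := facts.
have d0 : 0 < d by lra.
have -> : (C.-1 * i)%:R = B * i%:R by rewrite natrM -subn1 natrB.
have B0 : 0 <= B by rewrite /B; lra.
pose y : R := 2 / 3 * eps + B * i%:R / n%:R.
have y0 : 0 <= y.
  have : 0 <= B * i%:R / n%:R by rewrite divr_ge0 ?mulr_ge0 // ltW.
  by rewrite /y; lra.
apply: (@le_trans _ _ ((1 - eps) * (1 + y))).
  have -> : p * (d + 2 / 3 * eps * n%:R + B * i%:R) = (1 - eps) * ((d + 2 / 3 * eps * n%:R + B * i%:R) / d).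
    by rewrite /p mulrAC mulrA.
  rewrite ler_wpM2l ?subr_ge0 ?(ltW e1) // ler_pdivrMr //.
  have : y * n%:R <= y * d by rewrite ler_wpM2l.
  have -> : y * n%:R = 2 / 3 * eps * n%:R + B * i%:R by rewrite /y; field; rewrite lt0r_neq0.
  lra.
have -> : - (eps / 3) + B * i%:R / n%:R = - eps + y by rewrite /y; field; rewrite lt0r_neq0.
rewrite expRD ler_pM //; [lra|lra|exact: expR_ge1Dx|exact: expR_ge1Dx].
Qed.

Lemma saw_product k : \prod_(i < k) (p * (d + 2 / 3 * eps * n%:R + (C.-1 * i)%:R)) <=
  expR (- (k%:R * eps / 3 - B * k%:R ^+ 2 / (2 * n%:R))).
Proof.
have [e0 e1 n0' nd c1] := facts.
have B0 : 0 <= B by rewrite /B; lra.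
have /andP[p0 p1] := subcritical_p01; have d0 : 0 < d by lra.
elim: k => [|k IH]; first by rewrite big_ord0 !mul0r expr0n /= mulr0 mul0r subrr oppr0 expR0.
rewrite big_ord_recr /=; apply: le_trans (ler_pM _ _ IH (saw_factor k)) _.
- apply: prodr_ge0 => i _; rewrite mulr_ge0 // !addr_ge0 //; nra.
- rewrite mulr_ge0 // !addr_ge0 //; nra.
rewrite -expRD ler_expR (_ : k.+1%:R = k%:R + 1 :> R); last by rewrite natr1.
have -> : - ((k%:R + 1) * eps / 3 - B * (k%:R + 1) ^+ 2 / (2 * n%:R)) =
  - (k%:R * eps / 3 - B * k%:R ^+ 2 / (2 * n%:R)) + (- (eps / 3) + B * k%:R / n%:R) + B / (2 * n%:R).
  by field; rewrite lt0r_neq0.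
by rewrite lerDl divr_ge0 // mulr_ge0 // ltW.
Qed.

(** The exponent in [saw_product] is best at [eps n / (3 B)]; [beta] replaces [B], which vanishes
    for [C = 1]. As [B <= beta], no factor exceeds 1 up to this length. *)
Let k := Num.truncn (eps * n%:R / (3 * beta)).
Let M : R := expR (- (eps ^+ 2 * n%:R / (9 * C%:R ^+ 2))) * #|{: V}|%:R.

Lemma saw_length : k%:R <= eps * n%:R / (3 * beta) < k%:R + 1.
Proof.
have [e0 e1 n0' nd c1] := facts.
rewrite natr1; apply: truncn_itv; apply: divr_ge0; first by rewrite mulr_ge0 // ltW.
by rewrite /beta; lra.
Qed.

Lemma saw_product_le1 j : (j <= k)%N ->
  \prod_(i < j) (p * (d + 2 / 3 * eps * n%:R + (C.-1 * i)%:R)) <= 1.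
Proof.
have [e0 e1 n0' nd c1] := facts.
move=> jk; have B0 : 0 <= B by rewrite /B; lra.
have b0 : 0 < beta by rewrite /beta; lra.
have Bb : B <= beta by rewrite /B /beta; lra.
have /andP[p0 p1] := subcritical_p01; have d0 : 0 < d by lra.
apply: (@le_trans _ _ (\prod_(i < j) (1 : R))); last by rewrite big1.
apply: ler_prod => i _; apply/andP; split.
  rewrite mulr_ge0 // !addr_ge0 //; nra.
apply: le_trans (saw_factor i) _; rewrite expR_le1.
have /andP[kb _] := saw_length.
have ik : i%:R <= k%:R :> R by rewrite ler_nat ltnW // (leq_trans (ltn_ord i)).
rewrite addrC subr_le0.
rewrite ler_pdivrMr //; apply: (@le_trans _ _ (beta * (eps * n%:R / (3 * beta)))).
  by apply: ler_pM => //; apply: le_trans kb.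
have -> : beta * (eps * n%:R / (3 * beta)) = eps / 3 * n%:R by field; rewrite lt0r_neq0.
by [].
Qed.

(** Rounding [k] down costs at most [eps / 3], and [2 * beta - B = C] produces the [C] in the
    exponent. *)
Lemma saw_product_end :
  \prod_(i < k) (p * (d + 2 / 3 * eps * n%:R + (C.-1 * i)%:R)) <=
  expR (1 / 3 - eps ^+ 2 * C%:R / (18 * beta ^+ 2) * n%:R).
Proof.
have [e0 e1 n0' nd c1] := facts.
apply: le_trans (saw_product k) _; rewrite ler_expR.
have b0 : 0 < beta by rewrite /beta; lra.
have B0 : 0 <= B by rewrite /B; lra.
have BE : B = 2 * beta - C%:R by rewrite /B /beta; field.
have /andP[kb kb1] := saw_length; set K := eps * n%:R / (3 * beta) in kb kb1.
have K0 : 0 <= K by rewrite divr_ge0 ?mulr_ge0 ?ltW.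
have h1 : (K - 1) * eps / 3 <= k%:R * eps / 3.
  by rewrite ler_pM2r ?invr_gt0 // ler_pM2r //; lra.
have h2 : B * k%:R ^+ 2 / (2 * n%:R) <= B * K ^+ 2 / (2 * n%:R).
  rewrite ler_pM2r ?invr_gt0 ?mulr_gt0 // ler_wpM2l //.
  by apply: lerXn2r; rewrite ?nnegrE.
have h3 : K * eps / 3 - B * K ^+ 2 / (2 * n%:R) = eps ^+ 2 * C%:R / (18 * beta ^+ 2) * n%:R.
  rewrite BE.
  by rewrite /K; field; rewrite !lt0r_neq0.
rewrite mulrBl mul1r mulrBl in h1; lra.
Qed.

(** All vertices of a component larger than [M] lie in [big F], so Markov's inequality divides their
    expected number by [M]. The factor [#|V| / M] is [exp (eps ^ 2 n / (9 C ^ 2))], which the first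
    two exponents beat by the choice of [beta]. *)
Lemma subcritical_bound :
  Pr (edge_prob p) (fun F => M < (L1 (spanning_subgraph (G := cart_prod G) F))%:R) <=
  (expR (- (eps ^+ 2 / (9 * beta ^+ 2) * n%:R)) +
   expR (1 / 3 - eps ^+ 2 * C%:R / (18 * beta ^+ 2) * n%:R) + n%:R / M) * (#|{: V}|%:R / M).
Proof.
have [e0 e1 n0' nd c1] := facts.
have b0 : 0 < beta by rewrite /beta; lra.
have B0 : 0 <= B by rewrite /B; lra.
have V0 : 0 < #|{: V}|%:R :> R by rewrite ltr0n; apply: card_product_gt0.
have M0 : 0 < M by rewrite mulr_gt0 // expR_gt0.
have q01 := @edge_prob01 R (cart_prod G) p subcritical_p01.
pose e : rel V := adj_in setT.
have qE (x y : V) : e x y -> edge_prob (G := cart_prod G) p [set x; y] = p.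
  by move=> xy; apply: edge_probE; rewrite /= -adj_in_setT.
have clE F (v : V) : cluster (@adj (cart_prod G)) F v = cluster e F v.
  by apply: cluster_ext => x y; rewrite /e adj_in_setT.
pose big F := [set v : V | M < #|cluster e F v|%:R].
apply: (@le_trans _ _ (Ex (edge_prob (G := cart_prod G) p) (fun F => #|big F|%:R) / M)).
  apply: markov_Pr => // F ML.
  have [v Mv] : exists v : V, M < #|cluster e F v|%:R.
    apply/existsP; move: ML; apply: contraLR; rewrite -leNgt => /existsPn small.
    by apply: L1_le; [exact: ltW | move=> v; rewrite clE leNgt small].
  apply: le_trans (ltW Mv) _; rewrite ler_nat; apply/subset_leq_card/subsetP => u uv.
  by rewrite inE (cluster_eq (adj_in_sym _) uv).
rewrite mulrA ler_pM2r ?invr_gt0 //.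
have -> : Ex (edge_prob (G := cart_prod G) p) (fun F => #|big F|%:R) =
    \sum_(v : V) Pr (edge_prob (G := cart_prod G) p) (fun F => M < #|cluster e F v|%:R).
  rewrite -Ex_sum; apply: eq_Ex => F; rewrite -sum1_card natr_sum big_mkcond.
  by apply: eq_bigr => v _; rewrite inE; case: ifP.
pose bad := [set v : V | d + 2 / 3 * eps * n%:R <= (deg_in setT v)%:R].
have good_tail v : v \notin bad ->
    Pr (edge_prob (G := cart_prod G) p) (fun F => M < #|cluster e F v|%:R) <=
    expR (1 / 3 - eps ^+ 2 * C%:R / (18 * beta ^+ 2) * n%:R) + n%:R / M.
  rewrite inE -ltNge => vd.
  apply: le_trans (@cluster_tail _ e R _ p C.-1 q01 qE _ _ k v (d + 2 / 3 * eps * n%:R) M M0 _) _.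
  - by case/andP: subcritical_p01.
  - move=> x y xy; rewrite !deg_inE.
    have degB i (z : G i) : (deg z <= C.-1.+1)%N by rewrite prednK.
    by apply: (deg_in_lip deg1 degB setT (_ : adj_in setT y x)); rewrite adj_in_sym.
  - by rewrite deg_inE ltW.
  apply: lerD; first exact: saw_product_end.
  rewrite ler_pM2r ?invr_gt0 //; apply: (@le_trans _ _ (\sum_(j < k) (1 : R))).
    by apply: ler_sum => j _; apply: saw_product_le1; apply: ltnW.
  rewrite sumr_const card_ord; have /andP[kb _] := saw_length; apply: le_trans kb _.
  rewrite ler_pdivrMr ?mulr_gt0 //.
  have eb : eps <= 3 * beta by rewrite /beta; lra.
  by rewrite mulrC ler_pM2l.
pose X := expR (1 / 3 - eps ^+ 2 * C%:R / (18 * beta ^+ 2) * n%:R) + n%:R / M.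
have X0 : 0 <= X by rewrite addr_ge0 ?expR_ge0 ?divr_ge0 // ltW.
apply: (@le_trans _ _ (\sum_(v : V) ((v \in bad)%:R + X))).
  apply: ler_sum => v _; case: (boolP (v \in bad)) => [_|/good_tail]; last by rewrite add0r.
  by apply: le_trans (Pr_le1 q01 _) _; rewrite lerDl.
rewrite big_split /= sumr_const -/X -addrA mulrDl; apply: lerD; last first.
  by rewrite [leRHS]mulr_natr le_eqVlt; apply/orP; left; apply/eqP; congr (_ *+ _); apply: eq_card.
have -> : \sum_(v : V) (v \in bad)%:R = #|bad|%:R :> R.
  by rewrite -sum1_card natr_sum [RHS]big_mkcond; apply: eq_bigr => v _; case: (v \in bad).
(* The minimiser of [lam ^ 2 beta ^ 2 n - lam s] at [s = 2 / 3 eps n]. *)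
pose lam : R := eps / (3 * beta ^+ 2).
have lam0 : 0 <= lam by rewrite divr_ge0 ?mulr_ge0 ?sqr_ge0 // ltW.
apply: le_trans (upper_degree_tail G_gt0 deg1 degC _ lam0 _) _.
  have B1 : B <= beta ^+ 2 by rewrite /B /beta; nra.
  rewrite -/B mulrAC ler_pdivrMr ?mulr_gt0 ?exprn_gt0 //; nra.
rewrite mulrC ler_pM2r // ler_expR -/B.
have B2 : B ^+ 2 <= beta ^+ 2 by rewrite /B /beta; nra.
have : lam ^+ 2 * B ^+ 2 * n%:R <= lam ^+ 2 * beta ^+ 2 * n%:R.
  by rewrite ler_pM2r // ler_wpM2l ?sqr_ge0.
have -> : lam ^+ 2 * beta ^+ 2 * n%:R = eps ^+ 2 / (9 * beta ^+ 2) * n%:R.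
  by rewrite /lam; field; rewrite lt0r_neq0.
have -> : lam * (2 / 3 * eps * n%:R) = 2 * (eps ^+ 2 / (9 * beta ^+ 2) * n%:R).
  by rewrite /lam; field; rewrite lt0r_neq0.
lra.
Qed.

End Subcritical.

Section Admissible.
Variables (R : realType) (gamma : R) (C : nat) (G : forall n : nat, 'I_n -> sgraph).
Arguments G : clear implicits.
Hypothesis adm : admissible_factors gamma C G.

Lemma factor_deg_ge1 n i (x : G n i) : (1 <= deg x)%N.
Proof. by have [conn E1 _ _] := adm i; apply: deg_ge1. Qed.

Lemma factor_deg_le n i (x : G n i) : (deg x <= C)%N.
Proof. by have [_ _ dC _] := adm i; apply: leq_trans dC; apply: leq_bigmax. Qed.

Lemma factor_card n (i : 'I_n) : (2 <= #|G n i|)%N.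
Proof.
have [[/card_gt0P[x _] _] _ _ _] := adm i; have /card_gt0P[y] := factor_deg_ge1 x.
rewrite inE => xy; have ne : x != y by apply: contraTneq xy => ->; rewrite adj_irr.
by apply: leq_trans (max_card [set x; y]); rewrite cards2 ne.
Qed.

Lemma factor_iso n (i : 'I_n) (S : {set G n i}) :
  n%:R `^ (- gamma) * #|S|%:R * #|~: S|%:R <= #|G n i|%:R * #|arcs_out (@adj (G n i)) S|%:R.
Proof.
by have [_ _ _ iso] := adm i; apply: iso_const_arcs iso S; rewrite ?powR_ge0 ?factor_card.
Qed.

End Admissible.

Section SubcriticalLimit.
Variables (R : realType) (C : nat) (eps : R).
Hypothesis C1 : (1 <= C)%N.
Hypotheses (eps0 : 0 < eps) (eps1 : eps < 1).

Lemma subcritical_error : exists K : R, forall (n : nat) (v : R), (0 < n)%N -> 2 ^+ n <= v ->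
  let beta : R := C%:R - 1 / 2 in
  let M := expR (- (eps ^+ 2 * n%:R / (9 * C%:R ^+ 2))) * v in
  (expR (- (eps ^+ 2 / (9 * beta ^+ 2) * n%:R)) +
   expR (1 / 3 - eps ^+ 2 * C%:R / (18 * beta ^+ 2) * n%:R) + n%:R / M) * (v / M) <= K / n%:R.
Proof.
have [e0 e1] := (eps0, eps1).
have c1 : 1 <= C%:R :> R by rewrite ler1n.
pose beta : R := C%:R - 1 / 2.
have b0 : 0 < beta by rewrite /beta; lra.
have bC : beta ^+ 2 < C%:R ^+ 2.
  by rewrite /beta; nra.
have [b2 C2 e2] : [/\ 0 < beta ^+ 2, 0 < C%:R ^+ 2 :> R & 0 < eps ^+ 2].
  by split; apply: exprn_gt0 => //; lra.
pose a1 : R := eps ^+ 2 / (9 * beta ^+ 2) - eps ^+ 2 / (9 * C%:R ^+ 2).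
pose a2 : R := eps ^+ 2 * C%:R / (18 * beta ^+ 2) - eps ^+ 2 / (9 * C%:R ^+ 2).
have CR : 0 < C%:R :> R by lra.
have C0 : C%:R != 0 :> R by rewrite lt0r_neq0.
have a10 : 0 < a1.
  have -> : a1 = eps ^+ 2 * (C%:R ^+ 2 - beta ^+ 2) / (9 * beta ^+ 2 * C%:R ^+ 2).
    by rewrite /a1; field; rewrite C0 lt0r_neq0.
  by apply: divr_gt0; [apply: mulr_gt0 => //; rewrite subr_gt0 | do !apply: mulr_gt0 => //].
have a20 : 0 < a2.
  have -> : a2 = eps ^+ 2 * (C%:R ^+ 3 - 2 * beta ^+ 2) / (18 * beta ^+ 2 * C%:R ^+ 2).
    by rewrite /a2; field; rewrite C0 lt0r_neq0.
  have pol : 0 < C%:R ^+ 3 - 2 * beta ^+ 2.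
    have -> : C%:R ^+ 3 - 2 * beta ^+ 2 = C%:R * (C%:R - 1) ^+ 2 + (C%:R - 1 / 2).
      by rewrite /beta; field.
    by rewrite ltr_wpDl // mulr_ge0 ?sqr_ge0.
  by apply: divr_gt0; [apply: mulr_gt0 | do !apply: mulr_gt0 => //].
exists (a1^-1 + expR (1 / 3) / a2 + 2 * (18 / 5) ^+ 2) => n v n0 v2 /=.
rewrite -/beta; set M := expR _ * v; pose E0 := eps ^+ 2 * n%:R / (9 * C%:R ^+ 2).
have nR : 0 < n%:R :> R by rewrite ltr0n.
have v0 : 0 < v by apply: lt_le_trans v2; rewrite exprn_gt0.
have vM : v / M = expR E0.
  by rewrite /M invfM mulrCA divff ?lt0r_neq0 // mulr1 expRN invrK.
have pow1 (a : R) : 0 < a -> expR (- (a * n%:R)) <= a^-1 / n%:R.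
  move=> aa; apply: le_trans (expRN_le_pow 0 (mulr_gt0 aa nR)) _.
  by rewrite expr1 div1r invfM.
rewrite vM mulrDl [X in X + _]mulrDl ![in leRHS]mulrDl; apply: lerD; first apply: lerD.
- rewrite -expRD; apply: le_trans (pow1 _ a10); rewrite ler_expR le_eqVlt.
  by apply/orP; left; apply/eqP; rewrite /a1 /E0; field; rewrite C0 lt0r_neq0.
- rewrite -expRD.
  apply: (@le_trans _ _ (expR (1 / 3) * expR (- (a2 * n%:R)))).
    rewrite -expRD ler_expR le_eqVlt.
    by apply/orP; left; apply/eqP; rewrite /a2 /E0; field; rewrite C0 lt0r_neq0.
  by rewrite -[leRHS]mulrA ler_wpM2l ?expR_ge0 // pow1.
(* The last term equals [n exp (2 E0) / v] with [v >= 2 ^ n >= exp (n / 2)]; the rate 5/18 used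
   below is [1 / 2 - 2 / 9]. *)
have E2 : 2 * E0 <= 2 / 9 * n%:R.
  rewrite /E0 mulrA ler_pdivrMr; last by rewrite mulr_gt0 // exprn_gt0.
  have C21 : 1 <= C%:R ^+ 2 :> R by rewrite exprn_ege1.
  have ee : eps ^+ 2 <= 1 by rewrite exprn_ile1 // ltW.
  have h1 : eps ^+ 2 * n%:R <= n%:R by rewrite ler_piMl // ltW.
  have h2 : n%:R <= n%:R * C%:R ^+ 2 :> R by rewrite ler_peMr // ltW.
  lra.
have Mv : M^-1 = expR E0 / v by rewrite /M invfM expRN invrK.
apply: (@le_trans _ _ (n%:R * expR (- (5 / 18 * n%:R)))).
  rewrite -[leLHS]mulrA ler_wpM2l ?(ltW nR) // Mv mulrAC -expRD ler_pdivrMr //.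
  apply: (@le_trans _ _ (expR (- (5 / 18 * n%:R)) * expR (n%:R / 2))).
    by rewrite -expRD ler_expR; lra.
  by rewrite ler_wpM2l ?expR_ge0 // (le_trans (expR_half_le_pow2 _ _)).
have n5 : 0 < 5 / 18 * n%:R :> R by rewrite mulr_gt0.
apply: le_trans (ler_wpM2l (ltW nR) (expRN_le_pow 1 n5)) _.
rewrite le_eqVlt; apply/orP; left; apply/eqP.
by rewrite (_ : 2`! = 2)%N //; field; rewrite lt0r_neq0.
Qed.

Lemma subcritical_cvg (gamma : R) (G : forall n : nat, 'I_n -> sgraph) :
  admissible_factors gamma C G ->
  ((fun n : nat => perc_prob (cart_prod (G n)) ((1 - eps) / avg_degree (cart_prod (G n)) R)
     (fun H : sgraph => (L1 H)%:R <= expR (- (eps ^+ 2 * n%:R / (9 * C%:R ^+ 2)))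
                                     * #|cart_prod (G n)|%:R)) @ \oo --> (1 : R))%classic.
Proof.
move=> adm; have [K errK] := subcritical_error.
apply: (@cvg_one_of_harmonic_error _ _ K 1%N) => n n0.
have G2 (i : 'I_n) := factor_card adm i.
have deg1 i (x : G n i) := factor_deg_ge1 adm x.
have degC i (x : G n i) := factor_deg_le adm x.
have q01 := edge_prob01 (G := cart_prod (G n)) (subcritical_p01 (eps := eps) G2 deg1 C1 n0 eps0 eps1).
rewrite perc_probE Pr_le1 // andbT.
rewrite lerBlDl -lerBlDr -PrC.
apply: le_trans (errK n #|cart_prod (G n)|%:R n0 _); last first.
  by rewrite -natrX ler_nat; apply: card_product_ge.
apply: le_trans (subcritical_bound G2 deg1 degC C1 n0 eps0 eps1).
by apply: Pr_le => // F; rewrite -ltNge.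
Qed.

End SubcriticalLimit.

(** * The supercritical regime *)

Lemma card_ord_itv (n a b : nat) : (b <= n)%N -> #|[set i : 'I_n | (a <= i < b)%N]| = (b - a)%N.
Proof.
move=> bn; have lt (j : 'I_(b - a)) : (a + j < n)%N by have := ltn_ord j; lia.
pose f j := Ordinal (lt j).
have f_inj : injective f by move=> j j' /(congr1 val) /= /addnI/val_inj.
rewrite -[RHS]card_ord -(card_imset _ f_inj); congr #|pred_of_set _|.
apply/setP => i; rewrite inE; apply/idP/imsetP => [/andP[ai ib]|[j _ ->]].
  have ji : (i - a < b - a)%N by lia.
  by exists (Ordinal ji) => //; apply: val_inj; rewrite /= subnKC.
by have := ltn_ord j; rewrite /=; lia.
Qed.

Lemma union_prob01 (R : realType) (x y : R) : 0 <= x <= 1 -> 0 <= y <= 1 ->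
  0 <= 1 - (1 - x) * (1 - y) <= 1.
Proof. by move=> /andP[x0 x1] /andP[y0 y1]; apply/andP; split; nra. Qed.

Section Supercritical.
Variables (R : realType) (n : nat) (G : 'I_n -> sgraph) (C m K : nat).
Local Notation V := {dffun forall i : 'I_n, G i}.
Implicit Types (u v w x y : V) (F : {set {set V}}).
Hypothesis G2 : forall i, (2 <= #|G i|)%N.
Hypothesis deg1 : forall i (x : G i), (1 <= deg x)%N.
Hypothesis degC : forall i (x : G i), (deg x <= C)%N.
Hypothesis C1 : (1 <= C)%N.
Hypothesis Km : (K.+1 * m <= n)%N.

Definition block k : {set 'I_n} := [set i : 'I_n | (k * m <= i < k.+1 * m)%N].

(** The unreserved coordinates come last; up to stage [K] the block [K] is kept untouched for
    [sparse_vertices]. *)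
Definition stage r : {set 'I_n} := [set i : 'I_n | (i < r * m)%N || (K.+1 * m <= i)%N].

Let h : V -> nat := deg_in (stage 0).

Lemma card_block k : (k <= K)%N -> #|block k| = m.
Proof.
move=> kK; rewrite card_ord_itv ?mulSn ?addnK // -mulSn.
by apply: leq_trans Km; rewrite leq_mul2r ltnS kK orbT.
Qed.

Lemma stage_block_disjoint k : (k <= K)%N -> [disjoint stage k & block k].
Proof.
move=> kK; apply/pred0Pn => -[i /= /andP[]]; rewrite !inE.
have : (k.+1 * m <= K.+1 * m)%N by rewrite leq_mul2r ltnS kK orbT.
by move=> h1 /orP[h2|h2] /andP[h3 h4]; lia.
Qed.

Lemma stageS k : stage k.+1 = stage k :|: block k.
Proof.
apply/setP => i; rewrite !inE mulSn.
by case: (ltnP i (k * m)) => h1 /=; [rewrite (leq_trans h1 (leq_addl _ _))|rewrite orbC].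
Qed.

Lemma sub_stage0 k : stage 0 \subset stage k.
Proof. by apply/subsetP => i; rewrite !inE mul0n ltn0 /= => ->; rewrite orbT. Qed.

Lemma nbrs_block v k : (k <= K)%N -> (m <= #|nbrs (block k) v|)%N.
Proof. by move=> kK; rewrite deg_inE -{1}(card_block kK); apply: deg_in_ge. Qed.

Lemma h_local u v : (forall i, i \in stage 0 -> u i = v i) -> h u = h v.
Proof. by move=> uv; apply: eq_bigr => i /uv ->. Qed.

Variables (q : {set V} -> R) (p : R) (N : nat) (alpha k : R).
Hypothesis q01 : forall E, 0 <= q E <= 1.
Hypothesis qE : forall x y : V, adj_in setT x y -> q [set x; y] = p.
Hypothesis p01 : 0 <= p <= 1.
Hypothesis alpha01 : 0 <= alpha <= 1.
Hypothesis pN : 1 + alpha <= p * N%:R.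

Let a := (C * m)%N.
(** The total deficit never exceeds [2 ^ K * a], the slack having doubled [K] times, so the
    exploration always sees degree at least [N + m]. *)
Let H := (N + m + 2 ^ K * a)%N.
Let c0 : R := alpha / 2.

Lemma growth_base : growth q h H (stage 0) ((2 ^ K - 1) * a) a m%:R c0.
Proof.
move=> v b bK Hv.
have al01 := alpha01; have [al0 al1] := andP al01.
have th01 : 0 <= 1 - alpha / 2 <= 1 by apply/andP; split; lra.
have e_sub x y : adj_in (stage 0) x y -> adj_in setT x y.
  by apply: sub_adj_in; apply: finset.subsetT.
have lip x y : adj_in (stage 0) x y -> (h x <= h y + C)%N.
  have degB i (z : G i) : (deg z <= C.-1.+1)%N by rewrite prednK.
  by move=> xy; apply: leq_trans (deg_in_lip deg1 degB (stage 0) xy) _; rewrite leq_add2l leq_pred.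
have Kge : (0 < 2 ^ K)%N by rewrite expn_gt0.
have HbN : (N + m + a <= H - b)%N.
  rewrite /H; move: bK; rewrite mulnBl mul1n.
  have : (a <= 2 ^ K * a)%N by rewrite leq_pmull.
  by move: (2 ^ K * a)%N => z; lia.
have ldeg u : (H - b <= h u + C * m)%N -> (N + m <= #|[set w | adj_in (stage 0) u w]|)%N.
  by rewrite deg_inE -/h -/a => hu; lia.
have := @exploration_cluster _ (adj_in (stage 0)) (adj_in_irr _) R q p q01
  (fun x y xy => qE (e_sub x y xy)) h C m (H - b)%N N (1 - alpha / 2) lip ldeg p01 th01
  (binomial_survival p01 al01 pN) v.
rewrite leq_subLR addnC => /(_ Hv); have -> : 1 - (1 - alpha / 2) = c0 by rewrite /c0; lra.
move=> /le_trans; apply; apply: Pr_le => // F; rewrite /good ler_nat => /leq_trans; apply.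
apply/subset_leq_card/subsetP => u; rewrite !inE => /andP[-> hu] /=.
by move: hu; rewrite -/a; lia.
Qed.

Lemma growth_weaken A bmax b (s s' c c' : R) : s' <= s -> c' <= c ->
  growth q h H A bmax b s c -> growth q h H A bmax b s' c'.
Proof.
move=> ss cc gr v b' bb hv; apply: le_trans cc (le_trans (gr v b' bb hv) _).
by apply: Pr_le => // F; apply: le_trans.
Qed.

Hypothesis km : 8 <= k * m%:R.
Hypothesis kle : k <= (1 - expR (- (p * m%:R))) * (c0 / 2 ^+ K).

(** [km] bounds the failure of a step by [exp (- 1) <= 1 / 2], so the probability at worst halves,
    and [kle] makes the same [k] valid at every stage. *)
Lemma growth_stage r : (r <= K)%N ->
  growth q h H (stage r) ((2 ^ K - 2 ^ r) * a) (2 ^ r * a)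
    (m%:R * (k * m%:R / 2) ^+ r) (c0 / 2 ^+ r).
Proof.
have [p0 p1] := andP p01; have [al0 al1] := andP alpha01; have k8 := km.
have c00 : 0 <= c0 by rewrite divr_ge0.
elim: r => [_|r IH rK].
  by rewrite !expr0 mulr1 divr1 expn0 mul1n; apply: growth_base.
have {}IH := IH (ltnW rK).
pose s : R := m%:R * (k * m%:R / 2) ^+ r; pose c : R := c0 / 2 ^+ r.
have one : 1 <= (k * m%:R / 2) ^+ r by rewrite exprn_ege1 //; lra.
have sm : m%:R <= s by rewrite /s ler_peMr.
have s0 : 0 <= s by apply: le_trans sm.
have cge : 0 <= c by rewrite divr_ge0 ?exprn_ge0.
have pow2 : (2 ^ r.+1 <= 2 ^ K)%N by rewrite leq_pexp2l.
have bE : ((2 ^ K - 2 ^ r.+1) * a + 2 ^ r * a = (2 ^ K - 2 ^ r) * a)%N.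
  have pow1 : (2 ^ r <= 2 ^ K)%N by rewrite leq_pexp2l // ltnW.
  by rewrite -mulnDl expnS mul2n -addnn subnDA subnK // leq_subRL // addnn -mul2n -expnS.
rewrite -bE in IH.
have step := growth_step q01 qE p01 h_local (sub_stage0 r) (stage_block_disjoint (ltnW rK))
  (ler0n R m) _ s0 cge IH.
have {}step := step (fun v => etrans (ler_nat R _ _) (nbrs_block v (ltnW rK))).
set k' := (1 - expR (- (p * s))) * c in step.
have kk' : k <= k'.
  apply: le_trans kle _; apply: ler_pM.
  - by rewrite subr_ge0 expR_le1 oppr_le0 mulr_ge0.
  - by rewrite divr_ge0 ?exprn_ge0.
  - by rewrite lerD2l lerN2 ler_expR lerN2 ler_wpM2l.
  rewrite ler_wpM2l // lef_pV2 ?posrE ?exprn_gt0 //.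
  by rewrite ler_weXn2l // ?ler1n // ltnW.
have kmm : k * m%:R <= k' * m%:R by rewrite ler_wpM2r.
rewrite stageS; have -> : (2 ^ r.+1 * a = 2 ^ r * a + 2 ^ r * a)%N by rewrite expnS -mulnDl addnn mul2n.
apply: growth_weaken step.
  rewrite exprS mulrCA -/s ler_wpM2r //; lra.
rewrite exprS invfM mulrCA mulrC -/c ler_wpM2l //.
have e1 : expR (- (k' * m%:R / 8)) <= expR (- 1) by rewrite ler_expR; lra.
have : expR (- 1) <= 2^-1 :> R.
  by rewrite expRN lef_pV2 ?posrE ?expR_gt0 //; have := expR_ge1Dx (1 : R); lra.
lra.
Qed.

Let s : R := m%:R * (k * m%:R / 2) ^+ K.
Let cK : R := c0 / 2 ^+ K.

Definition giant_vertices F : {set V} := [set v : V | s <= #|cluster (adj_in setT) F v|%:R].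

Definition sparse_vertices F : {set V} :=
  [set v : V | #|nbrs (block K) v :&: giant_vertices F|%:R <= cK * m%:R / 2].

Lemma Pr_sparse v : (H <= h v)%N ->
  Pr q (fun F => v \in sparse_vertices F) <= expR (- (cK * m%:R / 8)).
Proof.
move=> Hv; have [al0 al1] := andP alpha01.
have cK0 : 0 <= cK by rewrite !divr_ge0 ?exprn_ge0.
have mN : m%:R <= #|nbrs (block K) v|%:R :> R by rewrite ler_nat nbrs_block.
have gr := growth_stage (leqnn K); rewrite subnn mul0n in gr.
have goodK x : (H <= h x + 0)%N -> cK <= Pr q (good h H (stage K) (2 ^ K * a) s x).
  by move=> hx; have := gr x 0%N (leqnn _) hx; rewrite add0n.
have Hv0 : (H <= h v + 0)%N by rewrite addn0.
apply: (@le_trans _ _ (expR (- (cK * #|nbrs (block K) v|%:R / 8)))); last first.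
  by rewrite ler_expR lerN2 ler_pM2r ?invr_gt0 // ler_wpM2l.
apply: le_trans (Pr_good_nbrs q01 h_local (sub_stage0 K) (stage_block_disjoint (leqnn K)) Hv0 cK0 goodK).
apply: Pr_le => // F; rewrite inE => few.
apply: (@le_trans _ _ (cK * m%:R / 2)); last by rewrite ler_pM2r ?invr_gt0 // ler_wpM2l.
apply: le_trans few; rewrite ler_nat; apply/subset_leq_card/subsetP => v'.
rewrite in_set in_setI => /andP[-> gv'] /=; rewrite in_set; apply: (le_trans gv').
rewrite ler_nat; apply/subset_leq_card/subsetP => u; rewrite inE => /andP[+ _].
by rewrite !inE; apply: open_adj_inS; apply: finset.subsetT.
Qed.

Lemma Ex_card_sparse (xi : R) :
  #|[set v : V | (h v < H)%N]|%:R <= #|{: V}|%:R * xi ->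
  Ex q (fun F => #|sparse_vertices F|%:R) <= #|{: V}|%:R * (xi + expR (- (cK * m%:R / 8))).
Proof.
move=> low.
have -> : Ex q (fun F => #|sparse_vertices F|%:R) = \sum_(v : V) Pr q (fun F => v \in sparse_vertices F).
  rewrite -Ex_sum; apply: eq_Ex => F; rewrite -sum1_card natr_sum big_mkcond.
  by apply: eq_bigr => v _; case: (v \in _).
apply: (@le_trans _ _ (\sum_(v : V) ((h v < H)%N%:R + expR (- (cK * m%:R / 8))))).
  apply: ler_sum => v _; case: ltnP => [_|/Pr_sparse]; last by rewrite add0r.
  by apply: le_trans (Pr_le1 q01 _) _; rewrite lerDl expR_ge0.
rewrite big_split /= sumr_const mulrDr; apply: lerD; last first.
  by rewrite [leRHS]mulrC [leRHS]mulr_natr le_eqVlt; apply/orP; left;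
    apply/eqP; congr (_ *+ _); apply: eq_card.
apply: le_trans low; rewrite -sum1_card natr_sum [leRHS]big_mkcond; apply: ler_sum => v _.
by rewrite inE; case: ltnP.
Qed.

(* Double counting of the pairs [v], [u] with [u] a giant neighbour of [v]. *)
Lemma card_giant F : (0 < m)%N -> #|sparse_vertices F|%:R <= #|{: V}|%:R / 2 :> R ->
  #|{: V}|%:R * (cK / (4 * C%:R)) <= #|giant_vertices F|%:R.
Proof.
move=> m0 few; have [al0 al1] := andP alpha01; set U := giant_vertices F.
have cK0 : 0 <= cK by rewrite !divr_ge0 ?exprn_ge0.
have C0 : 0 < C%:R :> R by rewrite ltr0n.
have mR : 0 < m%:R :> R by rewrite ltr0n.
have up : \sum_(v : V) #|nbrs (block K) v :&: U|%:R <= #|U|%:R * (m%:R * C%:R) :> R.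
  have -> : \sum_(v : V) #|nbrs (block K) v :&: U|%:R = \sum_(u in U) #|nbrs (block K) u|%:R :> R.
    transitivity (\sum_(v : V) \sum_(u in U) (adj_in (block K) v u)%:R : R).
      apply: eq_bigr => v _; rewrite -sum1_card natr_sum big_mkcond [RHS]big_mkcond.
      by apply: eq_bigr => u _; rewrite !inE; case: (adj_in _ _ _); case: (_ <= _).
    rewrite exchange_big /=; apply: eq_bigr => u _; rewrite -sum1_card natr_sum [RHS]big_mkcond.
    by apply: eq_bigr => v _; rewrite inE adj_in_sym; case: (adj_in _ _ _).
  rewrite mulr_natl -sumr_const; apply: ler_sum => u _.
  have degB i (z : G i) : (deg z <= C.-1.+1)%N by rewrite prednK.
  rewrite -natrM ler_nat deg_inE -(card_block (leqnn K)).
  by apply: leq_trans (deg_in_le degB _ _) _; rewrite prednK.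
have lo : #|~: sparse_vertices F|%:R * (cK * m%:R / 2) <= \sum_(v : V) #|nbrs (block K) v :&: U|%:R.
  rewrite mulr_natl -sumr_const big_mkcond; apply: ler_sum => v _.
  by case: ifP => // ; rewrite in_setC in_set -ltNge => /ltW.
have cV : #|{: V}|%:R = #|sparse_vertices F|%:R + #|~: sparse_vertices F|%:R :> R.
  by rewrite -natrD cardsC.
have half : #|{: V}|%:R / 2 <= #|~: sparse_vertices F|%:R :> R by lra.
have h1 : #|{: V}|%:R / 2 * (cK * m%:R / 2) <= #|U|%:R * (m%:R * C%:R).
  apply: le_trans up; apply: le_trans lo; rewrite ler_wpM2r // divr_ge0 // mulr_ge0 //.
rewrite mulrA ler_pdivrMr ?mulr_gt0 //.
have -> : #|U|%:R * (4 * C%:R) = #|U|%:R * (m%:R * C%:R) * (4 / m%:R) :> R by field; rewrite lt0r_neq0.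
have -> : #|{: V}|%:R * cK = #|{: V}|%:R / 2 * (cK * m%:R / 2) * (4 / m%:R) :> R by field; rewrite lt0r_neq0.
by rewrite ler_wpM2r // divr_ge0.
Qed.

Lemma isolated_sparse F :
  [set y : V | (y \notin giant_vertices F) && ~~ [exists u in giant_vertices F, adj_in setT y u]]
  \subset sparse_vertices F.
Proof.
have [al0 al1] := andP alpha01.
apply/subsetP => y; rewrite in_set => /andP[_ /exists_inPn iso]; rewrite in_set.
rewrite (_ : _ :&: _ = set0) ?cards0 ?divr_ge0 ?mulr_ge0 ?invr_ge0 ?exprn_ge0 ?divr_ge0 //.
apply/setP => u; rewrite in_setI in_set0 in_set; apply/negP => /andP[yu uU].
by have := iso u uU; rewrite (sub_adj_in (finset.subsetT (block K)) yu).
Qed.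

(** [c1] is a third of the density [cK / (4 C)] of giant vertices, as [merging] needs [3 t <= #|U|].
    A proportion [tau] of sparse vertices is tolerated: at most half for [card_giant], and small
    enough that isolated vertices do not destroy the links. *)
Lemma sprinkling_bound (q2 : {set V} -> R) (p2 iota xi tau : R) :
  (0 < m)%N -> 0 < alpha ->
  (forall E, 0 <= q2 E <= 1) -> (forall x y : V, adj_in setT x y -> q2 [set x; y] = p2) ->
  0 <= p2 <= 1 -> 0 <= iota ->
  (forall i (S : {set G i}),
    iota * #|S|%:R * #|~: S|%:R <= #|G i|%:R * #|arcs_out (@adj (G i)) S|%:R) ->
  #|[set v : V | (h v < H)%N]|%:R <= #|{: V}|%:R * xi ->
  0 < tau -> tau <= 1 / 2 ->
  let c1 : R := cK / (12 * C%:R) in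
  tau * (n * C)%:R <= iota * c1 ^+ 2 / 2 ->
  1 - ((xi + expR (- (cK * m%:R / 8))) / tau +
       expR (#|{: V}|%:R * (s^-1 - p2 ^+ 3 * iota * c1 ^+ 2 / (16 * (n * C)%:R)))) <=
  Pr (fun E => 1 - (1 - q E) * (1 - q2 E))
     (fun F => [exists v : V, c1 * #|{: V}|%:R <= #|cluster (adj_in setT) F v|%:R]).
Proof.
move=> m0 al0 q201 q2E p201 iota0 isoG low tau0 tau2 c1 tauC.
have G_gt0 i : (0 < #|G i|)%N by apply: leq_trans (G2 i).
have V0 : 0 < #|{: V}|%:R :> R by rewrite ltr0n; apply: card_product_gt0.
have C0 : 0 < C%:R :> R by rewrite ltr0n.
have mR : 0 < m%:R :> R by rewrite ltr0n.
have cK0 : 0 < cK by rewrite !divr_gt0 ?exprn_gt0.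
have c10 : 0 < c1 by rewrite divr_gt0 // mulr_gt0.
have s0 : 0 < s.
  by rewrite mulr_gt0 // exprn_gt0 //; have := km; lra.
have q12 E : 0 <= 1 - (1 - q E) * (1 - q2 E) <= 1.
  exact: union_prob01.
rewrite lerBlDr -lerBlDl -(PrC (fun E => 1 - (1 - q E) * (1 - q2 E))).
rewrite /Pr -Ex_union.
set e2 := expR (_ * _).
pose dense F := #|sparse_vertices F|%:R <= tau * #|{: V}|%:R.
apply: (@le_trans _ _ (Ex q (fun F1 => (~~ dense F1)%:R + e2))); last first.
  rewrite ExD Ex_cst lerD2r.
  apply: (@le_trans _ _ (Ex q (fun F => #|sparse_vertices F|%:R) / (tau * #|{: V}|%:R))).
    apply: markov_Pr => //; first by rewrite mulr_gt0.
    by move=> F; rewrite -ltNge => /ltW.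
  rewrite invfM mulrA mulrAC ler_pM2r ?invr_gt0 // ler_pdivrMr // mulrC.
  exact: Ex_card_sparse.
apply: Ex_le => // F1; case: (boolP (dense F1)) => [dF|_]; last first.
  apply: (@le_trans _ _ 1); last by rewrite lerDl expR_ge0.
  rewrite -[leRHS](Ex_cst q2); apply: Ex_le => // F2; by case: (~~ _).
rewrite add0r.
have t0 : 0 < c1 * #|{: V}|%:R by rewrite mulr_gt0.
have degD (v : V) : (#|[set w | adj_in setT v w]| <= n * C)%N.
  have degB i (z : G i) : (deg z <= C.-1.+1)%N by rewrite prednK.
  by rewrite deg_inE; apply: leq_trans (deg_in_le degB _ _) _; rewrite cardsT card_ord prednK.
have giant : 3 * (c1 * #|{: V}|%:R) <= #|giant_vertices F1|%:R.
  apply: le_trans (card_giant m0 _); last first.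
    apply: (le_trans dF); rewrite mulrC ler_wpM2l //; lra.
  rewrite le_eqVlt; apply/orP; left; apply/eqP; rewrite /c1; field; exact: lt0r_neq0.
have XV : #|[set y : V | (y \notin giant_vertices F1) &&
      ~~ [exists u in giant_vertices F1, adj_in setT y u]]|%:R
    * (n * C)%:R * #|{: V}|%:R <= iota * (c1 * #|{: V}|%:R) ^+ 2 / 2.
  apply: (@le_trans _ _ ((tau * #|{: V}|%:R) * (n * C)%:R * #|{: V}|%:R)).
    rewrite ler_pM2r // ler_wpM2r //; apply: le_trans dF; rewrite ler_nat.
    exact/subset_leq_card/isolated_sparse.
  have -> : tau * #|{: V}|%:R * (n * C)%:R * #|{: V}|%:R = #|{: V}|%:R ^+ 2 * (tau * (n * C)%:R) by ring.
  have -> : iota * (c1 * #|{: V}|%:R) ^+ 2 / 2 = #|{: V}|%:R ^+ 2 * (iota * c1 ^+ 2 / 2) by ring.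
  by rewrite ler_wpM2l // sqr_ge0.
apply: le_trans (merging (adj_in_sym _) degD q201 q2E p201 iota0
  (iso_product iota0 G_gt0 isoG) s0 t0 giant XV) _.
rewrite ler_expR le_eqVlt; apply/orP; left; apply/eqP.
have [n0|n0] := posnP (n * C)%N.
  by rewrite n0 !mulr0 invr0 !mulr0 !subr0.
have {n0} w0 : (0 : R) < (n * C)%:R by rewrite ltr0n.
move: ((n * C)%:R : R) w0 => w w0; move: (#|{: V}|%:R : R) V0 => z z0.
by field; rewrite !lt0r_neq0.
Qed.

End Supercritical.

(** * Choice of constants and the supercritical limit *)

Section SupercriticalLimit.
Variables (R : realType) (C g : nat) (eps : R).
Hypothesis C1 : (1 <= C)%N.
Hypotheses (eps0 : 0 < eps) (eps1 : eps < 1).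

(** Not merging costs an exponent of order [#|V| / n ^ (g + 4)]: three sprinkled edges give
    [n ^ -3], isoperimetry gives [n ^ -g], and making links disjoint loses one more [n]. The number
    of clusters is of order [#|V| / n ^ K.+1], smaller by a factor of order [n]. *)
Let K : nat := (g + 4)%N.
(** [W * m] is the whole degree budget: the reserved coordinates, the [m] neighbours lost in
    exploration, and the slack [2 ^ K * (C * m)]. The choice of [delta] keeps it below
    [eps n / 32]. *)
Let W : R := (C * K.+1 + 1 + 2 ^ K * C)%:R.
Let delta : R := eps / (32 * W).
Let cK : R := eps / 8 / 2 / 2 ^+ K.
Let k : R := (1 - expR (- (delta / (2 * C%:R)))) * cK.

Definition giant_density : R := cK / (12 * C%:R).

Let c1 := giant_density.
Let kappa : R := eps ^+ 3 * c1 ^+ 2 / (128 * C%:R ^+ 4).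
Let cs : R := delta / 2 * (k * delta / 4) ^+ K.

Let CR : 0 < C%:R :> R. Proof. by rewrite ltr0n. Qed.

Let W_ge1 : 1 <= W. Proof. by rewrite /W ler1n addn1 addSn. Qed.

Let delta_gt0 : 0 < delta.
Proof. by rewrite divr_gt0 // mulr_gt0 // (lt_le_trans ltr01 W_ge1). Qed.

Let cK_gt0 : 0 < cK. Proof. by do !apply: divr_gt0 => //; apply: exprn_gt0. Qed.

Let k_gt0 : 0 < k.
Proof.
apply: mulr_gt0 => //; rewrite subr_gt0 expR_lt1 oppr_lt0.
by apply: divr_gt0 => //; apply: mulr_gt0.
Qed.

Lemma giant_density_gt0 : 0 < giant_density.
Proof. by rewrite divr_gt0 // mulr_gt0. Qed.

Let kappa_gt0 : 0 < kappa.
Proof.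
have c10 := giant_density_gt0.
by apply: divr_gt0; apply: mulr_gt0 => //; apply: exprn_gt0.
Qed.

Let cs_gt0 : 0 < cs.
Proof.
apply: mulr_gt0; first exact: divr_gt0.
by apply: exprn_gt0; apply: divr_gt0 => //; apply: mulr_gt0.
Qed.

Section LargeDimension.
Variables (n : nat) (G : 'I_n -> sgraph).
Local Notation V := {dffun forall i : 'I_n, G i}.
Hypothesis G2 : forall i, (2 <= #|G i|)%N.
Hypothesis deg1 : forall i (x : G i), (1 <= deg x)%N.
Hypothesis degC : forall i (x : G i), (deg x <= C)%N.
Hypothesis n2 : 2 <= n%:R :> R.
Hypothesis n_eps : 32 / eps <= n%:R.
Hypothesis n_delta : 2 / delta <= n%:R.
Hypothesis n_k : 16 / (k * delta) <= n%:R.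
Hypothesis n_cs : 2 / (cs * kappa) <= n%:R.

Let d : R := avg_degree (cart_prod G) R.
Let m : nat := Num.truncn (delta * n%:R).
(** The mean degree in the unreserved coordinates is at least [x + eps n / 16]. [N] is chosen so
    that the degree threshold for roots is exactly the integer part of [x]; by [trunc_x] its
    subtractions are not truncated. *)
Let x : R := d - (C * K.+1 * m)%:R - eps / 16 * n%:R.
Let N : nat := (Num.truncn x - m - 2 ^ K * (C * m))%N.

Let nR : 0 < n%:R :> R. Proof. exact: lt_le_trans n2. Qed.
Let G_gt0 i : (0 < #|G i|)%N. Proof. exact: leq_trans (G2 i). Qed.
Let dn : n%:R <= d. Proof. exact: avg_product_ge. Qed.

Lemma m_bounds : delta * n%:R / 2 <= m%:R <= delta * n%:R.
Proof.
have /andP[lo hi] : m%:R <= delta * n%:R < m.+1%:R.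
  by apply: truncn_itv; rewrite mulr_ge0 // ltW.
have dn2 : 2 <= delta * n%:R by rewrite mulrC -ler_pdivrMr.
by rewrite lo andbT; move: hi; rewrite -natr1; lra.
Qed.

Lemma m_le_n : (K.+1 * m <= n)%N.
Proof.
have /andP[_ hi] := m_bounds; rewrite -(ler_nat R) natrM.
have W0 := W_ge1; have e1 := eps1; have e0 := eps0.
have KW : K.+1%:R <= W.
  by rewrite /W ler_nat -addnA; apply: leq_trans (leq_addr _ _); rewrite leq_pmull.
apply: (@le_trans _ _ (W * (delta * n%:R))); first by rewrite ler_pM.
have -> : W * (delta * n%:R) = eps / 32 * n%:R.
  by rewrite /delta; field; rewrite lt0r_neq0 //; apply: lt_le_trans W0.
have := nR; nra.
Qed.

Lemma x_lower : (m + 2 ^ K * (C * m))%:R + 1 + (1 - eps / 8) * d <= x.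
Proof.
have /andP[_ hi] := m_bounds; have e1 := eps1; have e0 := eps0; have nd := dn.
have Wm : W * m%:R <= eps / 32 * n%:R.
  have W0 := W_ge1.
  apply: (@le_trans _ _ (W * (delta * n%:R))); first by rewrite ler_wpM2l //; lra.
  rewrite le_eqVlt; apply/orP; left; apply/eqP.
  by rewrite /delta; field; rewrite lt0r_neq0 //; apply: lt_le_trans W0.
have n1 : 1 <= eps / 32 * n%:R.
  by have := n_eps; rewrite ler_pdivrMr // => h; lra.
have WE : W * m%:R = (C * K.+1 * m)%:R + (m + 2 ^ K * (C * m))%:R.
  by rewrite /W -natrM -natrD; congr (_%:R); rewrite !mulnDl mul1n mulnA addnA.
have ed : eps * n%:R <= eps * d by rewrite ler_wpM2l // ltW.
by rewrite /x; lra.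
Qed.

Lemma trunc_x : (N + m + 2 ^ K * (C * m))%N = Num.truncn x /\
  (Num.truncn x)%:R <= x /\ (1 - eps / 8) * d <= N%:R.
Proof.
have xl := x_lower; have e1 := eps1; have e0 := eps0; have nd := dn; have n0 := nR.
have d0 : 0 <= (1 - eps / 8) * d by rewrite mulr_ge0 //; lra.
have x0 : 0 <= x.
  have := ler0n R (m + 2 ^ K * (C * m)); lra.
have /andP[lo] : (Num.truncn x)%:R <= x < (Num.truncn x).+1%:R by apply: truncn_itv.
rewrite -natr1 => hi.
have le : (m + 2 ^ K * (C * m) <= Num.truncn x)%N.
  by rewrite -(ler_nat R); lra.
have E : (N + m + 2 ^ K * (C * m))%N = Num.truncn x.
  by rewrite /N -subnDA -addnA subnK.
split=> //; split=> //.
have : (Num.truncn x)%:R = N%:R + (m + 2 ^ K * (C * m))%:R :> R by rewrite -E -addnA natrD.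
lra.
Qed.

Lemma low_degree_count :
  #|[set v : V | (deg_in (stage n m K 0) v < N + m + 2 ^ K * (C * m))%N]|%:R <=
  #|{: V}|%:R * expR (- ((eps / 16) ^+ 2 / (4 * C%:R ^+ 2) * n%:R)).
Proof.
have e1 := eps1; have e0 := eps0; have c0 := CR; have c1' : 1 <= C%:R :> R by rewrite ler1n.
have [-> [xlo _]] := trunc_x.
(* The minimiser of [lam ^ 2 C ^ 2 n - lam s] at [s = eps n / 16]. *)
pose lam : R := eps / 16 / (2 * C%:R ^+ 2).
have lam0 : 0 <= lam by rewrite !divr_ge0 ?mulr_ge0 ?exprn_ge0 // ltW.
have lamC : lam * C%:R <= 1 / 3.
  have -> : lam * C%:R = eps / (32 * C%:R) by rewrite /lam; field; rewrite lt0r_neq0.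
  rewrite ler_pdivrMr ?mulr_gt0 //; lra.
have := lower_degree_tail G_gt0 deg1 degC (stage n m K 0) (eps / 16 * n%:R) lam0 lamC.
have -> : lam ^+ 2 * C%:R ^+ 2 * n%:R - lam * (eps / 16 * n%:R) =
    - ((eps / 16) ^+ 2 / (4 * C%:R ^+ 2) * n%:R).
  by rewrite /lam; field; rewrite lt0r_neq0.
apply: le_trans; rewrite ler_nat; apply/subset_leq_card/subsetP => v; rewrite !inE => hv.
have hx : (deg_in (stage n m K 0) v)%:R <= x.
  by apply: le_trans xlo; rewrite ler_nat ltnW.
apply: (@le_trans _ _ (d - (C * K.+1 * m)%:R)); first by move: hx; rewrite /x; lra.
rewrite lerBlDr /d (avg_degree_product _ G_gt0) (bigID (mem (stage n m K 0))) /= lerD2l.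
apply: (@le_trans _ _ (\sum_(i < n | i \notin stage n m K 0) C%:R)).
  by apply: ler_sum => i _; apply: (avg_le _ G_gt0).
rewrite sumr_const -[leLHS]mulr_natr -natrM ler_nat -mulnA leq_mul2l; apply/orP; right.
rewrite -[leqRHS]subn0 -(card_ord_itv 0 m_le_n); apply/subset_leq_card/subsetP => i.
by move=> iS; rewrite inE /=; move: iS; rewrite unfold_in /= inE mul0n ltn0 /= -ltnNge.
Qed.

Let p : R := (1 + eps) / d.
Let p2 : R := eps / (2 * d).
Let p1 : R := (p - p2) / (1 - p2).

Lemma sprinkling_params :
  [/\ 0 <= p1 <= 1, 0 <= p2 <= 1, 1 - p = (1 - p1) * (1 - p2),
      (1 + eps / 2) / d <= p1 & 0 <= p <= 1].
Proof.
have e1 := eps1; have e0 := eps0; have nd := dn; have nn := n2.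
have d0 : 0 < d by lra.
have p20 : 0 < p2 by rewrite divr_gt0 // mulr_gt0.
have d2 : eps < 1 * (2 * d) by lra.
have d1 : 1 + eps <= 1 * d by lra.
have s1 : 0 <= 1 + eps by lra.
have s2 : 0 <= 1 + eps / 2 by lra.
have p2lt : p2 < 1 by rewrite /p2 ltr_pdivrMr // mulr_gt0.
have ple : p <= 1 by rewrite /p ler_pdivrMr.
have pge : 0 <= p by rewrite /p divr_ge0 ?(ltW d0).
have diff : p - p2 = (1 + eps / 2) / d by rewrite /p /p2; field; rewrite lt0r_neq0.
have diff0 : 0 <= p - p2 by rewrite diff divr_ge0 ?(ltW d0).
have q0 : 0 < 1 - p2 by rewrite subr_gt0.
split.
- by rewrite /p1 divr_ge0 ?(ltW q0) //= ler_pdivrMr // mul1r lerD2r.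
- by rewrite !ltW.
- by rewrite /p1; field; rewrite lt0r_neq0.
- by rewrite -diff /p1 ler_pdivlMr // ler_piMr // gerBl ltW.
by rewrite pge ple.
Qed.

(** Dividing by [tau] costs [n ^ g.+1], so the exponentials are compared with [n ^ g.+2]. *)
Lemma sparse_error (xi tau : R) :
  xi = expR (- ((eps / 16) ^+ 2 / (4 * C%:R ^+ 2) * n%:R)) ->
  tau = c1 ^+ 2 / (2 * C%:R * n%:R ^+ g.+1) ->
  (xi + expR (- (cK * m%:R / 8))) / tau <=
  (g.+2`!%:R / ((eps / 16) ^+ 2 / (4 * C%:R ^+ 2)) ^+ g.+2 +
   g.+2`!%:R / (cK * delta / 16) ^+ g.+2) * (2 * C%:R / c1 ^+ 2) / n%:R.
Proof.
move=> -> ->; have c10 := giant_density_gt0.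
have pow (b : R) : 0 < b -> expR (- (b * n%:R)) <= g.+2`!%:R / b ^+ g.+2 / n%:R ^+ g.+2.
  move=> b0; apply: le_trans (expRN_le_pow g.+1 (mulr_gt0 b0 nR)) _.
  by rewrite exprMn invfM mulrA.
have n0 := nR; have n00 : n%:R != 0 :> R by rewrite lt0r_neq0.
have c00 : c1 != 0 by rewrite lt0r_neq0.
have C00 : C%:R != 0 :> R by rewrite lt0r_neq0.
have -> : (c1 ^+ 2 / (2 * C%:R * n%:R ^+ g.+1))^-1 = 2 * C%:R / c1 ^+ 2 * n%:R ^+ g.+1.
  by rewrite invf_div mulrAC.
set F := g.+2`!%:R; set b1 := (eps / 16) ^+ 2 / _; set b2 := cK * delta / 16.
have b10 : 0 < b1 by rewrite divr_gt0 ?exprn_gt0 ?divr_gt0 // mulr_gt0 // exprn_gt0.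
have b20 : 0 < b2 by rewrite divr_gt0 // mulr_gt0.
have bound : expR (- (b1 * n%:R)) + expR (- (cK * m%:R / 8)) <=
    (F / b1 ^+ g.+2 + F / b2 ^+ g.+2) / n%:R ^+ g.+2.
  rewrite mulrDl; apply: lerD; first exact: pow.
  apply: le_trans (pow _ b20); rewrite ler_expR lerN2 /b2.
  have /andP[lo _] := m_bounds.
  have := ler_wpM2l (ltW cK_gt0) lo; lra.
have c2 : 0 <= 2 * C%:R / c1 ^+ 2 * n%:R ^+ g.+1.
  by rewrite mulr_ge0 ?exprn_ge0 ?divr_ge0 ?sqr_ge0 ?mulr_ge0 ?ltW.
apply: le_trans (ler_wpM2r c2 bound) _; rewrite le_eqVlt; apply/orP; left; apply/eqP.
move: (F / _ + F / _) (2 * C%:R / c1 ^+ 2) => S T; rewrite (exprS _ g.+1).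
by field; rewrite n00 expf_neq0.
Qed.

(** Counting splits uses at most half of [kappa / n ^ K]. What is left is at most
    [2 n ^ K / (kappa v)], and the exponential size of [v] absorbs [n ^ K.+1]. *)
Lemma merging_error (v : R) : 2 ^+ n <= v ->
  expR (v * ((m%:R * (k * m%:R / 2) ^+ K)^-1 -
     p2 ^+ 3 * (n%:R ^+ g)^-1 * c1 ^+ 2 / (16 * (n * C)%:R))) <=
  2 * (g.+4.+1)`!%:R * 2 ^+ g.+4.+1 / kappa / n%:R.
Proof.
move=> v2; have c10 := giant_density_gt0; have n0 := nR; have c0 := CR.
have n00 : n%:R != 0 :> R by rewrite lt0r_neq0.
have v0 : 0 < v by apply: lt_le_trans v2; rewrite exprn_gt0.
have /andP[mlo _] := m_bounds; have dl := delta_gt0; have kk := k_gt0; have csg := cs_gt0.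
have kg := kappa_gt0.
have d0 : 0 < d by apply: lt_le_trans dn.
have sge : cs * n%:R ^+ K.+1 <= m%:R * (k * m%:R / 2) ^+ K.
  have -> : cs * n%:R ^+ K.+1 = (delta * n%:R / 2) * (k * (delta * n%:R / 2) / 2) ^+ K.
    have -> : k * (delta * n%:R / 2) / 2 = (k * delta / 4) * n%:R by field.
    rewrite /cs exprS; move: (k * delta / 4) => z; rewrite exprMn.
    by move: (z ^+ K) (n%:R ^+ K) => z' y; ring.
  have dn0 : 0 <= delta * n%:R / 2 by apply: divr_ge0 => //; apply/ltW/mulr_gt0.
  apply: ler_pM => //; first by apply/exprn_ge0/divr_ge0 => //; apply: mulr_ge0 => //; apply: ltW.
  have km0 y : 0 <= y -> 0 <= k * y / 2.
    by move=> y0; apply: divr_ge0 => //; apply: mulr_ge0 => //; apply: ltW.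
  apply: lerXn2r; rewrite ?nnegrE ?km0 //.
  by rewrite ler_pM2r ?invr_gt0 // ler_wpM2l // ltW.
have csn : 0 < cs * n%:R ^+ K.+1 by apply: mulr_gt0 => //; apply: exprn_gt0.
have h1 : (m%:R * (k * m%:R / 2) ^+ K)^-1 <= kappa / (2 * n%:R ^+ K).
  apply: (@le_trans _ _ (cs * n%:R ^+ K.+1)^-1).
    by rewrite lef_pV2 ?posrE // (lt_le_trans csn).
  have nK1 : 0 < n%:R ^+ K :> R by apply: exprn_gt0.
  have nK := ltW nK1.
  have rhs0 : 0 < 2 * n%:R ^+ K / kappa by apply: divr_gt0 => //; apply: mulr_gt0.
  have csk : 0 < cs * kappa by apply: mulr_gt0.
  rewrite -[leRHS]invf_div lef_pV2 ?posrE //.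
  have := n_cs; rewrite ler_pdivrMr // => h.
  rewrite ler_pdivrMr // exprS.
  have -> : cs * (n%:R * n%:R ^+ K) * kappa = n%:R ^+ K * (n%:R * (cs * kappa)) by ring.
  by rewrite mulrC ler_wpM2l.
have h2 : kappa / n%:R ^+ K <= p2 ^+ 3 * (n%:R ^+ g)^-1 * c1 ^+ 2 / (16 * (n * C)%:R).
  have p2ge : eps / (2 * (n%:R * C%:R)) <= p2.
    have nC0 : 0 < n%:R * C%:R :> R by apply: mulr_gt0.
    have dd0 : 0 < 2 * d by apply: mulr_gt0.
    have nn0 : 0 < 2 * (n%:R * C%:R) :> R by apply: mulr_gt0.
    rewrite /p2 ler_pM2l // lef_pV2 ?posrE // ler_pM2l //.
    exact: (avg_product_le _ G_gt0).
  have -> : kappa / n%:R ^+ K =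
      (eps / (2 * (n%:R * C%:R))) ^+ 3 * (n%:R ^+ g)^-1 * c1 ^+ 2 / (16 * (n * C)%:R).
    rewrite /kappa /K exprD natrM; field.
    by rewrite expf_neq0 // n00 lt0r_neq0.
  have low0 : 0 <= eps / (2 * (n%:R * C%:R)).
    by apply/ltW/divr_gt0 => //; apply: mulr_gt0 => //; apply: mulr_gt0.
  apply: ler_wpM2r; first by rewrite invr_ge0 mulr_ge0.
  apply: ler_wpM2r; first exact: sqr_ge0.
  apply: ler_wpM2r; first by rewrite invr_ge0 exprn_ge0.
  by apply: lerXn2r => //; rewrite nnegrE; apply: le_trans p2ge.
apply: (@le_trans _ _ (expR (- (v * (kappa / (2 * n%:R ^+ K)))))).
  rewrite ler_expR -[leRHS]mulrN ler_wpM2l ?(ltW v0) //.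
  have -> : - (kappa / (2 * n%:R ^+ K)) = kappa / (2 * n%:R ^+ K) - kappa / n%:R ^+ K.
    by field; rewrite expf_neq0.
  exact: lerB.
have nK : 0 < n%:R ^+ K :> R by rewrite exprn_gt0.
have arg0 : 0 < v * (kappa / (2 * n%:R ^+ K)).
  by apply: mulr_gt0 => //; apply: divr_gt0 => //; apply: mulr_gt0.
apply: le_trans (expRN_le_pow 0 arg0) _; rewrite expr1.
have vinv : v^-1 <= (g.+4.+1)`!%:R / (n%:R / 2) ^+ g.+4.+1.
  apply: (@le_trans _ _ (expR (- (n%:R / 2)))).
    rewrite expRN lef_pV2 ?posrE ?expR_gt0 //; apply: le_trans v2; exact: expR_half_le_pow2.
  by apply: expRN_le_pow; rewrite divr_gt0.
have -> : 1`!%:R / (v * (kappa / (2 * n%:R ^+ K))) = v^-1 * (2 * n%:R ^+ K / kappa) :> R.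
  by rewrite (_ : 1`! = 1)%N // div1r invfM invf_div.
apply: le_trans (ler_wpM2r _ vinv) _; first by apply: divr_ge0; [apply/ltW/mulr_gt0|apply: ltW].
rewrite le_eqVlt; apply/orP; left; apply/eqP.
rewrite /K addn4 exprMn exprVn (exprS n%:R g.+4); field.
by rewrite !lt0r_neq0 // exprn_gt0.
Qed.

Definition supercritical_error : R :=
  (g.+2`!%:R / ((eps / 16) ^+ 2 / (4 * C%:R ^+ 2)) ^+ g.+2 +
   g.+2`!%:R / (cK * delta / 16) ^+ g.+2) * (2 * C%:R / c1 ^+ 2) +
  2 * (g.+4.+1)`!%:R * 2 ^+ g.+4.+1 / kappa.

Hypothesis isoG : forall i (S : {set G i}),
  (n%:R ^+ g)^-1 * #|S|%:R * #|~: S|%:R <= #|G i|%:R * #|arcs_out (@adj (G i)) S|%:R :> R.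

Lemma supercritical_perc :
  1 - supercritical_error / n%:R <=
  perc_prob (cart_prod G) p (fun H : sgraph => c1 * #|cart_prod G|%:R <= (L1 H)%:R).
Proof.
have e1 := eps1; have e0 := eps0; have kk := k_gt0; have dl := delta_gt0; have n0 := nR.
have /andP[mlo _] := m_bounds.
have km : 8 <= k * m%:R.
  have kd : 0 < k * delta by apply: mulr_gt0.
  have := n_k; rewrite ler_pdivrMr // => h.
  have := ler_wpM2l (ltW kk) mlo; lra.
(* The mean offspring is [p1 * N] with [p1 >= (1 + eps / 2) / d] and [N >= (1 - eps / 8) d]; hence
   the excess [eps / 8] inside [cK]. *)
have f1 : 1 + eps / 8 <= (1 + eps / 2) * (1 - eps / 8) by nra.
have f2 : 1 <= 1 + eps / 2 by lra.
have f3 : 0 <= 1 - eps / 8 by lra.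
have f4 : eps / 8 / 2 <= 1 by lra.
have al01 : 0 <= eps / 8 <= 1 by apply/andP; split; lra.
have al0 : 0 < eps / 8 by lra.
have C1R : 1 <= C%:R :> R by rewrite ler1n.
have C12 : 1 <= 12 * C%:R :> R by lra.
have [p101 p201 pE p1ge pp01] := sprinkling_params.
have /andP[p10 _] := p101.
have nd := dn; have c10 := giant_density_gt0; have cKg := cK_gt0; have c0 := CR.
have d0 : 0 < d by apply: lt_le_trans dn.
have mpos : (0 < m)%N.
  by rewrite -(ltr0n R); apply: lt_le_trans mlo; apply: divr_gt0 => //; apply: mulr_gt0.
have [NE [_ Nge]] := trunc_x.
have pN : 1 + eps / 8 <= p1 * N%:R.
  apply: (@le_trans _ _ ((1 + eps / 2) / d * ((1 - eps / 8) * d))).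
    have -> : (1 + eps / 2) / d * ((1 - eps / 8) * d) = (1 + eps / 2) * (1 - eps / 8).
      by field; rewrite lt0r_neq0.
    exact: f1.
  apply: ler_pM => //; first by apply: divr_ge0; [apply: le_trans f2|apply: ltW].
  by apply: mulr_ge0 => //; apply: ltW.
have kle : k <= (1 - expR (- (p1 * m%:R))) * (eps / 8 / 2 / 2 ^+ K).
  apply: ler_wpM2r; first exact: ltW.
  rewrite lerD2l lerN2 ler_expR lerN2.
  have -> : delta / (2 * C%:R) = (n%:R * C%:R)^-1 * (delta * n%:R / 2).
    by field; rewrite !lt0r_neq0.
  have nC0 : 0 < n%:R * C%:R :> R by apply: mulr_gt0.
  have i1 : 0 <= (n%:R * C%:R)^-1 :> R by rewrite invr_ge0 ltW.
  have i2 : 0 <= delta * n%:R / 2 by apply: divr_ge0 => //; apply/ltW/mulr_gt0.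
  apply: (ler_pM i1 i2 _ mlo); apply: (@le_trans _ _ d^-1).
    by rewrite lef_pV2 ?posrE //; apply: (avg_product_le _ G_gt0).
  by apply: le_trans p1ge; rewrite ler_peMl ?invr_ge0 ?(ltW d0).
have q1E (u v : V) : adj_in setT u v -> edge_prob (G := cart_prod G) p1 [set u; v] = p1.
  by move=> uv; apply: edge_probE; rewrite /= -adj_in_setT.
have q2E (u v : V) : adj_in setT u v -> edge_prob (G := cart_prod G) p2 [set u; v] = p2.
  by move=> uv; apply: edge_probE; rewrite /= -adj_in_setT.
have iota0 : 0 <= (n%:R ^+ g)^-1 :> R by rewrite invr_ge0 exprn_ge0.
(* The largest value allowed by [tauC], which becomes an equality. *)
pose tau : R := c1 ^+ 2 / (2 * C%:R * n%:R ^+ g.+1).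
have tau_den : 0 < 2 * C%:R * n%:R ^+ g.+1 :> R by apply: mulr_gt0; [apply: mulr_gt0|apply: exprn_gt0].
have tau0 : 0 < tau by apply: divr_gt0 => //; apply: exprn_gt0.
have c1le : c1 <= 1.
  have h12 : 0 < 12 * C%:R :> R by apply: mulr_gt0.
  rewrite /c1 /giant_density ler_pdivrMr // mul1r.
  have pw : 1 <= 2 ^+ K :> R by rewrite exprn_ege1 // ler1n.
  have pw0 : 0 < 2 ^+ K :> R by rewrite exprn_gt0.
  rewrite /cK ler_pdivrMr //; apply: (le_trans f4); exact: mulr_ege1.
have tau2 : tau <= 1 / 2.
  have n1 : 1 <= n%:R ^+ g.+1 :> R by rewrite exprn_ege1 // (le_trans _ n2) // ler1n.
  have cc : c1 ^+ 2 <= 1 by rewrite exprn_ile1 // ltW.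
  rewrite /tau ler_pdivrMr //; apply: (le_trans cc).
  have -> : 1 / 2 * (2 * C%:R * n%:R ^+ g.+1) = C%:R * n%:R ^+ g.+1 :> R by field.
  exact: mulr_ege1.
have tauC : tau * (n * C)%:R <= (n%:R ^+ g)^-1 * c1 ^+ 2 / 2.
  rewrite /tau natrM (exprS n%:R g) le_eqVlt; apply/orP; left; apply/eqP.
  have ng0 : n%:R ^+ g != 0 :> R by rewrite expf_neq0 // lt0r_neq0.
  by move: ng0; move: (n%:R ^+ g : R) => z z0; field; rewrite z0 !lt0r_neq0.
have := sprinkling_bound G2 deg1 degC C1 m_le_n (edge_prob01 (G := cart_prod G) p101) q1E p101 al01 pN
  km kle mpos al0 (edge_prob01 (G := cart_prod G) p201) q2E p201 iota0 isoG
  low_degree_count tau0 tau2 tauC.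
rewrite -/cK -/c1 => bound.
rewrite perc_probE.
have -> : edge_prob (G := cart_prod G) p =
    fun E => 1 - (1 - edge_prob (G := cart_prod G) p1 E) * (1 - edge_prob (G := cart_prod G) p2 E).
  apply: boolp.funext => E; rewrite /edge_prob; case: ifP => _; last by rewrite !subr0 mul1r subrr.
  by rewrite -pE opprB addrC subrK.
apply: le_trans (le_trans bound _); last first.
  apply: Pr_le => [E|F /existsP[v big]].
    by apply: union_prob01; apply: edge_prob01.
  apply: (@L1_ge _ (cart_prod G) F _ v); apply: (le_trans big); rewrite ler_nat.
  by rewrite (cluster_ext F v (@adj_in_setT _ G)).
rewrite lerD2l lerN2 /supercritical_error [leRHS]mulrDl; apply: lerD.
  exact: sparse_error.
apply: merging_error; rewrite -natrX ler_nat.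
exact: card_product_ge.
Qed.

End LargeDimension.

Lemma supercritical_cvg (gamma : R) (G : forall n : nat, 'I_n -> sgraph) :
  gamma <= g%:R -> admissible_factors gamma C G ->
  ((fun n : nat => perc_prob (cart_prod (G n)) ((1 + eps) / avg_degree (cart_prod (G n)) R)
     (fun H : sgraph => giant_density * #|cart_prod (G n)|%:R <= (L1 H)%:R)) @ \oo --> (1 : R))%classic.
Proof.
move=> gg adm.
pose N0 : R := 2 + 32 / eps + 2 / delta + 16 / (k * delta) + 2 / (cs * kappa).
have b1 : 0 <= 32 / eps by apply/ltW/divr_gt0.
have b2 : 0 <= 2 / delta by apply/ltW/divr_gt0.
have b3 : 0 <= 16 / (k * delta) by apply/ltW/divr_gt0 => //; apply: mulr_gt0.
have b4 : 0 <= 2 / (cs * kappa) by apply/ltW/divr_gt0 => //; apply: mulr_gt0.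
apply: (@cvg_one_of_harmonic_error _ _ supercritical_error (Num.truncn N0).+1) => n nN.
have nN0 : N0 <= n%:R.
  apply: (@le_trans _ _ (Num.truncn N0).+1%:R); last by rewrite ler_nat.
  have N00 : 0 <= N0 by do !apply: addr_ge0 => //.
  by have /andP[_ /ltW] := truncn_itv N00.
have G2 (i : 'I_n) := factor_card adm i.
have deg1 i (x : G n i) := factor_deg_ge1 adm x.
have degC i (x : G n i) := factor_deg_le adm x.
have [n2 ne nd nk ncs] : [/\ 2 <= n%:R :> R, 32 / eps <= n%:R, 2 / delta <= n%:R,
    16 / (k * delta) <= n%:R & 2 / (cs * kappa) <= n%:R].
  move: nN0 b1 b2 b3 b4; rewrite /N0.
  move: (32 / eps) (2 / delta) (16 / _) (2 / (cs * _)) => z1 z2 z3 z4 *.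
  by split; lra.
have n0 : (0 < n)%N by rewrite -(ltr0n R) (lt_le_trans _ n2).
have isoG (i : 'I_n) (S : {set G n i}) : (n%:R ^+ g)^-1 * #|S|%:R * #|~: S|%:R <=
    #|G n i|%:R * #|arcs_out (@adj (G n i)) S|%:R :> R.
  apply: le_trans (factor_iso adm S); rewrite -!mulrA ler_wpM2r ?mulr_ge0 //.
  rewrite -powR_mulrn // -powRN ler_powR ?lerN2 // ler1n //.
apply/andP; split; first exact: supercritical_perc.
rewrite perc_probE; apply: Pr_le1; apply: edge_prob01.
by have [] := sprinkling_params (G := G n) G2 deg1 n2.
Qed.

End SupercriticalLimit.

Local Open Scope classical_set_scope.
Local Open Scope ring_scope.

Theorem theorem1p1 (R : realType) (gamma : R) (C : nat) (eps : R)
    (gamma_gt0 : 0 < gamma) (C_ge1 : (1 <= C)%N)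
    (eps_gt0 : 0 < eps) (eps_lt1 : eps < 1) :
  (forall G : forall n : nat, 'I_n -> sgraph, admissible_factors gamma C G ->
     (fun n : nat =>
        perc_prob (cart_prod (G n))
          ((1 - eps) / avg_degree (cart_prod (G n)) R)
          (fun H : sgraph =>
             (L1 H)%:R <= expR (- (eps ^+ 2 * n%:R / (9 * C%:R ^+ 2)))
                          * #|cart_prod (G n)|%:R))
       @ \oo --> (1 : R))
  /\
  (exists2 c1 : R, 0 < c1 &
   forall G : forall n : nat, 'I_n -> sgraph, admissible_factors gamma C G ->
     (fun n : nat =>
        perc_prob (cart_prod (G n))
          ((1 + eps) / avg_degree (cart_prod (G n)) R)
          (fun H : sgraph => c1 * #|cart_prod (G n)|%:R <= (L1 H)%:R))
       @ \oo --> (1 : R)).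
Proof.
split=> [G|]; first exact: subcritical_cvg.
(* Rounding [gamma] up to an integer weakens the isoperimetric bound to [n ^ -g] and makes the
   number of blocks a function of [gamma] alone. *)
have gg : gamma <= (Num.truncn gamma).+1%:R.
  by have /andP[_ /ltW] := truncn_itv (ltW gamma_gt0).
exists (giant_density C (Num.truncn gamma).+1 eps); first exact: giant_density_gt0.
by move=> G; apply: supercritical_cvg.
Qed.
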